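(* Consider the class of equations $$u_t+uu_x+\alpha(t)u+\beta(t)u_{xxxxx}=0,\qquad \beta\neq0,$$ where $\alpha,\beta$ are smooth functions of $t$ (the arbitrary elements of the class). The generalized extended equivalence group $\hat G^{\sim}$ of this class is formed by the transformations $$\tilde t=T(t),\quad \tilde x=(x+\delta_1)X^1+\delta_2,\quad \tilde u=\frac{1}{T_t}\left(X^1u+X^1_t(x+\delta_1)\right),$$ $$\tilde\alpha(\tilde t)=\frac1{T_t}\left(\alpha(t)-2\frac{X^1_t}{X^1}+\frac{T_{tt}}{T_t}\right),\qquad \tilde\beta(\tilde t)=\frac{(X^1)^5}{T_t}\,\beta(t),$$ where $$X^1=\left(\delta_3\int e^{-\int\alpha(t)\,dt}\,dt+\delta_4\right)^{-1},$$ $\delta_j$, $j=1,\dots,4$, are arbitrary constants with $(\delta_3,\delta_4)\neq(0,0)$, and $T=T(t)$ is a smooth function with $T_t\neq0$. The entire set of admissible transformations of the class is generated by the transformations from the group $\hat G^{\sim}$.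
   Context: Subscripts $t$ and $x$ denote derivatives. An equation of the class with coefficients $(\alpha,\beta)$ in the variables $(t,x,u)$ is mapped to the equation $\tilde u_{\tilde t}+\tilde u\tilde u_{\tilde x}+\tilde\alpha(\tilde t)\tilde u+\tilde\beta(\tilde t)\tilde u_{\tilde x\tilde x\tilde x\tilde x\tilde x}=0$ of the same class. An admissible transformation of a class of differential equations is a triple consisting of two fixed equations of the class and a nondegenerate point transformation of $(t,x,u)$ linking these equations. An equivalence transformation of the class is a transformation of the variables and arbitrary elements that maps every equation of the class to an equation of the same class; in the generalized extended equivalence group the components for the variables $(t,x,u)$ are allowed to depend on the arbitrary elements (generalized), possibly nonlocally, e.g. through integrals of arbitrary elements (extended). That the set of admissible transformations is generated by the group means that the point transformation in each admissible transformation is obtained from an element of the group by fixing the arbitrary elements to be those of the initial equation.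
   Formalization: The displayed transformations are not closed under composition (the Galilean boost x+ct, u+c for α=0 is missing), so the group is taken to be all finite composites of them, and admissible transformations are shown to coincide with such composites locally, near each point. *)

(* Defs.v *)
From Stdlib Require Import Reals List.
From Coquelicot Require Import Coquelicot.
Open Scope R_scope.

(* Stdlib reals with Coquelicot.  Points of the (t,x)-plane and of the
   (t,x,u)-space are tuples; functions of several variables are curried. *)

Definition dt (u : R -> R -> R) (t x : R) : R := Derive (fun s => u s x) t.
Definition dx (u : R -> R -> R) (t x : R) : R := Derive (fun y => u t y) x.

Definition dt3 (f : R -> R -> R -> R) (t x u : R) : R := Derive (fun s => f s x u) t.
Definition dx3 (f : R -> R -> R -> R) (t x u : R) : R := Derive (fun y => f t y u) x.
Definition du3 (f : R -> R -> R -> R) (t x u : R) : R := Derive (fun z => f t x z) u.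

(* The sets D below are always open, so the iterated (total) derivatives are
   the genuine ones: on D they do not depend on the values outside D. *)
Definition smooth1 (D : R -> Prop) (f : R -> R) : Prop :=
  forall (n : nat) (t : R), D t -> ex_derive_n f n t.

Fixpoint Ck2 (k : nat) (D : R * R -> Prop) (f : R -> R -> R) : Prop :=
  (forall p, D p -> continuous (fun q : R * R => f (fst q) (snd q)) p) /\
  match k with
  | O => True
  | S m =>
      (forall t x, D (t, x) ->
         ex_derive (fun s => f s x) t /\ ex_derive (fun y => f t y) x) /\
      Ck2 m D (dt f) /\ Ck2 m D (dx f)
  end.

Definition smooth2 (D : R * R -> Prop) (f : R -> R -> R) : Prop :=
  forall k, Ck2 k D f.

Fixpoint Ck3 (k : nat) (D : R * R * R -> Prop) (f : R -> R -> R -> R) : Prop :=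
  (forall p, D p ->
     continuous (fun q : R * R * R => f (fst (fst q)) (snd (fst q)) (snd q)) p) /\
  match k with
  | O => True
  | S m =>
      (forall t x u, D (t, x, u) ->
         ex_derive (fun s => f s x u) t /\ ex_derive (fun y => f t y u) x /\
         ex_derive (fun z => f t x z) u) /\
      Ck3 m D (dt3 f) /\ Ck3 m D (dx3 f) /\ Ck3 m D (du3 f)
  end.

Definition smooth3 (D : R * R * R -> Prop) (f : R -> R -> R -> R) : Prop :=
  forall k, Ck3 k D f.

Definition open_interval (J : R -> Prop) : Prop :=
  open J /\ (exists t, J t) /\
  (forall a b c, J a -> J b -> a <= c <= b -> J c).

(* The equation u_t + u u_x + alpha(t) u + beta(t) u_xxxxx = 0 for t in dom. *)
Record equation := Equation {
  dom : R -> Prop;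
  alpha : R -> R;
  beta : R -> R }.

Definition in_class (E : equation) : Prop :=
  open_interval (dom E) /\ smooth1 (dom E) (alpha E) /\ smooth1 (dom E) (beta E) /\
  (forall t, dom E t -> beta E t <> 0).

Definition residual (E : equation) (u : R -> R -> R) (t x : R) : R :=
  dt u t x + u t x * dx u t x + alpha E t * u t x
  + beta E t * Derive_n (fun y => u t y) 5 x.

Definition restrict (E : equation) (J : R -> Prop) : equation :=
  Equation J (alpha E) (beta E).

Record transformation := Transformation {
  Omega : R * R * R -> Prop;
  Tt : R -> R -> R -> R;
  Xt : R -> R -> R -> R;
  Ut : R -> R -> R -> R }.

Definition jacobian (phi : transformation) (t x u : R) : R :=
  let T := Tt phi in let X := Xt phi in let U := Ut phi in
    dt3 T t x u * (dx3 X t x u * du3 U t x u - du3 X t x u * dx3 U t x u)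
  - dx3 T t x u * (dt3 X t x u * du3 U t x u - du3 X t x u * dt3 U t x u)
  + du3 T t x u * (dt3 X t x u * dx3 U t x u - dx3 X t x u * dt3 U t x u).

Definition point_transformation (phi : transformation) : Prop :=
  open (Omega phi) /\ (exists p, Omega phi p) /\
  smooth3 (Omega phi) (Tt phi) /\ smooth3 (Omega phi) (Xt phi) /\
  smooth3 (Omega phi) (Ut phi) /\
  (forall t x u, Omega phi (t, x, u) -> jacobian phi t x u <> 0).

(* phi maps E to E' : the prolongation of phi to the fifth-order jets carries
   the manifold E onto E'.  Every jet is the jet of a smooth function u, and the
   prolonged transformation sends it to the jet of the transformed function v,
   defined near the image point when D(T,X)/D(t,x), taken along u, is nonzero. *)
Definition maps (E E' : equation) (phi : transformation) : Prop :=
  forall (D D' : R * R -> Prop) (u v : R -> R -> R) (t x : R),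
    let Tu := fun s y => Tt phi s y (u s y) in
    let Xu := fun s y => Xt phi s y (u s y) in
    let Uu := fun s y => Ut phi s y (u s y) in
    open D -> smooth2 D u -> open D' -> smooth2 D' v ->
    (forall s y, D (s, y) ->
       Omega phi (s, y, u s y) /\ D' (Tu s y, Xu s y) /\
       v (Tu s y) (Xu s y) = Uu s y) ->
    D (t, x) ->
    dt Tu t x * dx Xu t x - dx Tu t x * dt Xu t x <> 0 ->
    (residual E u t x = 0 <-> residual E' v (Tu t x) (Xu t x) = 0).

Definition admissible (E : equation) (phi : transformation) (E' : equation) : Prop :=
  in_class E /\ in_class E' /\ point_transformation phi /\
  (forall t x u, Omega phi (t, x, u) -> dom E t /\ dom E' (Tt phi t x u)) /\
  maps E E' phi.

(* A transformation of the variables and of the arbitrary elements whose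
   (t,x,u)-components may depend, possibly nonlocally, on the arbitrary
   elements: it assigns to each equation a transformation of (t,x,u) and a
   transformed equation. *)
Definition equivalence_transformation
    (G : equation -> transformation * equation) : Prop :=
  forall E, in_class E -> admissible E (fst (G E)) (snd (G E)).

Record parameters := MkParameters {
  tau : R -> R;
  delta1 : R;
  delta2 : R;
  delta3 : R;
  delta4 : R }.

(* A and B are antiderivatives of alpha and exp(-A); the choice of the constants
   of integration is immaterial, as it only changes delta3 and delta4. *)
Definition regular (g : parameters) (E : equation) (A B : R -> R) : Prop :=
  (delta3 g, delta4 g) <> (0, 0) /\
  smooth1 (dom E) (tau g) /\
  (forall t, dom E t ->
     is_derive A t (alpha E t) /\ is_derive B t (exp (- A t)) /\
     Derive (tau g) t <> 0 /\ delta3 g * B t + delta4 g <> 0).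

Definition X1 (g : parameters) (B : R -> R) (t : R) : R :=
  / (delta3 g * B t + delta4 g).

Definition variables_part (g : parameters) (E : equation) (B : R -> R) : transformation :=
  Transformation
    (fun p => dom E (fst (fst p)))
    (fun t x u => tau g t)
    (fun t x u => (x + delta1 g) * X1 g B t + delta2 g)
    (fun t x u => / Derive (tau g) t * (X1 g B t * u + Derive (X1 g B) t * (x + delta1 g))).

Definition elements_part (g : parameters) (E : equation) (B : R -> R)
    (E' : equation) : Prop :=
  (forall s, dom E' s <-> exists t, dom E t /\ s = tau g t) /\
  (forall t, dom E t ->
     alpha E' (tau g t) =
       / Derive (tau g) t *
       (alpha E t - 2 * (Derive (X1 g B) t / X1 g B t)
        + Derive_n (tau g) 2 t / Derive (tau g) t) /\
     beta E' (tau g t) = X1 g B t ^ 5 / Derive (tau g) t * beta E t).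

(* The transformation with parameters g, for the arbitrary elements of E. *)
Definition generator (g : parameters) (E : equation) (phi : transformation)
    (E' : equation) : Prop :=
  exists A B : R -> R,
    regular g E A B /\ phi = variables_part g E B /\ elements_part g E B E'.

Definition identity_on (E : equation) : transformation :=
  Transformation (fun p => dom E (fst (fst p)))
    (fun t x u => t) (fun t x u => x) (fun t x u => u).

Definition compose (psi phi : transformation) : transformation :=
  Transformation
    (fun p => let '(t, x, u) := p in
       Omega phi (t, x, u) /\
       Omega psi (Tt phi t x u, Xt phi t x u, Ut phi t x u))
    (fun t x u => Tt psi (Tt phi t x u) (Xt phi t x u) (Ut phi t x u))
    (fun t x u => Xt psi (Tt phi t x u) (Xt phi t x u) (Ut phi t x u))
    (fun t x u => Ut psi (Tt phi t x u) (Xt phi t x u) (Ut phi t x u)).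

(* The group formed by the generators.  The inverse of a generator (for the
   transformed equation) is a generator, but a composite of two generators need
   not be one: with T(t) = t in both, the Galilean boost x + B(t), u + exp(-A(t))
   is the composite of x / B(t) + 1 and its counterpart x B(t) for the
   transformed equation, while it is not itself of the form (x + delta1) X^1 + delta2.
   Elements of the group are hence finite composites, represented by the lists
   of their parameters; [acts w E phi E'] says that fixing the arbitrary elements
   to be those of E in the element w yields phi and the transformed equation E'. *)
Definition group_element := list parameters.

Fixpoint acts (w : group_element) (E : equation) (phi : transformation)
    (E' : equation) : Prop :=
  match w with
  | nil => phi = identity_on E /\ E' = E
  | g :: w' =>
      exists (phi1 : transformation) (E1 : equation) (phi2 : transformation),
        generator g E phi1 E1 /\ acts w' E1 phi2 E' /\ phi = compose phi2 phi1
  end.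

(* Point transformations are local: near each point of its domain, phi is
   obtained from an element of the group by fixing the arbitrary elements. *)
Definition generated (E : equation) (phi : transformation) (E' : equation) : Prop :=
  forall t x u, Omega phi (t, x, u) ->
  exists (w : group_element) (J : R -> Prop) (psi : transformation) (E1 : equation),
    open_interval J /\ J t /\ (forall s, J s -> dom E s) /\
    acts w (restrict E J) psi E1 /\
    (forall s, dom E1 s ->
       dom E' s /\ alpha E' s = alpha E1 s /\ beta E' s = beta E1 s) /\
    locally (t, x, u) (fun q : R * R * R => let '(s, y, z) := q in
       Omega phi (s, y, z) /\ Omega psi (s, y, z) /\
       Tt phi s y z = Tt psi s y z /\
       Xt phi s y z = Xt psi s y z /\
       Ut phi s y z = Ut psi s y z).

(* Main.v *)
Require Import Defs.
From Stdlib Require Import Reals.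
From Coquelicot Require Import Coquelicot.
From Stdlib Require Import Lra Lia Factorial List ClassicalEpsilon Ranalysis5.
Import ListNotations.
Open Scope R_scope.

(* An admissible transformation (T, X, U) is tested on polynomials v(T, X): the
   equation U = v(T, X) is solved for u(t, x) by the implicit function theorem, and
   if v satisfies the target equation at the image point, then u satisfies the
   initial one.  Two polynomials v that differ there by a perturbation that keeps
   the target equation thus give two functions u with the same value of
   u_t + u u_x + beta u_xxxxx, and the asymptotics of their difference in x
   isolates one determining equation:
     (T - T0)^5                                gives  T_x = T_u = 0,
     (X - X0)^5 - 120 beta' (T - T0)           gives  X_u = X_xx = 0 and beta',
     (X - X0)^4                                gives  U_xu = U_uu = 0,
     (X - X0) - U0 (T - T0)                    gives  U = (X_t + u X_x) / T_t.
   With X = xi1(t) x + xi0(t) the remaining conditions express alpha' and say that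
   1/xi1 = k B + c and that xi0' is a multiple of exp(-A) xi1^2.  Every such
   transformation is a composite of two generators, the first being
   x -> x / (B + b) with a constant b.  Conversely, transformations of this form
   are closed under composition, contain the generators, and are admissible by
   direct substitution. *)

(** * Functions of class C^k of three variables *)

(** The polynomial sits on the target side because the target residual can then be prescribed
    explicitly, while u comes from a scalar implicit equation; a polynomial u would require
    inverting the planar map (t, x) -> (T, X) to obtain v. The prolongation to fifth order is never
    expanded: two graphs through the same point differ by a function w of x, and a relation such as
    g^5 = k w + o(w) already fixes the fifth derivative of w. The tests build on one another, since
    each uses the earlier conclusions to evaluate the difference of the test functions along the
    graphs: T constant in (x, u), then X affine in x, then U affine in u. A single generator has xi0
    = delta1 xi1 + delta2, so it misses xi0 = B when xi1 is constant. After the preliminary map x ->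
    x / (B + b) the remaining scale factor (B + b) xi1 has derivative (c - k b) exp(-A) xi1^2, so
    every admissible xi0 is affine in that factor once c - k b is nonzero. *)

Lemma locally_R (x : R) (P : R -> Prop) :
  locally x P <-> exists d, 0 < d /\ forall y, Rabs (y - x) < d -> P y.
Proof.
split.
- intros [d Hd]. exists d. split. apply cond_pos. intros y Hy. apply Hd. exact Hy.
- intros [d [Hd H]]. exists (mkposreal d Hd). intros y Hy. apply H. exact Hy.
Qed.

Lemma locally_R2 (x y : R) (P : R * R -> Prop) :
  locally (x, y) P <-> exists d, 0 < d /\
    forall a b, Rabs (a - x) < d -> Rabs (b - y) < d -> P (a, b).
Proof.
split.
- intros [d Hd]. exists d. split. apply cond_pos. intros a b Ha Hb. apply Hd. split; assumption.
- intros [d [Hd H]]. exists (mkposreal d Hd). intros [a b] [Ha Hb]. apply H; assumption.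
Qed.

Lemma locally_R3 (x y z : R) (P : R * R * R -> Prop) :
  locally (x, y, z) P <-> exists d, 0 < d /\
    forall a b c, Rabs (a - x) < d -> Rabs (b - y) < d -> Rabs (c - z) < d -> P (a, b, c).
Proof.
split.
- intros [d Hd]. exists d. split. apply cond_pos. intros a b c Ha Hb Hc. apply Hd.
  split; [split |]; assumption.
- intros [d [Hd H]]. exists (mkposreal d Hd). intros [[a b] c] [[Ha Hb] Hc]. apply H; assumption.
Qed.

Lemma continuous_R {T : UniformSpace} (f : T -> R) (p : T) :
  continuous f p <-> forall e, 0 < e -> locally p (fun q => Rabs (f q - f p) < e).
Proof.
unfold continuous. split.
- intros H e He. apply (H (fun y => Rabs (y - f p) < e)).
  exists (mkposreal e He). intros y Hy. exact Hy.
- intros H P [e HP]. apply filter_imp with (2 := H e (cond_pos e)).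
  intros q Hq. apply HP. exact Hq.
Qed.

Lemma is_derive_R (f : R -> R) (x l : R) :
  is_derive f x l <-> forall e, 0 < e ->
    locally x (fun y => Rabs (f y - f x - l * (y - x)) <= e * Rabs (y - x)).
Proof.
split.
- intros [_ H] e He.
  specialize (H x (fun P HP => HP) (mkposreal e He)).
  apply filter_imp with (2 := H). intros y Hy.
  unfold norm, minus, plus, opp, scal in Hy; simpl in Hy.
  unfold abs, mult in Hy; simpl in Hy.
  replace (f y - f x - l * (y - x)) with (f y + - f x + - ((y + - x) * l)) by ring.
  exact Hy.
- intro H. split. apply is_linear_scal_l.
  intros z Hz. assert (E : x = z) by (apply (is_filter_lim_locally_unique (K := R_AbsRing) (V := R_NormedModule)); exact Hz).
  subst z. intro e.
  apply filter_imp with (2 := H e (cond_pos e)). intros y Hy.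
  unfold norm, minus, plus, opp, scal; simpl. unfold abs, mult; simpl.
  replace (f y + - f x + - ((y + - x) * l)) with (f y - f x - l * (y - x)) by ring.
  exact Hy.
Qed.

Lemma mean_value_slope (f df : R -> R) (a b l e : R) :
  (forall x, Rmin a b <= x <= Rmax a b -> is_derive f x (df x)) ->
  (forall x, Rmin a b <= x <= Rmax a b -> Rabs (df x - l) <= e) ->
  Rabs (f b - f a - l * (b - a)) <= e * Rabs (b - a).
Proof.
intros Hd He.
destruct (MVT_gen f a b df) as [c [Hc E]].
- intros x Hx. apply Hd. lra.
- intros x Hx. apply continuity_pt_filterlim. apply @ex_derive_continuous. exists (df x). now apply Hd.
- rewrite E. replace (df c * (b - a) - l * (b - a)) with ((df c - l) * (b - a)) by ring.
  rewrite Rabs_mult. apply Rmult_le_compat_r. apply Rabs_pos. now apply He.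
Qed.

Lemma between_close (a b x0 d x : R) : Rmin a b <= x <= Rmax a b ->
  Rabs (a - x0) < d -> Rabs (b - x0) < d -> Rabs (x - x0) < d.
Proof.
intros Hx Ha Hb. apply Rabs_def2 in Ha. apply Rabs_def2 in Hb.
unfold Rmin, Rmax in Hx. destruct (Rle_dec a b); apply Rabs_def1; lra.
Qed.

Lemma open_box (D : R * R * R -> Prop) (t x u : R) : open D -> D (t, x, u) ->
  exists d, 0 < d /\ forall a b c,
    Rabs (a - t) < d -> Rabs (b - x) < d -> Rabs (c - u) < d -> D (a, b, c).
Proof. intros HD Hp. apply locally_R3, HD, Hp. Qed.

Lemma Ck3_continuous k D f t x u : Ck3 k D f -> D (t, x, u) ->
  forall e, 0 < e -> exists d, 0 < d /\ forall a b c,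
    Rabs (a - t) < d -> Rabs (b - x) < d -> Rabs (c - u) < d -> Rabs (f a b c - f t x u) < e.
Proof.
intros H Hp e He.
assert (C : continuous (fun q : R * R * R => f (fst (fst q)) (snd (fst q)) (snd q)) (t, x, u)).
{ destruct k; now apply H. }
rewrite continuous_R in C. now apply C, locally_R3 in He.
Qed.

(** Strict differentiability: both endpoints vary, and the base point need not be one of them. The
    increment is split along the coordinate axes, and continuity of the partial derivatives at the
    base point makes the three mean value estimates uniform. This form allows two graphs through one
    point to be compared with each other. *)
Lemma Ck3_strict k D f t x u : open D -> Ck3 (S k) D f -> D (t, x, u) ->
  forall e, 0 < e -> exists d, 0 < d /\ forall a b c a' b' c',
    Rabs (a - t) < d -> Rabs (b - x) < d -> Rabs (c - u) < d ->
    Rabs (a' - t) < d -> Rabs (b' - x) < d -> Rabs (c' - u) < d ->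
    Rabs (f a' b' c' - f a b c - (dt3 f t x u * (a' - a) + dx3 f t x u * (b' - b)
      + du3 f t x u * (c' - c)))
    <= e * (Rabs (a' - a) + Rabs (b' - b) + Rabs (c' - c)).
Proof.
intros HD [_ [Hd [Ht [Hx Hu]]]] Hp e He.
destruct (open_box _ _ _ _ HD Hp) as [d0 [Hd0 B]].
destruct (Ck3_continuous _ _ _ _ _ _ Ht Hp e He) as [d1 [Hd1 C1]].
destruct (Ck3_continuous _ _ _ _ _ _ Hx Hp e He) as [d2 [Hd2 C2]].
destruct (Ck3_continuous _ _ _ _ _ _ Hu Hp e He) as [d3 [Hd3 C3]].
exists (Rmin (Rmin d0 d1) (Rmin d2 d3)). split.
{ repeat apply Rmin_glb_lt; assumption. }
assert (M : forall r, r < Rmin (Rmin d0 d1) (Rmin d2 d3) -> r < d0 /\ r < d1 /\ r < d2 /\ r < d3).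
{ intros r Hr. generalize (Rmin_l (Rmin d0 d1) (Rmin d2 d3)) (Rmin_r (Rmin d0 d1) (Rmin d2 d3))
   (Rmin_l d0 d1) (Rmin_r d0 d1) (Rmin_l d2 d3) (Rmin_r d2 d3). lra. }
intros a b c a' b' c' Ha Hb Hc Ha' Hb' Hc'.
assert (S1 : Rabs (f a' b' c' - f a b' c' - dt3 f t x u * (a' - a)) <= e * Rabs (a' - a)).
{ apply (mean_value_slope (fun s => f s b' c') (fun s => dt3 f s b' c')).
  - intros s Hs. apply (between_close _ _ t _ _ Hs Ha) in Ha'. apply M in Ha', Hb', Hc'.
    unfold dt3. apply Derive_correct. apply (Hd s b' c'). apply B; [apply Ha' | apply Hb' | apply Hc'].
  - intros s Hs. apply (between_close _ _ t _ _ Hs Ha) in Ha'. apply M in Ha', Hb', Hc'.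
    left. apply C1; [apply Ha' | apply Hb' | apply Hc']. }
assert (S2 : Rabs (f a b' c' - f a b c' - dx3 f t x u * (b' - b)) <= e * Rabs (b' - b)).
{ apply (mean_value_slope (fun s => f a s c') (fun s => dx3 f a s c')).
  - intros s Hs. apply (between_close _ _ x _ _ Hs Hb) in Hb'. apply M in Ha, Hb', Hc'.
    unfold dx3. apply Derive_correct. apply (Hd a s c'). apply B; [apply Ha | apply Hb' | apply Hc'].
  - intros s Hs. apply (between_close _ _ x _ _ Hs Hb) in Hb'. apply M in Ha, Hb', Hc'.
    left. apply C2; [apply Ha | apply Hb' | apply Hc']. }
assert (S3 : Rabs (f a b c' - f a b c - du3 f t x u * (c' - c)) <= e * Rabs (c' - c)).
{ apply (mean_value_slope (fun s => f a b s) (fun s => du3 f a b s)).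
  - intros s Hs. apply (between_close _ _ u _ _ Hs Hc) in Hc'. apply M in Ha, Hb, Hc'.
    unfold du3. apply Derive_correct. apply (Hd a b s). apply B; [apply Ha | apply Hb | apply Hc'].
  - intros s Hs. apply (between_close _ _ u _ _ Hs Hc) in Hc'. apply M in Ha, Hb, Hc'.
    left. apply C3; [apply Ha | apply Hb | apply Hc']. }
replace (f a' b' c' - f a b c - (dt3 f t x u * (a' - a) + dx3 f t x u * (b' - b)
      + du3 f t x u * (c' - c))) with
 ((f a' b' c' - f a b' c' - dt3 f t x u * (a' - a)) + (f a b' c' - f a b c' - dx3 f t x u * (b' - b))
 + (f a b c' - f a b c - du3 f t x u * (c' - c))) by ring.
eapply Rle_trans. apply Rabs_triang. eapply Rle_trans. apply Rplus_le_compat_r, Rabs_triang.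
lra.
Qed.

Lemma is_derive_lipschitz (f : R -> R) (x l : R) : is_derive f x l ->
  locally x (fun y => Rabs (f y - f x) <= (Rabs l + 1) * Rabs (y - x)).
Proof.
intro H. rewrite is_derive_R in H. apply filter_imp with (2 := H 1 Rlt_0_1).
intros y Hy. replace (f y - f x) with ((f y - f x - l * (y - x)) + l * (y - x)) by ring.
eapply Rle_trans. apply Rabs_triang. rewrite Rabs_mult. lra.
Qed.

Lemma is_derive_close (f : R -> R) (x l d : R) : is_derive f x l -> 0 < d ->
  locally x (fun y => Rabs (f y - f x) < d).
Proof.
intros H Hd. apply continuous_R with (f := f); trivial.
apply @ex_derive_continuous. now exists l.
Qed.

Lemma chain_rule3 k D f (a b c : R -> R) s a1 b1 c1 :
  open D -> Ck3 (S k) D f -> D (a s, b s, c s) ->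
  is_derive a s a1 -> is_derive b s b1 -> is_derive c s c1 ->
  is_derive (fun r => f (a r) (b r) (c r)) s
    (dt3 f (a s) (b s) (c s) * a1 + dx3 f (a s) (b s) (c s) * b1 + du3 f (a s) (b s) (c s) * c1).
Proof.
intros HD HC Hp Ha Hb Hc. apply is_derive_R. intros e He.
set (ft := dt3 f (a s) (b s) (c s)). set (fx := dx3 f (a s) (b s) (c s)).
set (fu := du3 f (a s) (b s) (c s)).
(* [K] bounds the sum of the three increments relative to r - s, and [K'] dominates the sum of the
   absolute partial derivatives; each of the two error terms gets e / 2. *)
set (K := Rabs a1 + 1 + (Rabs b1 + 1) + (Rabs c1 + 1)).
set (K' := Rabs ft + Rabs fx + Rabs fu + 1).
assert (HK : 0 < K) by (unfold K; generalize (Rabs_pos a1) (Rabs_pos b1) (Rabs_pos c1); lra).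
assert (HK' : 0 < K') by (unfold K'; generalize (Rabs_pos ft) (Rabs_pos fx) (Rabs_pos fu); lra).
assert (He1 : 0 < e / 2 / K) by (repeat apply Rdiv_lt_0_compat; lra).
assert (He2 : 0 < e / 2 / K') by (repeat apply Rdiv_lt_0_compat; lra).
destruct (Ck3_strict _ _ _ _ _ _ HD HC Hp _ He1) as [d [Hd St]].
generalize (filter_and _ _ (filter_and _ _ (is_derive_close _ _ _ _ Ha Hd)
  (filter_and _ _ (is_derive_close _ _ _ _ Hb Hd) (is_derive_close _ _ _ _ Hc Hd)))
  (filter_and _ _ (filter_and _ _ (is_derive_lipschitz _ _ _ Ha)
  (filter_and _ _ (is_derive_lipschitz _ _ _ Hb) (is_derive_lipschitz _ _ _ Hc)))
  (filter_and _ _ (proj1 (is_derive_R _ _ _) Ha _ He2)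
  (filter_and _ _ (proj1 (is_derive_R _ _ _) Hb _ He2) (proj1 (is_derive_R _ _ _) Hc _ He2))))).
apply filter_imp. intros r [[Ca [Cb Cc]] [[La [Lb Lc]] [Da [Db Dc]]]].
assert (Z : forall y, Rabs (y - y) < d) by (intro y; rewrite Rminus_diag, Rabs_R0; trivial).
specialize (St _ _ _ _ _ _ (Z _) (Z _) (Z _) Ca Cb Cc). fold ft fx fu in St.
replace (f (a r) (b r) (c r) - f (a s) (b s) (c s) - (ft * a1 + fx * b1 + fu * c1) * (r - s))
  with ((f (a r) (b r) (c r) - f (a s) (b s) (c s) -
   (ft * (a r - a s) + fx * (b r - b s) + fu * (c r - c s))) +
   (ft * (a r - a s - a1 * (r - s)) + (fx * (b r - b s - b1 * (r - s)) + fu * (c r - c s - c1 * (r - s))))) by ring.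
set (h := Rabs (r - s)) in *.
assert (Hh : 0 <= h) by apply Rabs_pos.
assert (T1 : e / 2 / K * (Rabs (a r - a s) + Rabs (b r - b s) + Rabs (c r - c s)) <= e / 2 * h).
{ apply Rle_trans with (e / 2 / K * (K * h)).
  - apply Rmult_le_compat_l. lra. unfold K. lra.
  - right. field. lra. }
assert (T2 : Rabs (ft * (a r - a s - a1 * (r - s)) + (fx * (b r - b s - b1 * (r - s)) + fu * (c r - c s - c1 * (r - s)))) <= e / 2 * h).
{ eapply Rle_trans. apply Rabs_triang. eapply Rle_trans. apply Rplus_le_compat_l, Rabs_triang.
  rewrite !Rabs_mult.
  apply Rle_trans with (Rabs ft * (e / 2 / K' * h) + (Rabs fx * (e / 2 / K' * h) + Rabs fu * (e / 2 / K' * h))).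
  - repeat apply Rplus_le_compat; apply Rmult_le_compat_l; trivial; apply Rabs_pos.
  - apply Rle_trans with (K' * (e / 2 / K' * h)).
    + unfold K' at 4. assert (0 <= e / 2 / K' * h) by (apply Rmult_le_pos; lra). nra.
    + right. field. lra. }
eapply Rle_trans. apply Rabs_triang. lra.
Qed.

Lemma Ck3_S k D f : Ck3 (S k) D f -> Ck3 k D f.
Proof.
revert f. induction k as [|k IH]; intros f H.
- split; [apply H | trivial].
- split; [apply H|]. destruct H as [_ [H1 [H2 [H3 H4]]]].
  split; [exact H1|]. split; [|split]; apply IH; assumption.
Qed.

Lemma Ck3_sub k D D' f : (forall p, D' p -> D p) -> Ck3 k D f -> Ck3 k D' f.
Proof.
intro S. revert f. induction k as [|k IH]; intros f H.
- split; [intros p Hp; apply H, S, Hp | trivial].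
- destruct H as [H0 [H1 [H2 [H3 H4]]]].
  split; [intros p Hp; apply H0, S, Hp|].
  split; [intros; apply H1, S; assumption|]. split; [|split]; apply IH; assumption.
Qed.

Section Slots.
Variable D : R * R * R -> Prop.
Hypothesis HD : open D.

Lemma open_slot_t t x u : D (t, x, u) -> locally t (fun s => D (s, x, u)).
Proof.
intro H. apply HD, locally_R3 in H. destruct H as [d [Hd H]]. apply locally_R.
exists d. split; trivial. intros y Hy. apply H; rewrite ?Rminus_diag, ?Rabs_R0; trivial.
Qed.

Lemma open_slot_x t x u : D (t, x, u) -> locally x (fun s => D (t, s, u)).
Proof.
intro H. apply HD, locally_R3 in H. destruct H as [d [Hd H]]. apply locally_R.
exists d. split; trivial. intros y Hy. apply H; rewrite ?Rminus_diag, ?Rabs_R0; trivial.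
Qed.

Lemma open_slot_u t x u : D (t, x, u) -> locally u (fun s => D (t, x, s)).
Proof.
intro H. apply HD, locally_R3 in H. destruct H as [d [Hd H]]. apply locally_R.
exists d. split; trivial. intros y Hy. apply H; rewrite ?Rminus_diag, ?Rabs_R0; trivial.
Qed.

Lemma Ck3_ext k f g : (forall t x u, D (t, x, u) -> f t x u = g t x u) ->
  Ck3 k D f -> Ck3 k D g.
Proof.
revert f g. induction k as [|k IH]; intros f g E H.
- split; [|trivial]. intros [[t x] u] Hp.
  apply continuous_ext_loc with (2 := proj1 H _ Hp).
  apply filter_imp with (2 := HD _ Hp). intros [[a b] c]. apply E.
- destruct H as [H0 [H1 [H2 [H3 H4]]]]. split; [|split; [|split; [|split]]].
  + intros [[t x] u] Hp.
    apply continuous_ext_loc with (2 := H0 _ Hp).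
    apply filter_imp with (2 := HD _ Hp). intros [[a b] c]. apply E.
  + intros t x u Hp. destruct (H1 t x u Hp) as [A [B C]]. split; [|split].
    * apply ex_derive_ext_loc with (2 := A). apply filter_imp with (2 := open_slot_t _ _ _ Hp). intros; now apply E.
    * apply ex_derive_ext_loc with (2 := B). apply filter_imp with (2 := open_slot_x _ _ _ Hp). intros; now apply E.
    * apply ex_derive_ext_loc with (2 := C). apply filter_imp with (2 := open_slot_u _ _ _ Hp). intros; now apply E.
  + apply IH with (2 := H2). intros t x u Hp. apply Derive_ext_loc.
    apply filter_imp with (2 := open_slot_t _ _ _ Hp). intros; now apply E.
  + apply IH with (2 := H3). intros t x u Hp. apply Derive_ext_loc.
    apply filter_imp with (2 := open_slot_x _ _ _ Hp). intros; now apply E.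
  + apply IH with (2 := H4). intros t x u Hp. apply Derive_ext_loc.
    apply filter_imp with (2 := open_slot_u _ _ _ Hp). intros; now apply E.
Qed.

(** Replaces the total derivatives in the definition of [Ck3] by closed formulas that need to be
    correct on D only. *)
Lemma Ck3_intro k f ft fx fu :
  (forall p, D p -> continuous (fun q : R * R * R => f (fst (fst q)) (snd (fst q)) (snd q)) p) ->
  (forall t x u, D (t, x, u) -> is_derive (fun s => f s x u) t (ft t x u) /\
     is_derive (fun y => f t y u) x (fx t x u) /\ is_derive (fun z => f t x z) u (fu t x u)) ->
  Ck3 k D ft -> Ck3 k D fx -> Ck3 k D fu -> Ck3 (S k) D f.
Proof.
intros H0 H1 H2 H3 H4. split; [exact H0|]. split; [|split; [|split]].
- intros t x u Hp. destruct (H1 t x u Hp) as [A [B C]]. split; [|split]; eexists; eassumption.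
- apply Ck3_ext with (2 := H2). intros t x u Hp. symmetry. apply is_derive_unique. now apply H1.
- apply Ck3_ext with (2 := H3). intros t x u Hp. symmetry. apply is_derive_unique. now apply H1.
- apply Ck3_ext with (2 := H4). intros t x u Hp. symmetry. apply is_derive_unique. now apply H1.
Qed.

Lemma Ck3_derivs k f t x u : Ck3 (S k) D f -> D (t, x, u) ->
  is_derive (fun s => f s x u) t (dt3 f t x u) /\
  is_derive (fun y => f t y u) x (dx3 f t x u) /\ is_derive (fun z => f t x z) u (du3 f t x u).
Proof.
intros [_ [H _]] Hp. destruct (H t x u Hp) as [A [B C]].
split; [|split]; apply Derive_correct; assumption.
Qed.

Lemma Ck3_const k c : Ck3 k D (fun _ _ _ => c).
Proof.
revert c. induction k as [|k IH]; intro c.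
- split; trivial. intros. apply continuous_const.
- apply Ck3_intro with (fun _ _ _ => 0) (fun _ _ _ => 0) (fun _ _ _ => 0); trivial.
  + intros. apply continuous_const.
  + intros. split; [|split]; apply is_derive_Reals; apply derivable_pt_lim_const.
Qed.

Lemma Ck3_pr_t k : Ck3 k D (fun t _ _ => t).
Proof.
assert (C : forall p, D p -> continuous (fun q : R * R * R => fst (fst q)) p).
{ intros [[t x] u] Hp. apply continuous_R. intros e He. apply locally_R3. exists e. split; trivial. }
destruct k. now split.
apply Ck3_intro with (fun _ _ _ => 1) (fun _ _ _ => 0) (fun _ _ _ => 0); trivial; try apply Ck3_const.
intros. split; [|split]; apply is_derive_Reals; first [apply derivable_pt_lim_const | apply derivable_pt_lim_id].
Qed.

Lemma Ck3_pr_x k : Ck3 k D (fun _ x _ => x).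
Proof.
assert (C : forall p, D p -> continuous (fun q : R * R * R => snd (fst q)) p).
{ intros [[t x] u] Hp. apply continuous_R. intros e He. apply locally_R3. exists e. split; trivial. }
destruct k. now split.
apply Ck3_intro with (fun _ _ _ => 0) (fun _ _ _ => 1) (fun _ _ _ => 0); trivial; try apply Ck3_const.
intros. split; [|split]; apply is_derive_Reals; first [apply derivable_pt_lim_const | apply derivable_pt_lim_id].
Qed.

Lemma Ck3_pr_u k : Ck3 k D (fun _ _ u => u).
Proof.
assert (C : forall p, D p -> continuous (fun q : R * R * R => snd q) p).
{ intros [[t x] u] Hp. apply continuous_R. intros e He. apply locally_R3. exists e. split; trivial. }
destruct k. now split.
apply Ck3_intro with (fun _ _ _ => 0) (fun _ _ _ => 0) (fun _ _ _ => 1); trivial; try apply Ck3_const.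
intros. split; [|split]; apply is_derive_Reals; first [apply derivable_pt_lim_const | apply derivable_pt_lim_id].
Qed.

Lemma Ck3_plus k f g : Ck3 k D f -> Ck3 k D g -> Ck3 k D (fun t x u => f t x u + g t x u).
Proof.
revert f g. induction k as [|k IH]; intros f g Hf Hg.
- split; trivial. intros p Hp. apply (continuous_plus (V := R_NormedModule)); [now apply Hf | now apply Hg].
- apply Ck3_intro with (fun t x u => dt3 f t x u + dt3 g t x u) (fun t x u => dx3 f t x u + dx3 g t x u)
    (fun t x u => du3 f t x u + du3 g t x u).
  + intros p Hp. apply (continuous_plus (V := R_NormedModule)); [now apply Hf | now apply Hg].
  + intros t x u Hp. destruct (Ck3_derivs _ _ _ _ _ Hf Hp) as [A [B C]].
    destruct (Ck3_derivs _ _ _ _ _ Hg Hp) as [A' [B' C']].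
    split; [|split]; apply (is_derive_plus (V := R_NormedModule)); assumption.
  + apply IH; [apply Hf | apply Hg].
  + apply IH; [apply Hf | apply Hg].
  + apply IH; [apply Hf | apply Hg].
Qed.

Lemma Ck3_mult k f g : Ck3 k D f -> Ck3 k D g -> Ck3 k D (fun t x u => f t x u * g t x u).
Proof.
revert f g. induction k as [|k IH]; intros f g Hf Hg.
- split; trivial. intros p Hp. apply (continuous_mult (K := R_AbsRing)); [now apply Hf | now apply Hg].
- apply Ck3_intro with (fun t x u => dt3 f t x u * g t x u + f t x u * dt3 g t x u)
    (fun t x u => dx3 f t x u * g t x u + f t x u * dx3 g t x u)
    (fun t x u => du3 f t x u * g t x u + f t x u * du3 g t x u).
  + intros p Hp. apply (continuous_mult (K := R_AbsRing)); [now apply Hf | now apply Hg].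
  + intros t x u Hp. destruct (Ck3_derivs _ _ _ _ _ Hf Hp) as [A [B C]].
    destruct (Ck3_derivs _ _ _ _ _ Hg Hp) as [A' [B' C']].
    rewrite is_derive_Reals in A, B, C, A', B', C'.
    split; [|split].
    * apply is_derive_Reals. exact (derivable_pt_lim_mult _ _ _ _ _ A A').
    * apply is_derive_Reals. exact (derivable_pt_lim_mult _ _ _ _ _ B B').
    * apply is_derive_Reals. exact (derivable_pt_lim_mult _ _ _ _ _ C C').
  + apply Ck3_plus; apply IH; first [apply Hf | apply Hg | now apply Ck3_S].
  + apply Ck3_plus; apply IH; first [apply Hf | apply Hg | now apply Ck3_S].
  + apply Ck3_plus; apply IH; first [apply Hf | apply Hg | now apply Ck3_S].
Qed.

Lemma Ck3_opp k f : Ck3 k D f -> Ck3 k D (fun t x u => - f t x u).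
Proof.
intro H. apply Ck3_ext with (fun t x u => (-1) * f t x u).
intros; ring. apply Ck3_mult; trivial. apply Ck3_const.
Qed.

Lemma Ck3_minus k f g : Ck3 k D f -> Ck3 k D g -> Ck3 k D (fun t x u => f t x u - g t x u).
Proof. intros. apply Ck3_plus; trivial. now apply Ck3_opp. Qed.

Lemma Ck3_pow k f n : Ck3 k D f -> Ck3 k D (fun t x u => f t x u ^ n).
Proof. intro H. induction n; simpl. apply Ck3_const. now apply Ck3_mult. Qed.

Lemma Ck3_inv k f : (forall t x u, D (t, x, u) -> f t x u <> 0) -> Ck3 k D f ->
  Ck3 k D (fun t x u => / f t x u).
Proof.
intro N.
assert (Cn : forall j, Ck3 j D f -> forall p, D p ->
  continuous (fun q : R * R * R => / f (fst (fst q)) (snd (fst q)) (snd q)) p).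
{ intros j H [[t x] u] Hp.
  apply (continuous_comp (fun q : R * R * R => f (fst (fst q)) (snd (fst q)) (snd q)) Rinv).
  destruct j; now apply H. apply continuous_Rinv. now apply N. }
induction k as [|k IH]; intros Hf.
- split; trivial. now apply (Cn 0%nat).
- assert (I : Ck3 k D (fun t x u => / f t x u)) by (now apply IH, Ck3_S).
  apply Ck3_intro with (fun t x u => - (dt3 f t x u * (/ f t x u * / f t x u)))
    (fun t x u => - (dx3 f t x u * (/ f t x u * / f t x u)))
    (fun t x u => - (du3 f t x u * (/ f t x u * / f t x u))).
  + now apply (Cn (S k)).
  + intros t x u Hp. destruct (Ck3_derivs _ _ _ _ _ Hf Hp) as [A [B C]].
    generalize (N _ _ _ Hp). intro N0.
    split; [|split].
    * replace (- (dt3 f t x u * (/ f t x u * / f t x u))) with (- dt3 f t x u / f t x u ^ 2) by (field; trivial).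
      exact (is_derive_inv (fun s => f s x u) t _ A N0).
    * replace (- (dx3 f t x u * (/ f t x u * / f t x u))) with (- dx3 f t x u / f t x u ^ 2) by (field; trivial).
      exact (is_derive_inv (fun s => f t s u) x _ B N0).
    * replace (- (du3 f t x u * (/ f t x u * / f t x u))) with (- du3 f t x u / f t x u ^ 2) by (field; trivial).
      exact (is_derive_inv (fun s => f t x s) u _ C N0).
  + apply Ck3_opp. repeat apply Ck3_mult; trivial; apply Hf.
  + apply Ck3_opp. repeat apply Ck3_mult; trivial; apply Hf.
  + apply Ck3_opp. repeat apply Ck3_mult; trivial; apply Hf.
Qed.

Lemma Ck3_div k f g : (forall t x u, D (t, x, u) -> g t x u <> 0) -> Ck3 k D f -> Ck3 k D g ->
  Ck3 k D (fun t x u => f t x u / g t x u).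
Proof. intros. apply Ck3_mult; trivial. now apply Ck3_inv. Qed.

(** The outer function is smooth to all orders, so that the induction can pass to its partial
    derivatives, but the inner ones are only C^k: in the implicit function theorem the inner
    function is the solution whose regularity is being bootstrapped. *)
Lemma Ck3_comp k W f a b c : open W ->
  (forall j, Ck3 j W f) -> Ck3 k D a -> Ck3 k D b -> Ck3 k D c ->
  (forall t x u, D (t, x, u) -> W (a t x u, b t x u, c t x u)) ->
  Ck3 k D (fun t x u => f (a t x u) (b t x u) (c t x u)).
Proof.
intros HW Hf Ha Hb Hc Hm.
assert (Cn : forall g, Ck3 0 W g -> forall p, D p -> continuous (fun q : R * R * R =>
   g (a (fst (fst q)) (snd (fst q)) (snd q)) (b (fst (fst q)) (snd (fst q)) (snd q))
     (c (fst (fst q)) (snd (fst q)) (snd q))) p).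
{ intros g Hg [[t x] u] Hp. apply continuous_R. intros e He.
  destruct (Ck3_continuous _ _ _ _ _ _ Hg (Hm _ _ _ Hp) _ He) as [d [Hd C]].
  assert (Ca : continuous (fun q : R * R * R => a (fst (fst q)) (snd (fst q)) (snd q)) (t, x, u)) by (destruct k; now apply Ha).
  assert (Cb : continuous (fun q : R * R * R => b (fst (fst q)) (snd (fst q)) (snd q)) (t, x, u)) by (destruct k; now apply Hb).
  assert (Cc : continuous (fun q : R * R * R => c (fst (fst q)) (snd (fst q)) (snd q)) (t, x, u)) by (destruct k; now apply Hc).
  rewrite continuous_R in Ca, Cb, Cc.
  generalize (filter_and _ _ (Ca d Hd) (filter_and _ _ (Cb d Hd) (Cc d Hd))).
  apply filter_imp. intros q [A [B C']]. now apply C. }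
clear - HD HW Hf Ha Hb Hc Hm Cn.
revert f Hf. induction k as [|k IH]; intros f Hf.
- split; trivial. apply Cn. apply (Hf 0%nat).
- specialize (IH (Ck3_S _ _ _ Ha) (Ck3_S _ _ _ Hb) (Ck3_S _ _ _ Hc)).
  assert (I : forall g, (forall j, Ck3 j W g) -> Ck3 k D (fun t x u => g (a t x u) (b t x u) (c t x u)))
    by exact IH.
  assert (It := I (dt3 f) (fun j => proj1 (proj2 (proj2 (Hf (S j)))))).
  assert (Ix := I (dx3 f) (fun j => proj1 (proj2 (proj2 (proj2 (Hf (S j))))))).
  assert (Iu := I (du3 f) (fun j => proj2 (proj2 (proj2 (proj2 (Hf (S j))))))).
  apply Ck3_intro with
   (fun t x u => dt3 f (a t x u) (b t x u) (c t x u) * dt3 a t x u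
      + dx3 f (a t x u) (b t x u) (c t x u) * dt3 b t x u
      + du3 f (a t x u) (b t x u) (c t x u) * dt3 c t x u)
   (fun t x u => dt3 f (a t x u) (b t x u) (c t x u) * dx3 a t x u
      + dx3 f (a t x u) (b t x u) (c t x u) * dx3 b t x u
      + du3 f (a t x u) (b t x u) (c t x u) * dx3 c t x u)
   (fun t x u => dt3 f (a t x u) (b t x u) (c t x u) * du3 a t x u
      + dx3 f (a t x u) (b t x u) (c t x u) * du3 b t x u
      + du3 f (a t x u) (b t x u) (c t x u) * du3 c t x u).
  + apply Cn. apply (Hf 0%nat).
  + intros t x u Hp. destruct (Ck3_derivs _ _ _ _ _ Ha Hp) as [A1 [A2 A3]].
    destruct (Ck3_derivs _ _ _ _ _ Hb Hp) as [B1 [B2 B3]].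
    destruct (Ck3_derivs _ _ _ _ _ Hc Hp) as [C1 [C2 C3]].
    split; [|split].
    * apply (chain_rule3 0 W f (fun s => a s x u) (fun s => b s x u) (fun s => c s x u)); auto.
    * apply (chain_rule3 0 W f (fun s => a t s u) (fun s => b t s u) (fun s => c t s u)); auto.
    * apply (chain_rule3 0 W f (fun s => a t x s) (fun s => b t x s) (fun s => c t x s)); auto.
  + repeat apply Ck3_plus; apply Ck3_mult; trivial; first [apply Ha | apply Hb | apply Hc].
  + repeat apply Ck3_plus; apply Ck3_mult; trivial; first [apply Ha | apply Hb | apply Hc].
  + repeat apply Ck3_plus; apply Ck3_mult; trivial; first [apply Ha | apply Hb | apply Hc].
Qed.

End Slots.

(** * Transfer between functions of one, two and three variables *)

Lemma open_fst {T U : UniformSpace} (D : T -> Prop) : open D -> open (fun p : T * U => D (fst p)).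
Proof.
intros HD p Hp. destruct (HD _ Hp) as [e He]. exists e. intros q [Hq _]. now apply He.
Qed.

Lemma open_strip (J : R -> Prop) : open J -> open (fun p : R * R * R => J (fst (fst p))).
Proof. intro H. apply (open_fst (fun q : R * R => J (fst q))). now apply open_fst. Qed.

(** Functions of fewer variables are treated as functions of three variables that ignore the others,
    so that the C^k calculus is developed only once. *)
Lemma Ck2_of_Ck3 k D f : Ck3 k (fun p => D (fst p)) (fun t x _ => f t x) -> Ck2 k D f.
Proof.
revert f. induction k as [|k IH]; intros f H.
- split; trivial. intros [t x] Hp. apply continuous_R. intros e He.
  destruct (Ck3_continuous _ _ _ t x 0 H Hp e He) as [d [Hd C]].
  apply locally_R2. exists d. split; trivial. intros a b Ha Hb. simpl.
  apply (C a b 0 Ha Hb). now rewrite Rminus_diag, Rabs_R0.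
- assert (H' := Ck3_S _ _ _ H).
  destruct H as [_ [H1 [H2 [H3 _]]]]. apply IH in H'.
  split; [|split; [|split]].
  + destruct k; apply H'.
  + intros t x Hp. destruct (H1 t x 0 Hp) as [A [B _]]. now split.
  + apply IH. exact H2.
  + apply IH. exact H3.
Qed.

Lemma Ck3_of_Ck2 k D f : open D -> Ck2 k D f -> Ck3 k (fun p => D (fst p)) (fun t x _ => f t x).
Proof.
intro HD. assert (HD' := open_fst (U := R_UniformSpace) D HD).
revert f. induction k as [|k IH]; intros f H.
- split; trivial. intros [[t x] u] Hp. destruct H as [H _].
  apply (continuous_comp (fun q : R * R * R => fst q) (fun q : R * R => f (fst q) (snd q))).
  apply continuous_fst. now apply H.
- destruct H as [H0 [H1 [H2 H3]]].
  apply Ck3_intro with (ft := fun t x _ => dt f t x) (fx := fun t x _ => dx f t x) (fu := fun _ _ _ => 0); trivial.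
  + intros [[t x] u] Hp.
    apply (continuous_comp (fun q : R * R * R => fst q) (fun q : R * R => f (fst q) (snd q))).
    apply continuous_fst. now apply H0.
  + intros t x u Hp. destruct (H1 t x Hp) as [A B]. split; [|split].
    * now apply Derive_correct.
    * now apply Derive_correct.
    * apply is_derive_Reals, derivable_pt_lim_const.
  + now apply IH.
  + now apply IH.
  + now apply Ck3_const.
Qed.

Lemma smooth1_Derive J f : smooth1 J f -> smooth1 J (Derive f).
Proof.
intros H n t Ht. specialize (H (S n) t Ht). destruct n as [|n]. exact I.
simpl in *. apply ex_derive_ext with (2 := H). intro s. symmetry.
rewrite <- (Derive_n_ext (Derive_n f 1) (Derive f) n s) by reflexivity.
rewrite Derive_n_comp. now rewrite Nat.add_comm.
Qed.

Lemma smooth1_derivable J f t : smooth1 J f -> J t -> is_derive f t (Derive f t).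
Proof. intros H Ht. apply Derive_correct. apply (H 1%nat t Ht). Qed.

Lemma Ck3_of_smooth1 k J f : open J -> smooth1 J f ->
  Ck3 k (fun p => J (fst (fst p))) (fun t _ _ => f t).
Proof.
intro HJ. assert (HJ' := open_strip J HJ).
revert f. induction k as [|k IH]; intros f H.
- split; trivial. intros [[t x] u] Hp.
  apply (continuous_comp (fun q : R * R * R => fst (fst q)) f).
  + apply (continuous_comp (fun q : R * R * R => fst q) fst); apply continuous_fst.
  + apply @ex_derive_continuous. eexists. apply (smooth1_derivable _ _ _ H Hp).
- apply Ck3_intro with (ft := fun t _ _ => Derive f t) (fx := fun _ _ _ => 0) (fu := fun _ _ _ => 0); trivial.
  + intros p Hp. apply (proj1 (IH f H) p Hp) || (destruct k; apply (proj1 (IH f H) p Hp)).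
  + intros t x u Hp. split; [|split].
    * apply (smooth1_derivable _ _ _ H Hp).
    * apply is_derive_Reals, derivable_pt_lim_const.
    * apply is_derive_Reals, derivable_pt_lim_const.
  + apply IH. now apply smooth1_Derive.
  + now apply Ck3_const.
  + now apply Ck3_const.
Qed.

Lemma smooth3_dt3 D f : smooth3 D f -> smooth3 D (dt3 f).
Proof. intros H k. apply (H (S k)). Qed.
Lemma smooth3_dx3 D f : smooth3 D f -> smooth3 D (dx3 f).
Proof. intros H k. apply (H (S k)). Qed.
Lemma smooth3_du3 D f : smooth3 D f -> smooth3 D (du3 f).
Proof. intros H k. apply (H (S k)). Qed.

Lemma smooth3_derivs D f t x u : smooth3 D f -> D (t, x, u) ->
  is_derive (fun s => f s x u) t (dt3 f t x u) /\
  is_derive (fun y => f t y u) x (dx3 f t x u) /\ is_derive (fun z => f t x z) u (du3 f t x u).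
Proof. intros H Hp. exact (Ck3_derivs D 0 f t x u (H 1%nat) Hp). Qed.

Lemma smooth3_slice_t J D f x u : smooth3 D f -> (forall s, J s -> D (s, x, u)) ->
  smooth1 J (fun s => f s x u).
Proof.
intros H S n t Ht.
(* The iterated derivative of a slice is a slice of an iterated partial derivative. The equality
   holds for every s, inside D or not, because [Derive] is total. *)
assert (E : forall m g, smooth3 D g -> exists h, smooth3 D h /\
   forall s, Derive_n (fun r => g r x u) m s = h s x u).
{ clear. induction m as [|m IH]; intros g Hg.
  - now exists g.
  - destruct (IH g Hg) as [h [Hh E]]. exists (dt3 h). split. now apply smooth3_dt3.
    intro s. simpl. now apply Derive_ext. }
destruct n as [|n]. exact I.
destruct (E n f H) as [h [Hh Eh]]. simpl.
apply ex_derive_ext with (fun s => h s x u). intro s; now rewrite Eh.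
eexists. apply (smooth3_derivs D h t x u Hh). now apply S.
Qed.

Lemma smooth3_slice_x J D f t u : smooth3 D f -> (forall s, J s -> D (t, s, u)) ->
  smooth1 J (fun s => f t s u).
Proof.
intros H S n y Hy.
assert (E : forall m g, smooth3 D g -> exists h, smooth3 D h /\
   forall s, Derive_n (fun r => g t r u) m s = h t s u).
{ clear. induction m as [|m IH]; intros g Hg.
  - now exists g.
  - destruct (IH g Hg) as [h [Hh E]]. exists (dx3 h). split. now apply smooth3_dx3.
    intro s. simpl. now apply Derive_ext. }
destruct n as [|n]. exact I.
destruct (E n f H) as [h [Hh Eh]]. simpl.
apply ex_derive_ext with (fun s => h t s u). intro s; now rewrite Eh.
eexists. apply (smooth3_derivs D h t y u Hh). now apply S.
Qed.

Lemma smooth2_slice_x J D f t : open D -> smooth2 D f -> (forall y, J y -> D (t, y)) ->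
  smooth1 J (fun y => f t y).
Proof.
intros HD H S. apply (smooth3_slice_x J (fun p => D (fst p)) (fun t x _ => f t x) t 0); trivial.
intro k. now apply Ck3_of_Ck2.
Qed.

(** Through this lemma the closure properties of [smooth1] are inherited from those of [Ck3] on the
    strip over J. *)
Lemma smooth1_of_strip J f : smooth3 (fun p => J (fst (fst p))) (fun t _ _ => f t) -> smooth1 J f.
Proof. intro H. now apply (smooth3_slice_t J _ (fun t _ _ => f t) 0 0 H). Qed.

Lemma smooth1_const J c : smooth1 J (fun _ => c).
Proof. intros n t _. apply ex_derive_n_const. Qed.

Lemma smooth1_id J : open J -> smooth1 J (fun t => t).
Proof. intro HJ. apply smooth1_of_strip. intro k. apply Ck3_pr_t. now apply open_strip. Qed.

Lemma smooth1_plus J f g : open J -> smooth1 J f -> smooth1 J g -> smooth1 J (fun t => f t + g t).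
Proof.
intros HJ Hf Hg. apply smooth1_of_strip. intro k.
apply (Ck3_plus _ (open_strip J HJ)); now apply Ck3_of_smooth1.
Qed.

Lemma smooth1_mult J f g : open J -> smooth1 J f -> smooth1 J g -> smooth1 J (fun t => f t * g t).
Proof.
intros HJ Hf Hg. apply smooth1_of_strip. intro k.
apply (Ck3_mult _ (open_strip J HJ)); now apply Ck3_of_smooth1.
Qed.

Lemma smooth1_pow J f n : open J -> smooth1 J f -> smooth1 J (fun t => f t ^ n).
Proof.
intros HJ Hf. apply smooth1_of_strip. intro k.
apply (Ck3_pow _ (open_strip J HJ)); now apply Ck3_of_smooth1.
Qed.

Lemma smooth1_minus J f g : open J -> smooth1 J f -> smooth1 J g -> smooth1 J (fun t => f t - g t).
Proof.
intros HJ Hf Hg. apply smooth1_of_strip. intro k.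
apply (Ck3_minus _ (open_strip J HJ)); now apply Ck3_of_smooth1.
Qed.

Lemma smooth1_inv J f : open J -> (forall t, J t -> f t <> 0) -> smooth1 J f -> smooth1 J (fun t => / f t).
Proof.
intros HJ N Hf. apply smooth1_of_strip. intro k.
apply (Ck3_inv _ (open_strip J HJ)). intros t x u. apply N. now apply Ck3_of_smooth1.
Qed.

Lemma smooth1_comp J K f g : open J -> open K -> smooth1 K f -> smooth1 J g ->
  (forall t, J t -> K (g t)) -> smooth1 J (fun t => f (g t)).
Proof.
intros HJ HK Hf Hg S. apply smooth1_of_strip. intro k.
apply (Ck3_comp _ (open_strip J HJ) k (fun p => K (fst (fst p))) (fun t _ _ => f t)
  (fun t _ _ => g t) (fun t _ _ => 0) (fun _ _ _ => 0) (open_strip K HK)).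
- intro j. now apply Ck3_of_smooth1.
- now apply Ck3_of_smooth1.
- apply Ck3_const. now apply open_strip.
- apply Ck3_const. now apply open_strip.
- intros t x u. apply S.
Qed.

Lemma smooth1_ext J f g : open J -> (forall t, J t -> f t = g t) -> smooth1 J f -> smooth1 J g.
Proof.
intros HJ E H n t Ht. apply ex_derive_n_ext_loc with (2 := H n t Ht).
apply filter_imp with (2 := HJ t Ht). exact E.
Qed.

Lemma smooth1_sub J K f : (forall t, J t -> K t) -> smooth1 K f -> smooth1 J f.
Proof. intros S H n t Ht. apply H. now apply S. Qed.

Lemma smooth1_local J f : (forall t, J t -> exists K, K t /\ smooth1 K f) -> smooth1 J f.
Proof. intros H n t Ht. destruct (H t Ht) as [K [Kt HK]]. now apply HK. Qed.

(** * The implicit function theorem *)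

(** With e = |m| / 2 the hypothesis first yields the Lipschitz bound |h r - h s| <= L |r - s|;
    inserting this bound turns the hypothesis for smaller e into differentiability. *)
Lemma implicit_derivative (h : R -> R) s l m : m <> 0 ->
  (forall e, 0 < e -> locally s (fun r =>
     Rabs (l * (r - s) + m * (h r - h s)) <= e * (Rabs (r - s) + Rabs (h r - h s)))) ->
  is_derive h s (- l / m).
Proof.
intros Hm H. assert (Pm := Rabs_pos_lt m Hm). apply is_derive_R. intros e He.
set (L := 2 * Rabs l / Rabs m + 1).
assert (HL : 0 < L).
{ unfold L. assert (0 <= 2 * Rabs l / Rabs m).
  { apply Rmult_le_pos. generalize (Rabs_pos l); lra. left; now apply Rinv_0_lt_compat. } lra. }
set (e' := e * Rabs m / (1 + L)).
assert (He' : 0 < e') by (unfold e'; apply Rdiv_lt_0_compat; [now apply Rmult_lt_0_compat | lra]).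
assert (Hm2 : 0 < Rabs m / 2) by lra.
generalize (filter_and _ _ (H _ Hm2) (H _ He')). apply filter_imp. intros r [H1 H2].
set (A := Rabs (r - s)) in *. set (B := Rabs (h r - h s)) in *.
assert (HA : 0 <= A) by apply Rabs_pos.
assert (HB : B <= L * A).
{ assert (T : Rabs m * B <= Rabs (l * (r - s) + m * (h r - h s)) + Rabs l * A).
  { unfold A, B. rewrite <- !Rabs_mult.
    replace (m * (h r - h s)) with ((l * (r - s) + m * (h r - h s)) + - (l * (r - s))) at 1 by ring.
    eapply Rle_trans. apply Rabs_triang. rewrite Rabs_Ropp. lra. }
  apply Rmult_le_reg_l with (Rabs m / 2); trivial.
  unfold L. replace (Rabs m / 2 * ((2 * Rabs l / Rabs m + 1) * A)) with (Rabs l * A + Rabs m / 2 * A) by (field; lra).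
  lra. }
apply Rmult_le_reg_l with (Rabs m); trivial. rewrite <- Rabs_mult.
replace (m * (h r - h s - - l / m * (r - s))) with (l * (r - s) + m * (h r - h s)) by (field; trivial).
eapply Rle_trans. apply H2.
apply Rle_trans with (e' * ((1 + L) * A)).
- apply Rmult_le_compat_l; lra.
- right. unfold e'. field. lra.
Qed.

Lemma implicit_function W F t0 x0 u0 : open W -> smooth3 W F -> W (t0, x0, u0) ->
  F t0 x0 u0 = 0 -> du3 F t0 x0 u0 <> 0 ->
  exists (D : R * R -> Prop) (u : R -> R -> R),
    open D /\ D (t0, x0) /\ smooth2 D u /\ u t0 x0 = u0 /\
    forall t x, D (t, x) ->
      W (t, x, u t x) /\ F t x (u t x) = 0 /\
      is_derive (fun s => u s x) t (- dt3 F t x (u t x) / du3 F t x (u t x)) /\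
      is_derive (fun y => u t y) x (- dx3 F t x (u t x) / du3 F t x (u t x)).
Proof.
intros HW HF Hp HF0. set (k := du3 F t0 x0 u0). intro Hk.
assert (Pk := Rabs_pos_lt k Hk).
assert (Pk2 : 0 < Rabs k / 2) by lra.
destruct (open_box _ _ _ _ HW Hp) as [d1 [Hd1 B]].
destruct (Ck3_continuous 0 _ _ _ _ _ (smooth3_du3 _ _ HF 0%nat) Hp _ Pk2) as [d2 [Hd2 C]].
set (d := Rmin d1 d2). assert (Hd : 0 < d) by now apply Rmin_glb_lt.
assert (D1 : forall r, r < d -> r < d1) by (intros; eapply Rlt_le_trans; [eassumption | apply Rmin_l]).
assert (D2 : forall r, r < d -> r < d2) by (intros; eapply Rlt_le_trans; [eassumption | apply Rmin_r]).
(* In the box F_u stays within |k| / 2 of k, hence so do the difference quotients of F in u. This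
   gives the injectivity estimate [Mono] and, at u0 + h and u0 - h, the signs needed for
   existence. *)
assert (Sl : forall a b z z', Rabs (a - t0) < d -> Rabs (b - x0) < d -> Rabs (z - u0) < d ->
  Rabs (z' - u0) < d -> Rabs (F a b z' - F a b z - k * (z' - z)) <= Rabs k / 2 * Rabs (z' - z)).
{ intros a b z z' Ha Hb Hz Hz'.
  apply (mean_value_slope (fun s => F a b s) (fun s => du3 F a b s)).
  - intros s Hs. apply (between_close _ _ u0 d _ Hs Hz) in Hz'.
    apply (smooth3_derivs W F); trivial. apply B; apply D1; trivial.
  - intros s Hs. apply (between_close _ _ u0 d _ Hs Hz) in Hz'.
    left. apply C; apply D2; trivial. }
assert (Mono : forall a b z z', Rabs (a - t0) < d -> Rabs (b - x0) < d -> Rabs (z - u0) < d ->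
  Rabs (z' - u0) < d -> Rabs k / 2 * Rabs (z' - z) <= Rabs (F a b z' - F a b z)).
{ intros a b z z' Ha Hb Hz Hz'. specialize (Sl a b z z' Ha Hb Hz Hz').
  assert (T : Rabs k * Rabs (z' - z) <= Rabs (F a b z' - F a b z - k * (z' - z)) + Rabs (F a b z' - F a b z)).
  { rewrite <- Rabs_mult. replace (k * (z' - z)) with (- (F a b z' - F a b z - k * (z' - z)) + (F a b z' - F a b z)) at 1 by ring.
    eapply Rle_trans. apply Rabs_triang. rewrite Rabs_Ropp. lra. }
  lra. }
assert (Nz : forall a b z, Rabs (a - t0) < d -> Rabs (b - x0) < d -> Rabs (z - u0) < d -> du3 F a b z <> 0).
{ intros a b z Ha Hb Hz E. generalize (C a b z (D2 _ Ha) (D2 _ Hb) (D2 _ Hz)). rewrite E.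
  fold k. unfold Rminus. rewrite Rplus_0_l, Rabs_Ropp. lra. }
set (h := d / 2).
assert (Hh : 0 < h < d) by (unfold h; lra).
assert (Z0 : forall y, Rabs (y - y) < d) by (intro y; rewrite Rminus_diag, Rabs_R0; trivial).
assert (Hu : Rabs (u0 + h - u0) < d) by (replace (u0 + h - u0) with h by ring; rewrite Rabs_pos_eq; lra).
assert (Hl : Rabs (u0 - h - u0) < d) by (replace (u0 - h - u0) with (-h) by ring; rewrite Rabs_Ropp, Rabs_pos_eq; lra).
assert (Hu' : W (t0, x0, u0 + h)) by (apply B; apply D1; trivial).
assert (Hl' : W (t0, x0, u0 - h)) by (apply B; apply D1; trivial).
(* Over (t0, x0) the values at u0 + h and u0 - h lie within |k| h / 2 of k h and - k h; a further
   change below |k| h / 4 preserves their signs. *)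
assert (Pkh : 0 < Rabs k * h / 4).
{ assert (0 < Rabs k * h) by (apply Rmult_lt_0_compat; lra). lra. }
destruct (Ck3_continuous 0 _ _ _ _ _ (HF 0%nat) Hu' _ Pkh) as [d3 [Hd3 C3]].
destruct (Ck3_continuous 0 _ _ _ _ _ (HF 0%nat) Hl' _ Pkh) as [d4 [Hd4 C4]].
set (d' := Rmin d (Rmin d3 d4)).
assert (Hd' : 0 < d') by (repeat apply Rmin_glb_lt; trivial).
assert (E0 : forall r, r < d' -> r < d /\ r < d3 /\ r < d4).
{ intros r Hr. generalize (Rmin_l d (Rmin d3 d4)) (Rmin_r d (Rmin d3 d4)) (Rmin_l d3 d4) (Rmin_r d3 d4).
  unfold d' in Hr. lra. }
set (D := fun q : R * R => Rabs (fst q - t0) < d' /\ Rabs (snd q - x0) < d').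
assert (HD : open D).
{ intros [a b] [Ha Hb]. simpl in Ha, Hb. apply locally_R2.
  exists (Rmin (d' - Rabs (a - t0)) (d' - Rabs (b - x0))). split. apply Rmin_glb_lt; lra.
  intros a' b' Ha' Hb'. split; simpl.
  - replace (a' - t0) with ((a' - a) + (a - t0)) by ring. eapply Rle_lt_trans. apply Rabs_triang.
    generalize (Rmin_l (d' - Rabs (a - t0)) (d' - Rabs (b - x0))). lra.
  - replace (b' - x0) with ((b' - b) + (b - x0)) by ring. eapply Rle_lt_trans. apply Rabs_triang.
    generalize (Rmin_r (d' - Rabs (a - t0)) (d' - Rabs (b - x0))). lra. }
assert (Ex : forall a b, D (a, b) -> exists z, Rabs (z - u0) < d /\ F a b z = 0).
{ intros a b [Ha Hb]. simpl in Ha, Hb. destruct (E0 _ Ha) as [Ha1 [Ha3 Ha4]]. destruct (E0 _ Hb) as [Hb1 [Hb3 Hb4]].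
  assert (U : Rabs (F a b (u0 + h) - k * h) < Rabs k * h).
  { generalize (Sl t0 x0 u0 (u0 + h) (Z0 _) (Z0 _) (Z0 _) Hu). intro S1.
    replace (u0 + h - u0) with h in S1 by ring. rewrite (Rabs_pos_eq h) in S1 by lra.
    rewrite HF0 in S1.
    assert (S2 : Rabs (F a b (u0 + h) - F t0 x0 (u0 + h)) < Rabs k * h / 4).
    { apply C3; trivial. rewrite Rminus_diag, Rabs_R0; trivial. }
    replace (F a b (u0 + h) - k * h) with ((F a b (u0 + h) - F t0 x0 (u0 + h)) + (F t0 x0 (u0 + h) - 0 - k * h)) by ring.
    eapply Rle_lt_trans. apply Rabs_triang. lra. }
  assert (V : Rabs (F a b (u0 - h) + k * h) < Rabs k * h).
  { generalize (Sl t0 x0 u0 (u0 - h) (Z0 _) (Z0 _) (Z0 _) Hl). intro S1.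
    replace (u0 - h - u0) with (-h) in S1 by ring. rewrite Rabs_Ropp, (Rabs_pos_eq h) in S1 by lra.
    rewrite HF0 in S1.
    assert (S2 : Rabs (F a b (u0 - h) - F t0 x0 (u0 - h)) < Rabs k * h / 4).
    { apply C4; trivial. rewrite Rminus_diag, Rabs_R0; trivial. }
    replace (F a b (u0 - h) + k * h) with ((F a b (u0 - h) - F t0 x0 (u0 - h)) + (F t0 x0 (u0 - h) - 0 - k * - h)) by ring.
    eapply Rle_lt_trans. apply Rabs_triang. lra. }
  assert (Cz : forall z, u0 - h <= z <= u0 + h -> forall c, continuity_pt (fun s => c * F a b s) z).
  { intros z Hz c. apply continuity_pt_mult. apply continuity_pt_const. intros ? ?; reflexivity.
    apply continuity_pt_filterlim. apply @ex_derive_continuous. eexists.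
    apply (smooth3_derivs W F); trivial. apply B; apply D1; trivial. apply Rabs_def1; lra. }
  assert (R0 : forall z, u0 - h <= z <= u0 + h -> Rabs (z - u0) < d) by (intros; apply Rabs_def1; lra).
  apply Rabs_def2 in U. apply Rabs_def2 in V.
  (* The intermediate value theorem is applied to a change from negative to positive, hence the
     factor 1 or -1 according to the sign of k. *)
  destruct (Rlt_dec 0 k) as [K|K].
  - rewrite (Rabs_pos_eq k) in U, V by lra.
    destruct (IVT_interv (fun s => 1 * F a b s) (u0 - h) (u0 + h)) as [z [Hz Ez]]; try lra.
    intros; now apply Cz. exists z. split. now apply R0. lra.
  - rewrite (Rabs_left1 k) in U, V by lra.
    destruct (IVT_interv (fun s => (-1) * F a b s) (u0 - h) (u0 + h)) as [z [Hz Ez]]; try lra.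
    intros; now apply Cz. exists z. split. now apply R0. lra. }
(* Over D the zero exists and is unique in the box by [Mono]; elsewhere the value is arbitrary. *)
set (u := fun a b => epsilon (inhabits 0) (fun z => Rabs (z - u0) < d /\ F a b z = 0)).
assert (Su : forall a b, D (a, b) -> Rabs (u a b - u0) < d /\ F a b (u a b) = 0).
{ intros a b H. apply (epsilon_spec (inhabits 0) (fun z => Rabs (z - u0) < d /\ F a b z = 0)). now apply Ex. }
assert (Du : forall a b, D (a, b) -> Rabs (a - t0) < d /\ Rabs (b - x0) < d).
{ intros a b [Ha Hb]. split; [apply (E0 _ Ha) | apply (E0 _ Hb)]. }
assert (Wu : forall a b, D (a, b) -> W (a, b, u a b)).
{ intros a b H. destruct (Du _ _ H). apply B; apply D1; trivial. now apply Su. }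
(* By [Mono], the change of u is at most 2 / |k| times |F(a', b', u a b)|, which tends to F(a, b, u
   a b) = 0. *)
assert (Cu : forall a b, D (a, b) -> forall e, 0 < e ->
   locally (a, b) (fun q => Rabs (u (fst q) (snd q) - u a b) < e)).
{ intros a b H e He. destruct (Su _ _ H) as [S1 S2]. destruct (Du _ _ H) as [Q1 Q2].
  assert (He' : 0 < Rabs k / 2 * e) by now apply Rmult_lt_0_compat.
  destruct (Ck3_continuous 0 _ _ _ _ _ (HF 0%nat) (Wu _ _ H) _ He') as [d5 [Hd5 C5]].
  assert (L : locally (a, b) (fun q => Rabs (fst q - a) < d5 /\ Rabs (snd q - b) < d5)).
  { apply locally_R2. exists d5. split; trivial. intros; now split. }
  generalize (filter_and _ _ (HD _ H) L). apply filter_imp. intros [a' b'] [H' [L1 L2]]. simpl in L1, L2 |- *.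
  destruct (Su _ _ H') as [S1' S2']. destruct (Du _ _ H') as [Q1' Q2'].
  apply Rmult_lt_reg_l with (Rabs k / 2); trivial.
  eapply Rle_lt_trans. apply (Mono a' b' (u a b) (u a' b')); trivial.
  rewrite S2', <- Rabs_Ropp. replace (- (0 - F a' b' (u a b))) with (F a' b' (u a b) - F a b (u a b)) by (rewrite S2; ring).
  apply C5; trivial. now rewrite Rminus_diag, Rabs_R0. }
assert (Der : forall t x, D (t, x) ->
      is_derive (fun s => u s x) t (- dt3 F t x (u t x) / du3 F t x (u t x)) /\
      is_derive (fun y => u t y) x (- dx3 F t x (u t x) / du3 F t x (u t x))).
{ intros t x H. destruct (Su _ _ H) as [S1 S2]. destruct (Du _ _ H) as [Q1 Q2].
  assert (N : du3 F t x (u t x) <> 0) by now apply Nz.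
  split; apply implicit_derivative; trivial; intros e He;
  destruct (Ck3_strict 0 _ _ _ _ _ HW (HF 1%nat) (Wu _ _ H) e He) as [d5 [Hd5 C5]];
  assert (Z5 : forall y, Rabs (y - y) < d5) by (intro y; rewrite Rminus_diag, Rabs_R0; trivial);
  generalize (filter_and _ _ (HD _ H) (Cu _ _ H _ Hd5)); intro L;
  apply locally_R2 in L; destruct L as [d6 [Hd6 L]]; apply locally_R; exists (Rmin d5 d6);
  (split; [now apply Rmin_glb_lt|]).
  - intros s Hs.
    assert (Hs5 : Rabs (s - t) < d5) by (eapply Rlt_le_trans; [exact Hs | apply Rmin_l]).
    assert (Hs6 : Rabs (s - t) < d6) by (eapply Rlt_le_trans; [exact Hs | apply Rmin_r]).
    destruct (L s x Hs6) as [L1 L2]. now rewrite Rminus_diag, Rabs_R0. simpl in L2.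
    destruct (Su _ _ L1) as [_ S2'].
    specialize (C5 t x (u t x) s x (u s x) (Z5 _) (Z5 _) (Z5 _) Hs5 (Z5 _) L2).
    rewrite S2, S2', Rminus_diag, Rminus_diag, Rabs_R0 in C5. rewrite <- Rabs_Ropp.
    replace (- (dt3 F t x (u t x) * (s - t) + du3 F t x (u t x) * (u s x - u t x)))
     with (0 - (dt3 F t x (u t x) * (s - t) + dx3 F t x (u t x) * 0 + du3 F t x (u t x) * (u s x - u t x))) by ring.
    eapply Rle_trans. apply C5. right; ring.
  - intros s Hs.
    assert (Hs5 : Rabs (s - x) < d5) by (eapply Rlt_le_trans; [exact Hs | apply Rmin_l]).
    assert (Hs6 : Rabs (s - x) < d6) by (eapply Rlt_le_trans; [exact Hs | apply Rmin_r]).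
    destruct (L t s) as [L1 L2]; trivial. now rewrite Rminus_diag, Rabs_R0. simpl in L2.
    destruct (Su _ _ L1) as [_ S2'].
    specialize (C5 t x (u t x) t s (u t s) (Z5 _) (Z5 _) (Z5 _) (Z5 _) Hs5 L2).
    rewrite S2, S2', Rminus_diag, Rminus_diag, Rabs_R0 in C5. rewrite <- Rabs_Ropp.
    replace (- (dx3 F t x (u t x) * (s - x) + du3 F t x (u t x) * (u t s - u t x)))
     with (0 - (dt3 F t x (u t x) * 0 + dx3 F t x (u t x) * (s - x) + du3 F t x (u t x) * (u t s - u t x))) by ring.
    eapply Rle_trans. apply C5. right; ring. }
assert (D0 : D (t0, x0)) by (split; simpl; now rewrite Rminus_diag, Rabs_R0).
exists D, u. split; [exact HD|]. split; [exact D0|]. split; [|split].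
- intro n. apply Ck2_of_Ck3.
  assert (HD3 := open_fst (U := R_UniformSpace) D HD).
  assert (C0 : forall p : R * R * R, D (fst p) -> continuous (fun q : R * R * R => u (fst (fst q)) (snd (fst q))) p).
  { intros [[a b] c] H. apply (continuous_comp (fun q : R * R * R => fst q) (fun q : R * R => u (fst q) (snd q))).
    apply continuous_fst. apply continuous_R. now apply Cu. }
  (* Bootstrap: the derivatives of u are quotients of smooth functions evaluated on its graph, so a
     C^n solution has C^n derivatives. *)
  induction n as [|n IH].
  + now split.
  + assert (IF : forall g, smooth3 W g -> Ck3 n (fun p => D (fst p)) (fun t x _ => g t x (u t x))).
    { intros g Hg. apply (Ck3_comp _ HD3 n W g (fun t _ _ => t) (fun _ x _ => x) (fun t x _ => u t x)); trivial.
      now apply Ck3_pr_t. now apply Ck3_pr_x. intros t x z. apply Wu. }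
    apply Ck3_intro with (ft := fun t x _ => - dt3 F t x (u t x) / du3 F t x (u t x))
      (fx := fun t x _ => - dx3 F t x (u t x) / du3 F t x (u t x)) (fu := fun _ _ _ => 0); trivial.
    * intros t x z H. split; [|split]; try now apply Der. apply is_derive_Reals, derivable_pt_lim_const.
    * apply Ck3_div; trivial.
      { intros t x z H. destruct (Du _ _ H). apply Nz; trivial. now apply Su. }
      apply Ck3_opp; trivial. now apply (IF (dt3 F)), smooth3_dt3. now apply (IF (du3 F)), smooth3_du3.
    * apply Ck3_div; trivial.
      { intros t x z H. destruct (Du _ _ H). apply Nz; trivial. now apply Su. }
      apply Ck3_opp; trivial. now apply (IF (dx3 F)), smooth3_dx3. now apply (IF (du3 F)), smooth3_du3.
    * now apply Ck3_const.
- destruct (Su _ _ D0) as [S1 S2].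
  generalize (Mono t0 x0 u0 (u t0 x0) (Z0 _) (Z0 _) (Z0 _) S1). rewrite S2, HF0, Rminus_diag, Rabs_R0. intro M.
  assert (Rabs (u t0 x0 - u0) <= 0).
  { apply Rmult_le_reg_l with (Rabs k / 2); lra. }
  destruct (Req_dec (u t0 x0 - u0) 0) as [E|E]. lra. apply Rabs_pos_lt in E. lra.
- intros t x H. split; [now apply Wu|]. split; [now apply Su|]. now apply Der.
Qed.

(** * Preimages of polynomial test functions *)

Lemma Derive_n_Derive f n x : Derive_n f (S n) x = Derive_n (Derive f) n x.
Proof.
rewrite <- (Nat.add_1_r n), <- Derive_n_comp. now apply Derive_n_ext.
Qed.

Lemma Derive_n_shift f g n x : (forall y, is_derive f y (g y)) -> Derive_n f (S n) x = Derive_n g n x.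
Proof.
intro H. rewrite Derive_n_Derive. apply Derive_n_ext. intro y. now apply is_derive_unique.
Qed.

(** At (T0, X0) the value and the first derivatives are U0, p, q. The coefficients r, c, d enter in
    orders four and five only, and of these only r reaches the fifth X-derivative at the base
    point. *)
Definition test (T0 X0 U0 p q r c d T X : R) : R :=
  U0 + p * (T - T0) + q * (X - X0) + r * (X - X0) ^ 5 + c * (T - T0) ^ 5 + d * (X - X0) ^ 4.

Lemma test_derive p q r c d (f g h : R -> R) s f1 g1 h1 :
  is_derive f s f1 -> is_derive g s g1 -> is_derive h s h1 ->
  is_derive (fun y => h y - test (f s) (g s) (h s) p q r c d (f y) (g y)) s (h1 - p * f1 - q * g1).
Proof.
intros Hf Hg Hh. unfold test. auto_derive.
- repeat split; eexists; eassumption.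
- apply is_derive_unique in Hf, Hg, Hh.
  change (Derive (fun x => f x) s) with (Derive f s).
  change (Derive (fun x => g x) s) with (Derive g s).
  change (Derive (fun x => h x) s) with (Derive h s).
  rewrite Hf, Hg, Hh. simpl. ring.
Qed.

Lemma Ck3_test D k T0 X0 U0 p q r c d f g : open D -> Ck3 k D f -> Ck3 k D g ->
  Ck3 k D (fun t x u => test T0 X0 U0 p q r c d (f t x u) (g t x u)).
Proof.
intros HD Hf Hg. unfold test.
repeat first [apply Ck3_plus | apply Ck3_mult | apply Ck3_minus | apply Ck3_pow
 | apply Ck3_const | assumption].
Qed.

(** Here 120 = 5!. Where the coefficient beta is nonzero, any p and q can be completed by an r for
    which the residual vanishes. *)
Lemma residual_test E T0 X0 U0 p q r c d :
  residual E (test T0 X0 U0 p q r c d) T0 X0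
  = p + U0 * q + alpha E T0 * U0 + beta E T0 * (120 * r).
Proof.
unfold residual, dt, dx.
replace (Derive (fun s => test T0 X0 U0 p q r c d s X0) T0) with p.
2:{ symmetry. apply is_derive_unique. unfold test. auto_derive; trivial. simpl. ring. }
replace (Derive (fun y => test T0 X0 U0 p q r c d T0 y) X0) with q.
2:{ symmetry. apply is_derive_unique. unfold test. auto_derive; trivial. simpl. ring. }
replace (Derive_n (fun y => test T0 X0 U0 p q r c d T0 y) 5 X0) with (120 * r).
2:{ rewrite (Derive_n_shift _ (fun y => q + 5 * r * (y - X0) ^ 4 + 4 * d * (y - X0) ^ 3)).
    2:{ intro y. unfold test. auto_derive; trivial. simpl. ring. }
    rewrite (Derive_n_shift _ (fun y => 20 * r * (y - X0) ^ 3 + 12 * d * (y - X0) ^ 2)).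
    2:{ intro y. auto_derive; trivial. simpl. ring. }
    rewrite (Derive_n_shift _ (fun y => 60 * r * (y - X0) ^ 2 + 24 * d * (y - X0))).
    2:{ intro y. auto_derive; trivial. simpl. ring. }
    rewrite (Derive_n_shift _ (fun y => 120 * r * (y - X0) + 24 * d)).
    2:{ intro y. auto_derive; trivial. simpl. ring. }
    rewrite (Derive_n_shift _ (fun y => 120 * r)).
    2:{ intro y. auto_derive; trivial. simpl. ring. }
    reflexivity. }
unfold test. ring.
Qed.

(* The graph of u is carried into the graph of the test function where [gap]
   vanishes. *)
Definition gap (phi : transformation) (t x u p q r c d s y z : R) : R :=
  Ut phi s y z - test (Tt phi t x u) (Xt phi t x u) (Ut phi t x u) p q r c d
    (Tt phi s y z) (Xt phi s y z).

Lemma gap_smooth phi t x u p q r c d : point_transformation phi ->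
  smooth3 (Omega phi) (gap phi t x u p q r c d).
Proof.
intros [HO [_ [HT [HX [HU _]]]]] n. apply Ck3_minus; trivial. now apply Ck3_test.
Qed.

Lemma gap_derivs phi t x u p q r c d : point_transformation phi -> Omega phi (t, x, u) ->
  let F := gap phi t x u p q r c d in
  F t x u = 0 /\
  dt3 F t x u = dt3 (Ut phi) t x u - p * dt3 (Tt phi) t x u - q * dt3 (Xt phi) t x u /\
  dx3 F t x u = dx3 (Ut phi) t x u - p * dx3 (Tt phi) t x u - q * dx3 (Xt phi) t x u /\
  du3 F t x u = du3 (Ut phi) t x u - p * du3 (Tt phi) t x u - q * du3 (Xt phi) t x u.
Proof.
intros [_ [_ [HT [HX [HU _]]]]] Hp F.
destruct (smooth3_derivs _ _ _ _ _ HT Hp) as [Tt1 [Tx1 Tu1]].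
destruct (smooth3_derivs _ _ _ _ _ HX Hp) as [Xt1 [Xx1 Xu1]].
destruct (smooth3_derivs _ _ _ _ _ HU Hp) as [Ut1 [Ux1 Uu1]].
split; [|split; [|split]].
- unfold F, gap, test. ring.
- apply is_derive_unique. exact (test_derive p q r c d (fun s => Tt phi s x u) (fun s => Xt phi s x u) (fun s => Ut phi s x u) t _ _ _ Tt1 Xt1 Ut1).
- apply is_derive_unique. exact (test_derive p q r c d (fun s => Tt phi t s u) (fun s => Xt phi t s u) (fun s => Ut phi t s u) x _ _ _ Tx1 Xx1 Ux1).
- apply is_derive_unique. exact (test_derive p q r c d (fun s => Tt phi t x s) (fun s => Xt phi t x s) (fun s => Ut phi t x s) u _ _ _ Tu1 Xu1 Uu1).
Qed.

Lemma is_derive_id_R (t : R) : is_derive (fun s : R => s) t 1.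
Proof. apply is_derive_Reals, derivable_pt_lim_id. Qed.

Lemma is_derive_const_R (c t : R) : is_derive (fun _ : R => c) t 0.
Proof. apply is_derive_Reals, derivable_pt_lim_const. Qed.

Lemma is_derive_along_x W f h t x h1 : open W -> smooth3 W f -> W (t, x, h x) -> is_derive h x h1 ->
  is_derive (fun y => f t y (h y)) x (dx3 f t x (h x) + du3 f t x (h x) * h1).
Proof.
intros HW Hf Hp Hh.
replace (dx3 f t x (h x) + du3 f t x (h x) * h1) with
  (dt3 f t x (h x) * 0 + dx3 f t x (h x) * 1 + du3 f t x (h x) * h1) by ring.
apply (chain_rule3 0 W f (fun _ => t) (fun s => s) h); trivial.
apply is_derive_const_R. apply is_derive_id_R.
Qed.

Lemma is_derive_along_t W f h t x h1 : open W -> smooth3 W f -> W (t, x, h t) -> is_derive h t h1 ->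
  is_derive (fun s => f s x (h s)) t (dt3 f t x (h t) + du3 f t x (h t) * h1).
Proof.
intros HW Hf Hp Hh.
replace (dt3 f t x (h t) + du3 f t x (h t) * h1) with
  (dt3 f t x (h t) * 1 + dx3 f t x (h t) * 0 + du3 f t x (h t) * h1) by ring.
apply (chain_rule3 0 W f (fun s => s) (fun _ => x) h); trivial.
apply is_derive_id_R. apply is_derive_const_R.
Qed.

Lemma open_slice (D : R * R -> Prop) (t : R) : open D -> open (fun y => D (t, y)).
Proof.
intros HD y Hy. apply HD, locally_R2 in Hy. destruct Hy as [e [He Hy]]. apply locally_R. exists e. split; trivial.
intros z Hz. apply Hy; trivial. now rewrite Rminus_diag, Rabs_R0.
Qed.

(** The condition k <> 0 serves twice: it makes [gap] solvable for u, and it turns the nondegeneracy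
    of phi into that of (T, X) along the graph. Only the slice h at time t is returned, since u_t
    enters solely as - kt / k. The first-order part of the resulting equation depends only on p and
    q, so tests that agree in p and q have the same fifth derivative of h. *)
Lemma admissible_test E phi E' t x u p q r c d :
  admissible E phi E' -> Omega phi (t, x, u) ->
  let T0 := Tt phi t x u in let X0 := Xt phi t x u in let U0 := Ut phi t x u in
  let k := du3 (Ut phi) t x u - p * du3 (Tt phi) t x u - q * du3 (Xt phi) t x u in
  let kt := dt3 (Ut phi) t x u - p * dt3 (Tt phi) t x u - q * dt3 (Xt phi) t x u in
  let kx := dx3 (Ut phi) t x u - p * dx3 (Tt phi) t x u - q * dx3 (Xt phi) t x u in
  k <> 0 -> p + U0 * q + alpha E' T0 * U0 + beta E' T0 * (120 * r) = 0 ->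
  exists (J : R -> Prop) (h : R -> R), open J /\ J x /\ smooth1 J h /\ h x = u /\
    is_derive h x (- kx / k) /\
    (forall y, J y -> Omega phi (t, y, h y) /\
       Ut phi t y (h y) = test T0 X0 U0 p q r c d (Tt phi t y (h y)) (Xt phi t y (h y))) /\
    - kt / k + u * (- kx / k) + alpha E t * u + beta E t * Derive_n h 5 x = 0.
Proof.
intros [_ [_ [HP [_ HM]]]] Hp T0 X0 U0 k kt kx Hk Hr.
set (F := gap phi t x u p q r c d).
assert (HF : smooth3 (Omega phi) F) by now apply gap_smooth.
destruct (gap_derivs phi t x u p q r c d HP Hp) as [F0 [Ft [Fx Fu]]].
fold F in F0, Ft, Fx, Fu. fold kt in Ft. fold kx in Fx. fold k in Fu.
destruct HP as [HO [_ [HT [HX [HU HJ]]]]]. specialize (HJ _ _ _ Hp).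
destruct (implicit_function (Omega phi) F t x u HO HF Hp F0) as [D [w [HD [Dp [Hw [w0 W]]]]]].
{ now rewrite Fu. }
destruct (W t x Dp) as [_ [_ [Wt Wx]]]. rewrite w0, Ft, Fu in Wt. rewrite w0, Fx, Fu in Wx.
assert (Dt : forall f, smooth3 (Omega phi) f ->
  dt (fun s y => f s y (w s y)) t x = dt3 f t x u + du3 f t x u * (- kt / k)).
{ intros f Hf. apply is_derive_unique.
  generalize (is_derive_along_t (Omega phi) f (fun s => w s x) t x (- kt / k)). rewrite w0. now auto. }
assert (Dx : forall f, smooth3 (Omega phi) f ->
  dx (fun s y => f s y (w s y)) t x = dx3 f t x u + du3 f t x u * (- kx / k)).
{ intros f Hf. apply is_derive_unique.
  generalize (is_derive_along_x (Omega phi) f (fun y => w t y) t x (- kx / k)). rewrite w0. now auto. }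
assert (R0 : residual E w t x = 0).
{ apply (HM D (fun _ => True) w (test T0 X0 U0 p q r c d) t x); trivial.
  - apply open_true.
  - intro n. apply Ck2_of_Ck3. 
    assert (O3 : open (fun p : R * R * R => True)) by apply open_true.
    apply (Ck3_test _ n T0 X0 U0 p q r c d (fun t _ _ => t) (fun _ x _ => x)); trivial.
    now apply Ck3_pr_t. now apply Ck3_pr_x.
  - intros s y Hs. destruct (W s y Hs) as [W1 [W2 _]]. split; trivial. split; trivial.
    unfold F, gap in W2. fold T0 X0 U0 in W2. lra.
  (* Along the graph the determinant D(T, X) / D(t, x), multiplied by k, is the Jacobian of phi. *)
  - rewrite !Dt, !Dx; trivial. intro Z. apply HJ.
    replace (jacobian phi t x u) with (((dt3 (Tt phi) t x u + du3 (Tt phi) t x u * (- kt / k)) *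
     (dx3 (Xt phi) t x u + du3 (Xt phi) t x u * (- kx / k)) -
     (dx3 (Tt phi) t x u + du3 (Tt phi) t x u * (- kx / k)) *
     (dt3 (Xt phi) t x u + du3 (Xt phi) t x u * (- kt / k))) * k).
    rewrite Z; ring.
    transitivity (k * (dt3 (Tt phi) t x u * dx3 (Xt phi) t x u - dx3 (Tt phi) t x u * dt3 (Xt phi) t x u)
      - kt * (du3 (Tt phi) t x u * dx3 (Xt phi) t x u - dx3 (Tt phi) t x u * du3 (Xt phi) t x u)
      - kx * (dt3 (Tt phi) t x u * du3 (Xt phi) t x u - du3 (Tt phi) t x u * dt3 (Xt phi) t x u)).
    { clearbody k kt kx. field. exact Hk. }
    unfold jacobian, k, kt, kx. ring.
  - rewrite w0. fold T0 X0. rewrite residual_test. exact Hr. }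
exists (fun y => D (t, y)), (fun y => w t y). split; [now apply open_slice|]. split; [exact Dp|].
split; [now apply (smooth2_slice_x _ D)|]. split; [exact w0|]. split; [exact Wx|]. split.
- intros y Hy. destruct (W t y Hy) as [W1 [W2 _]]. split; trivial. unfold F, gap in W2. fold T0 X0 U0 in W2. lra.
- unfold residual in R0.
  replace (dt w t x) with (- kt / k) in R0 by (symmetry; apply (is_derive_unique _ _ _ Wt)).
  replace (dx w t x) with (- kx / k) in R0 by (symmetry; apply (is_derive_unique _ _ _ Wx)).
  rewrite w0 in R0. exact R0.
Qed.

(** * Derivatives of functions of one variable read off from their asymptotics *)

Lemma smooth1_derivs_near J f x n : open J -> smooth1 J f -> J x ->
  locally x (fun y => forall k, (k <= n)%nat -> ex_derive_n f k y).
Proof. intros HJ Hf Hx. apply filter_imp with (2 := HJ x Hx). intros y Hy k _. now apply Hf. Qed.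

Lemma smooth1_Derive_n J f n : smooth1 J f -> smooth1 J (Derive_n f n).
Proof.
intro H. induction n as [|n IH]. exact H. now apply smooth1_Derive.
Qed.

Lemma smooth1_Derive_n_close J f n x : smooth1 J f -> J x -> forall e, 0 < e ->
  locally x (fun y => Rabs (Derive_n f n y - Derive_n f n x) < e).
Proof.
intros H Hx e He. eapply is_derive_close; trivial.
apply (smooth1_derivable J). now apply smooth1_Derive_n. exact Hx.
Qed.

(** Strong induction on k: once the lower derivatives vanish, Taylor's formula leaves only the
    remainder of order k, and a nonzero k-th derivative would keep it above what the little-o bound
    allows. *)
Lemma derivs_of_littleo J f x n : open J -> smooth1 J f -> J x ->
  (forall e, 0 < e -> locally x (fun y => Rabs (f y) <= e * Rabs (y - x) ^ n)) ->
  forall k, (k <= n)%nat -> Derive_n f k x = 0.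
Proof.
intros HJ Hf Hx H k. induction k as [k IH] using (well_founded_induction Wf_nat.lt_wf). intro Hk.
destruct (Req_dec (Derive_n f k x) 0) as [E|Nl]; trivial. exfalso.
apply Rabs_pos_lt in Nl. set (l := Derive_n f k x) in *.
assert (Pf := INR_fact_lt_0 k).
(* The remainder is at least |l| / 2 / k! times |y - x|^k; a quarter in place of the half gives the
   contradiction, as |y - x|^n <= |y - x|^k for |y - x| < 1. *)
assert (He : 0 < Rabs l / 4 / INR (fact k)) by (apply Rdiv_lt_0_compat; lra).
assert (L : locally x (fun y => J y /\ Rabs (y - x) < 1 /\ Rabs (Derive_n f k y - l) < Rabs l / 2 /\
  Rabs (f y) <= Rabs l / 4 / INR (fact k) * Rabs (y - x) ^ n)).
{ apply filter_and. apply HJ, Hx. apply filter_and. apply locally_R. exists 1. split. lra. trivial.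
  apply filter_and. apply smooth1_Derive_n_close with J; trivial. lra. now apply H. }
apply locally_R in L. destruct L as [d [Hd L]].
set (y := x + d / 2).
assert (Hxy : x < y) by (unfold y; lra).
assert (N : forall z, x <= z <= y -> Rabs (z - x) < d) by (intros z Hz; apply Rabs_def1; unfold y in Hz; lra).
destruct (L y) as [_ [L1 [_ L2]]]. apply N; lra.
(* The remainder formula starts at order one, so order zero is settled at y = x itself; there
   [0 ^ n] equals 1 if n = 0, whence the bound by 1. *)
destruct k as [|k].
- destruct (L x) as [_ [_ [_ L3]]]. apply N; lra.
  change (f x) with l in L3. simpl INR in L3. rewrite Rminus_diag, Rabs_R0 in L3.
  assert (0 ^ n <= 1). { destruct n; simpl; lra. }
  assert (Rabs l / 4 / 1 * 0 ^ n <= Rabs l / 4 / 1 * 1) by (apply Rmult_le_compat_l; lra). lra.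
- destruct (Taylor_Lagrange f k x y Hxy) as [z [Hz E]].
  { intros z Hz j _. apply Hf. apply L. now apply N. }
  assert (S0 : sum_f_R0 (fun m => (y - x) ^ m / INR (fact m) * Derive_n f m x) k = 0).
  { rewrite (sum_eq _ (fun _ => 0)). rewrite sum_cte. ring. intros i Hi. rewrite IH by lia. ring. }
  rewrite S0, Rplus_0_l in E. destruct (L z) as [_ [_ [L3 _]]]. apply N; lra.
  rewrite E in L2. rewrite Rabs_mult, Rabs_div in L2 by apply INR_fact_neq_0.
  rewrite <- RPow_abs in L2.
  rewrite (Rabs_pos_eq (INR _)) in L2 by lra.
  assert (P : Rabs (y - x) ^ n <= Rabs (y - x) ^ S k).
  { replace n with (S k + (n - S k))%nat by lia. rewrite pow_add.
    rewrite <- (Rmult_1_r (Rabs (y - x) ^ S k)) at 2. apply Rmult_le_compat_l. apply pow_le, Rabs_pos.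
    rewrite <- (pow1 (n - S k)). apply pow_incr. split. apply Rabs_pos. lra. }
  assert (Pp : 0 < Rabs (y - x) ^ S k) by (apply pow_lt, Rabs_pos_lt; lra).
  assert (Q : Rabs l / 2 < Rabs (Derive_n f (S k) z)).
  { replace l with ((l - Derive_n f (S k) z) + Derive_n f (S k) z) by ring.
    assert (T := Rabs_triang (l - Derive_n f (S k) z) (Derive_n f (S k) z)).
    rewrite (Rabs_minus_sym l) in T. replace (l - Derive_n f (S k) z + Derive_n f (S k) z) with l in * by ring. lra. }
  set (A := Rabs (y - x) ^ S k) in *. set (B := Rabs (Derive_n f (S k) z)) in *.
  set (K := INR (fact (S k))) in *.
  assert (M : A / K * B <= Rabs l / 4 / K * A).
  { eapply Rle_trans. exact L2. apply Rmult_le_compat_l. lra. exact P. }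
  assert (PA : 0 < A / K) by now apply Rdiv_lt_0_compat.
  assert (A / K * (Rabs l / 2) < A / K * B) by now apply Rmult_lt_compat_l.
  replace (Rabs l / 4 / K * A) with (A / K * (Rabs l / 4)) in M by (field; lra).
  assert (A / K * (Rabs l / 4) < A / K * (Rabs l / 2)) by (apply Rmult_lt_compat_l; lra).
  lra.
Qed.

Lemma Derive_n5_pow5 L x : Derive_n (fun y => L * (y - x) ^ 5) 5 x = 120 * L.
Proof.
rewrite (Derive_n_shift _ (fun y => 5 * L * (y - x) ^ 4)).
2:{ intro y. auto_derive; trivial. simpl. ring. }
rewrite (Derive_n_shift _ (fun y => 20 * L * (y - x) ^ 3)).
2:{ intro y. auto_derive; trivial. simpl. ring. }
rewrite (Derive_n_shift _ (fun y => 60 * L * (y - x) ^ 2)).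
2:{ intro y. auto_derive; trivial. simpl. ring. }
rewrite (Derive_n_shift _ (fun y => 120 * L * (y - x))).
2:{ intro y. auto_derive; trivial. simpl. ring. }
rewrite (Derive_n_shift _ (fun y => 120 * L)).
2:{ intro y. auto_derive; trivial. simpl. ring. }
reflexivity.
Qed.

Lemma smooth1_shift_pow J L x n : open J -> smooth1 J (fun y => L * (y - x) ^ n).
Proof.
intro HJ. apply smooth1_mult; trivial. apply smooth1_const. apply smooth1_pow; trivial.
apply smooth1_minus; trivial. now apply smooth1_id. apply smooth1_const.
Qed.

(** With s = y - x: g = b s + o(s) and g^5 = k w + o(w) first give w = O(s^5), then k w = b^5 s^5 +
    o(s^5). Hence the fifth-order Taylor coefficient of w is b^5 / k. *)
Lemma fifth_derivative (J : R -> Prop) (w g : R -> R) (x k b : R) : open J -> smooth1 J w -> J x -> k <> 0 ->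
  is_derive g x b -> g x = 0 ->
  (forall e, 0 < e -> locally x (fun y => Rabs (g y ^ 5 - k * w y) <= e * Rabs (w y))) ->
  Derive_n w 5 x = 120 * b ^ 5 / k.
Proof.
intros HJ Hw Hx Hk Hg g0 H. set (L := b ^ 5 / k).
assert (Pk := Rabs_pos_lt k Hk).
assert (D0 : Derive_n (fun y => w y - L * (y - x) ^ 5) 5 x = 0).
{ apply derivs_of_littleo with J 5%nat; trivial. 
  - apply smooth1_minus; trivial. now apply smooth1_shift_pow.
  - intros e He.
    (* |g| <= (|b| + 1) |s| near x, so [M] bounds g^5 relative to s^5 and |w| <= 2 M / |k| |s|^5.
       The tolerance in [He2] is scaled so that the o(w) error costs at most half of e |k| |s|^5. *)
    set (M := (Rabs b + 1) ^ 5). assert (HM : 0 < M) by (apply pow_lt; generalize (Rabs_pos b); lra).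
    assert (Cp : continuous (fun z => z ^ 5) b).
    { apply @ex_derive_continuous. auto_derive. trivial. }
    assert (He1 : 0 < e * Rabs k / 2) by (apply Rdiv_lt_0_compat; [now apply Rmult_lt_0_compat | lra]).
    assert (He2 : 0 < e * Rabs k / 2 / (2 * M / Rabs k)).
    { apply Rdiv_lt_0_compat; trivial. apply Rdiv_lt_0_compat; lra. }
    rewrite continuous_R in Cp. specialize (Cp _ He1). apply locally_R in Cp. destruct Cp as [d [Hd Cp]].
    assert (Hd2 : 0 < d / 2) by lra.
    assert (Hk2 : 0 < Rabs k / 2) by lra.
    generalize (filter_and _ _ (filter_and _ _ (H _ He2) (H _ Hk2))
      (filter_and _ _ (proj1 (is_derive_R _ _ _) Hg _ Hd2) (is_derive_lipschitz _ _ _ Hg))).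
    apply filter_imp. intros y [[H1 H2] [G1 G2]]. rewrite g0, Rminus_0_r in G1, G2.
    set (s := y - x) in *.
    assert (Ps : 0 <= Rabs s ^ 5) by (apply pow_le, Rabs_pos).
    assert (Gp : Rabs (g y ^ 5) <= M * Rabs s ^ 5).
    { rewrite <- RPow_abs. unfold M. rewrite <- Rpow_mult_distr. apply pow_incr. split. apply Rabs_pos. exact G2. }
    assert (W : Rabs (w y) <= 2 * M / Rabs k * Rabs s ^ 5).
    { apply Rmult_le_reg_l with (Rabs k / 2); trivial.
      replace (Rabs k / 2 * (2 * M / Rabs k * Rabs s ^ 5)) with (M * Rabs s ^ 5) by (field; lra).
      assert (T : Rabs k * Rabs (w y) <= Rabs (g y ^ 5 - k * w y) + Rabs (g y ^ 5)).
      { rewrite <- Rabs_mult. replace (k * w y) with (- (g y ^ 5 - k * w y) + g y ^ 5) at 1 by ring.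
        eapply Rle_trans. apply Rabs_triang. rewrite Rabs_Ropp. lra. }
      lra. }
    assert (Gs : Rabs (g y ^ 5 - b ^ 5 * s ^ 5) <= e * Rabs k / 2 * Rabs s ^ 5).
    { destruct (Req_dec s 0) as [S0|S0].
      - rewrite S0 in G1. rewrite !Rabs_R0, Rmult_0_r, Rmult_0_r, Rminus_0_r in G1.
        assert (g y = 0). { destruct (Req_dec (g y) 0) as [Z|Z]; trivial. apply Rabs_pos_lt in Z. lra. }
        rewrite H0, S0. replace (0 ^ 5 - b ^ 5 * 0 ^ 5) with 0 by ring. rewrite Rabs_R0. simpl. lra.
      - replace (g y ^ 5 - b ^ 5 * s ^ 5) with (((g y / s) ^ 5 - b ^ 5) * s ^ 5) by (field; trivial).
        rewrite Rabs_mult, <- (RPow_abs s). apply Rmult_le_compat_r; trivial. left. apply Cp.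
        assert (Ps0 := Rabs_pos_lt s S0).
        replace (g y / s - b) with ((g y - b * s) / s) by (field; trivial).
        rewrite Rabs_div by trivial. apply Rmult_lt_reg_r with (Rabs s); trivial.
        unfold Rdiv. rewrite Rmult_assoc, Rinv_l by lra. nra. }
    apply Rmult_le_reg_l with (Rabs k); trivial. rewrite <- Rabs_mult.
    replace (k * (w y - L * s ^ 5)) with (- (g y ^ 5 - k * w y) + (g y ^ 5 - b ^ 5 * s ^ 5)) by (unfold L; field; trivial).
    eapply Rle_trans. apply Rabs_triang. rewrite Rabs_Ropp.
    assert (e * Rabs k / 2 / (2 * M / Rabs k) * Rabs (w y) <= e * Rabs k / 2 * Rabs s ^ 5).
    { apply Rle_trans with (e * Rabs k / 2 / (2 * M / Rabs k) * (2 * M / Rabs k * Rabs s ^ 5)).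
      apply Rmult_le_compat_l; lra. right. field. lra. }
    lra. }
rewrite Derive_n_minus, Derive_n5_pow5 in D0.
- unfold L in D0. unfold Rdiv in *. lra.
- now apply smooth1_derivs_near with J.
- apply smooth1_derivs_near with J; trivial. now apply smooth1_shift_pow.
Qed.

(* Matching the orders [s^4] and [s^5] of [m w = A s^4 + O(w^2)], [s = y - x],
   where [w] has no term of order [s^5]. *)
Lemma quartic_coefficient (J : R -> Prop) (w m : R -> R) (x l A C : R) : open J -> smooth1 J w -> J x -> w x = 0 ->
  Derive_n w 5 x = 0 -> is_derive m x l -> m x <> 0 -> A <> 0 -> 0 < C ->
  locally x (fun y => Rabs (A * (y - x) ^ 4 - m y * w y) <= C * w y ^ 2) -> l = 0.
Proof.
intros HJ Hw Hx w0 w5 Hm m0 HA HC H.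
assert (Pm := Rabs_pos_lt _ m0).
assert (PA := Rabs_pos_lt _ HA).
assert (Dw := smooth1_derivable J w x Hw Hx).
(* Near x one has |m y| >= |m x| / 2, and the quadratic error is at most |m x| / 4 |w|; absorbing it
   leaves |m x| / 4 |w| <= |A| s^4. *)
set (K := 4 * Rabs A / Rabs (m x)). assert (HK : 0 < K) by (apply Rdiv_lt_0_compat; lra).
assert (W4 : locally x (fun y => Rabs (w y) <= K * Rabs (y - x) ^ 4)).
{ assert (E1 : 0 < Rabs (m x) / 2) by lra. assert (E2 : 0 < Rabs (m x) / 4 / C) by (apply Rdiv_lt_0_compat; lra).
  generalize (filter_and _ _ H (filter_and _ _ (is_derive_close _ _ _ _ Hm E1) (is_derive_close _ _ _ _ Dw E2))).
  apply filter_imp. intros y [H1 [H2 H3]]. rewrite w0, Rminus_0_r in H3.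
  assert (M : Rabs (m x) / 2 <= Rabs (m y)).
  { assert (T := Rabs_triang (m x - m y) (m y)). rewrite (Rabs_minus_sym (m x)) in T.
    replace (m x - m y + m y) with (m x) in T by ring. lra. }
  assert (Q : C * w y ^ 2 <= Rabs (m x) / 4 * Rabs (w y)).
  { rewrite <- (pow2_abs (w y)). replace (C * Rabs (w y) ^ 2) with (C * Rabs (w y) * Rabs (w y)) by ring.
    apply Rmult_le_compat_r. apply Rabs_pos. apply Rmult_le_reg_r with (/ C). now apply Rinv_0_lt_compat.
    replace (C * Rabs (w y) * / C) with (Rabs (w y)) by (field; lra). unfold Rdiv in H3. lra. }
  assert (T : Rabs (m y) * Rabs (w y) <= Rabs (A * (y - x) ^ 4 - m y * w y) + Rabs A * Rabs (y - x) ^ 4).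
  { rewrite RPow_abs, <- !Rabs_mult. replace (m y * w y) with (- (A * (y - x) ^ 4 - m y * w y) + A * (y - x) ^ 4) at 1 by ring.
    eapply Rle_trans. apply Rabs_triang. rewrite Rabs_Ropp. lra. }
  assert (Rabs (m x) / 2 * Rabs (w y) <= Rabs (m y) * Rabs (w y)) by (apply Rmult_le_compat_r; trivial; apply Rabs_pos).
  apply Rmult_le_reg_l with (Rabs (m x) / 4). lra.
  replace (Rabs (m x) / 4 * (K * Rabs (y - x) ^ 4)) with (Rabs A * Rabs (y - x) ^ 4) by (unfold K; field; lra). lra. }
assert (W3 : forall k, (k <= 3)%nat -> Derive_n w k x = 0).
{ apply derivs_of_littleo with J; trivial. intros e He.
  assert (L1 : locally x (fun y => Rabs (y - x) < e / K)).
  { apply locally_R. exists (e / K). split; trivial. now apply Rdiv_lt_0_compat. }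
  generalize (filter_and _ _ W4 L1). apply filter_imp. intros y [H1 H2].
  eapply Rle_trans. exact H1. replace (K * Rabs (y - x) ^ 4) with (K * Rabs (y - x) * Rabs (y - x) ^ 3) by ring.
  apply Rmult_le_compat_r. apply pow_le, Rabs_pos. apply Rmult_le_reg_r with (/ K). now apply Rinv_0_lt_compat.
  replace (K * Rabs (y - x) * / K) with (Rabs (y - x)) by (field; lra). unfold Rdiv in H2. lra. }
set (c := Derive_n w 4 x / 24).
set (B := Rabs (Derive_n w 6 x) + 1). assert (HB : 0 < B) by (unfold B; generalize (Rabs_pos (Derive_n w 6 x)); lra).
set (Q := (Rabs (m x) + 1) * B + C * K ^ 2).
assert (HQ : 0 < Q).
{ unfold Q. assert (0 < (Rabs (m x) + 1) * B) by (apply Rmult_lt_0_compat; lra).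
  assert (0 < C * K ^ 2) by (apply Rmult_lt_0_compat; trivial; now apply pow_lt). lra. }
(* As w has no fifth-order term, w = c s^4 + O(s^6), and division by s^4 gives m c - A = O(s^2).
   Order zero then yields m(x) c = A, so c <> 0, and order one yields l c = 0. *)
assert (L : exists d, 0 < d /\ forall y, x < y < x + d -> Rabs (m y * c - A) <= Q * (y - x) ^ 2).
{ assert (E1 : locally x (fun y => J y /\ Rabs (y - x) < 1 /\ Rabs (Derive_n w 6 y - Derive_n w 6 x) < 1
    /\ Rabs (m y - m x) < 1 /\ Rabs (w y) <= K * Rabs (y - x) ^ 4 /\
    Rabs (A * (y - x) ^ 4 - m y * w y) <= C * w y ^ 2)).
  { apply filter_and. now apply HJ. apply filter_and. apply locally_R. exists 1. split; trivial; lra.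
    apply filter_and. apply smooth1_Derive_n_close with J; trivial; lra.
    apply filter_and. eapply is_derive_close. exact Hm. lra. now apply filter_and. }
  apply locally_R in E1. destruct E1 as [d [Hd E1]]. exists d. split; trivial. intros y Hy.
  assert (N : forall z, x <= z <= y -> Rabs (z - x) < d) by (intros; apply Rabs_def1; lra).
  destruct (E1 y) as [_ [Y1 [_ [Y2 [Y3 Y4]]]]]. apply N; lra.
  destruct (Taylor_Lagrange w 5 x y) as [z [Hz E]]. lra.
  { intros z Hz j _. apply Hw. apply E1. now apply N. }
  cbn [sum_f_R0] in E. rewrite w5 in E.
  rewrite (W3 0%nat), (W3 1%nat), (W3 2%nat), (W3 3%nat) in E by lia.
  destruct (E1 z) as [_ [_ [Z1 _]]]. apply N; lra.
  set (s := y - x) in *. assert (Hs : 0 < s) by (unfold s; lra).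
  rewrite (Rabs_pos_eq s) in Y1, Y3 by lra.
  assert (Ew : w y = c * s ^ 4 + Derive_n w 6 z / 720 * s ^ 6).
  { rewrite E. unfold c. replace (INR (fact 6)) with 720 by (simpl; ring).
    replace (INR (fact 4)) with 24 by (simpl; ring). field. repeat split; apply INR_fact_neq_0. }
  assert (Bz : Rabs (Derive_n w 6 z) <= B).
  { unfold B. assert (T := Rabs_triang (Derive_n w 6 z - Derive_n w 6 x) (Derive_n w 6 x)).
    replace (Derive_n w 6 z - Derive_n w 6 x + Derive_n w 6 x) with (Derive_n w 6 z) in T by ring. lra. }
  assert (My : Rabs (m y) <= Rabs (m x) + 1).
  { assert (T := Rabs_triang (m y - m x) (m x)). replace (m y - m x + m x) with (m y) in T by ring. lra. }
  assert (Ps : 0 < s ^ 4) by now apply pow_lt.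
  apply Rmult_le_reg_r with (s ^ 4); trivial.
  rewrite <- (Rabs_pos_eq (s ^ 4)) at 1 by lra. rewrite <- Rabs_mult.
  replace ((m y * c - A) * s ^ 4) with (- (A * s ^ 4 - m y * w y) + - (m y * (Derive_n w 6 z / 720) * s ^ 6)) by (rewrite Ew; ring).
  eapply Rle_trans. apply Rabs_triang. rewrite !Rabs_Ropp.
  assert (T1 : C * w y ^ 2 <= C * K ^ 2 * s ^ 6).
  { rewrite Rmult_assoc. apply Rmult_le_compat_l. lra. rewrite <- pow2_abs.
    apply Rle_trans with ((K * s ^ 4) ^ 2). apply pow_incr. split; trivial. apply Rabs_pos.
    replace ((K * s ^ 4) ^ 2) with (K ^ 2 * (s ^ 6 * s ^ 2)) by ring.
    apply Rmult_le_compat_l. apply pow_le; lra.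
    rewrite <- (Rmult_1_r (s ^ 6)) at 2. apply Rmult_le_compat_l. apply pow_le; lra.
    rewrite <- (pow1 2). apply pow_incr. lra. }
  assert (T2 : Rabs (m y * (Derive_n w 6 z / 720) * s ^ 6) <= (Rabs (m x) + 1) * B * s ^ 6).
  { rewrite !Rabs_mult, (Rabs_pos_eq (s ^ 6)) by (apply pow_le; lra).
    apply Rmult_le_compat_r. apply pow_le; lra. apply Rmult_le_compat; trivial; try apply Rabs_pos.
    unfold Rdiv. rewrite Rabs_mult, (Rabs_pos_eq (/ 720)) by lra. generalize (Rabs_pos (Derive_n w 6 z)). lra. }
  replace (Q * s ^ 2 * s ^ 4) with (C * K ^ 2 * s ^ 6 + (Rabs (m x) + 1) * B * s ^ 6) by (unfold Q; ring).
  lra. }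
destruct L as [d [Hd L]].
assert (Ph : is_derive (fun y => m y * c - A) x (l * c)).
{ auto_derive. now exists l. rewrite Rmult_1_l. f_equal. apply (is_derive_unique _ _ _ Hm). }
assert (Z : forall e, 0 < e -> exists y, x < y < x + d /\ y - x < e /\
  Rabs ((m y * c - A) - (m x * c - A)) <= (Rabs (l * c) + 1) * (y - x) /\
  Rabs ((m y * c - A) - (m x * c - A) - l * c * (y - x)) <= e * (y - x)).
{ intros e He. 
  assert (E1 := filter_and _ _ (is_derive_lipschitz _ _ _ Ph) (proj1 (is_derive_R _ _ _) Ph e He)).
  apply locally_R in E1. destruct E1 as [d' [Hd' E1]].
  set (r := Rmin (Rmin d d') e / 2).
  assert (Hr : 0 < r /\ r < d /\ r < d' /\ r < e).
  { assert (0 < Rmin (Rmin d d') e) by (repeat apply Rmin_glb_lt; trivial).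
    generalize (Rmin_l (Rmin d d') e) (Rmin_r (Rmin d d') e) (Rmin_l d d') (Rmin_r d d'). unfold r. lra. }
  exists (x + r). destruct (E1 (x + r)) as [A1 A2].
  { replace (x + r - x) with r by ring. rewrite Rabs_pos_eq; lra. }
  replace (Rabs (x + r - x)) with (x + r - x) in A1, A2 by (symmetry; apply Rabs_pos_eq; lra).
  split; [lra|]. split; [lra|]. split; [exact A1 | exact A2]. }
assert (P0 : m x * c - A = 0).
{ destruct (Req_dec (m x * c - A) 0) as [E|E]; trivial. exfalso. apply Rabs_pos_lt in E.
  set (G := Q * d + (Rabs (l * c) + 1)).
  assert (HG : 0 < G). { unfold G. assert (0 < Q * d) by now apply Rmult_lt_0_compat. generalize (Rabs_pos (l * c)). lra. }
  assert (HeG : 0 < Rabs (m x * c - A) / G) by now apply Rdiv_lt_0_compat.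
  destruct (Z _ HeG) as [y [Y1 [Y2 [Y3 _]]]].
  specialize (L y Y1).
  assert (T := Rabs_triang (m y * c - A) (- ((m y * c - A) - (m x * c - A)))).
  rewrite Rabs_Ropp in T. replace (m y * c - A + - (m y * c - A - (m x * c - A))) with (m x * c - A) in T by ring.
  assert (Q * (y - x) ^ 2 <= Q * d * (y - x)).
  { replace (Q * (y - x) ^ 2) with (Q * (y - x) * (y - x)) by ring. apply Rmult_le_compat_r. lra. apply Rmult_le_compat_l; lra. }
  assert (Rabs (m x * c - A) <= G * (y - x)) by (unfold G; lra).
  apply (Rmult_lt_compat_l G) in Y2; trivial. replace (G * (Rabs (m x * c - A) / G)) with (Rabs (m x * c - A)) in Y2 by (field; lra).
  lra. }
assert (c0 : c <> 0). { intro E. rewrite E in P0. lra. }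
assert (lc : l * c = 0).
{ destruct (Req_dec (l * c) 0) as [E|E]; trivial. exfalso. apply Rabs_pos_lt in E.
  assert (Hee : 0 < Rabs (l * c) / (2 * (Q + 1))) by (apply Rdiv_lt_0_compat; lra).
  destruct (Z _ Hee) as [y [Y1 [Y2 [_ Y3]]]]. specialize (L y Y1). rewrite P0, Rminus_0_r in Y3.
  assert (T := Rabs_triang (m y * c - A) (- ((m y * c - A) - l * c * (y - x)))).
  rewrite Rabs_Ropp in T. replace (m y * c - A + - (m y * c - A - l * c * (y - x))) with (l * c * (y - x)) in T by ring.
  rewrite Rabs_mult, (Rabs_pos_eq (y - x)) in T by lra.
  assert (Rabs (l * c) * (y - x) <= (Q * (y - x) + Rabs (l * c) / (2 * (Q + 1))) * (y - x)) by nra.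
  apply Rmult_le_reg_r in H0; [|lra].
  assert (Q * (y - x) <= Q * (Rabs (l * c) / (2 * (Q + 1)))) by (apply Rmult_le_compat_l; lra).
  assert (Q * (Rabs (l * c) / (2 * (Q + 1))) + Rabs (l * c) / (2 * (Q + 1)) = Rabs (l * c) / 2) by (field; lra).
  lra. }
apply Rmult_integral in lc. tauto.
Qed.

(** * The form of admissible transformations *)

(** The error is measured by h2 - h1 and not by y - x, although both graphs move with y; this is
    where strict differentiability is used. *)
Lemma slope_along W f t x u (h1 h2 : R -> R) : open W -> smooth3 W f -> W (t, x, u) ->
  h1 x = u -> h2 x = u -> continuous h1 x -> continuous h2 x ->
  forall e, 0 < e -> locally x (fun y =>
    Rabs (f t y (h2 y) - f t y (h1 y) - du3 f t x u * (h2 y - h1 y)) <= e * Rabs (h2 y - h1 y)).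
Proof.
intros HW Hf Hp E1 E2 C1 C2 e He.
destruct (Ck3_strict 0 _ _ _ _ _ HW (Hf 1%nat) Hp e He) as [d [Hd S]].
rewrite continuous_R in C1, C2. specialize (C1 d Hd). specialize (C2 d Hd). rewrite E1 in C1. rewrite E2 in C2.
assert (L : locally x (fun y => Rabs (y - x) < d)) by (apply locally_R; exists d; now split).
generalize (filter_and _ _ L (filter_and _ _ C1 C2)). apply filter_imp. intros y [Hy [H1 H2]].
assert (Z : Rabs (t - t) < d) by now rewrite Rminus_diag, Rabs_R0.
specialize (S t y (h1 y) t y (h2 y) Z Hy H1 Z Hy H2).
rewrite !Rminus_diag, Rabs_R0, !Rmult_0_r, !Rplus_0_l in S. exact S.
Qed.

Lemma is_derive_continuous (f : R -> R) x l : is_derive f x l -> continuous f x.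
Proof. intro H. apply @ex_derive_continuous. now exists l. Qed.

Lemma admissible_facts E phi E' t x u : admissible E phi E' -> Omega phi (t, x, u) ->
  beta E t <> 0 /\ beta E' (Tt phi t x u) <> 0 /\ jacobian phi t x u <> 0 /\
  open (Omega phi) /\ smooth3 (Omega phi) (Tt phi) /\ smooth3 (Omega phi) (Xt phi) /\
  smooth3 (Omega phi) (Ut phi).
Proof.
intros [[_ [_ [_ B]]] [[_ [_ [_ B']]] [[HO [_ [HT [HX [HU HJ]]]]] [HD _]]]] Hp.
destruct (HD _ _ _ Hp). repeat split; auto.
Qed.

Lemma Derive_n_minus_smooth J f g n x : open J -> smooth1 J f -> smooth1 J g -> J x ->
  Derive_n (fun y => f y - g y) n x = Derive_n f n x - Derive_n g n x.
Proof. intros. apply Derive_n_minus; now apply smooth1_derivs_near with J. Qed.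

(* Perturbing the test function by [(T - T0)^5] does not change whether it solves
   the target equation, but changes u_xxxxx by a multiple of the fifth power of
   the x-derivative of T along the graph. *)
Lemma Tt_along_graph E phi E' t x u p q : admissible E phi E' -> Omega phi (t, x, u) ->
  du3 (Ut phi) t x u - p * du3 (Tt phi) t x u - q * du3 (Xt phi) t x u <> 0 ->
  dx3 (Tt phi) t x u * (du3 (Ut phi) t x u - q * du3 (Xt phi) t x u)
  = du3 (Tt phi) t x u * (dx3 (Ut phi) t x u - q * dx3 (Xt phi) t x u).
Proof.
intros Ha Hp Hk.
destruct (admissible_facts _ _ _ _ _ _ Ha Hp) as [B [B' [_ [HO [HT [HX HU]]]]]].
set (T0 := Tt phi t x u) in *. set (U0 := Ut phi t x u).
set (r := - (p + U0 * q + alpha E' T0 * U0) / (120 * beta E' T0)).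
assert (Hr : p + U0 * q + alpha E' T0 * U0 + beta E' T0 * (120 * r) = 0) by (unfold r; field; trivial).
destruct (admissible_test E phi E' t x u p q r 0 0 Ha Hp Hk Hr) as [J1 [h1 [J1o [J1x [S1 [E1 [D1 [G1 R1]]]]]]]].
destruct (admissible_test E phi E' t x u p q r 1 0 Ha Hp Hk Hr) as [J2 [h2 [J2o [J2x [S2 [E2 [D2 [G2 R2]]]]]]]].
set (k := du3 (Ut phi) t x u - p * du3 (Tt phi) t x u - q * du3 (Xt phi) t x u) in *.
set (kx := dx3 (Ut phi) t x u - p * dx3 (Tt phi) t x u - q * dx3 (Xt phi) t x u) in *.
assert (Jo : open (fun y => J1 y /\ J2 y)) by now apply open_and.
assert (S1' : smooth1 (fun y => J1 y /\ J2 y) h1) by (apply smooth1_sub with (2 := S1); tauto).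
assert (S2' : smooth1 (fun y => J1 y /\ J2 y) h2) by (apply smooth1_sub with (2 := S2); tauto).
(* The two tests share p and q, so the equations [R1] and [R2] have the same first-order part. *)
assert (W5 : Derive_n (fun y => h2 y - h1 y) 5 x = 0).
{ rewrite (Derive_n_minus_smooth _ h2 h1 5 x Jo S2' S1') by now split.
  assert (beta E t * (Derive_n h2 5 x - Derive_n h1 5 x) = 0) by lra.
  apply Rmult_integral in H. tauto. }
set (b := dx3 (Tt phi) t x u + du3 (Tt phi) t x u * (- kx / k)).
assert (Hg : is_derive (fun y => Tt phi t y (h2 y) - T0) x b).
{ replace b with (b - 0) by ring. apply (is_derive_minus (V := R_NormedModule)).
  - generalize (is_derive_along_x (Omega phi) (Tt phi) h2 t x (- kx / k)). rewrite E2. now auto.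
  - apply is_derive_const_R. }
destruct Ha as [HE [HE' [HP _]]].
destruct (gap_derivs phi t x u p q r 0 0 HP Hp) as [_ [_ [_ Fu]]]. fold k in Fu.
assert (F5 : Derive_n (fun y => h2 y - h1 y) 5 x = 120 * b ^ 5 / k).
{ apply (fifth_derivative (fun y => J1 y /\ J2 y)) with (g := fun y => Tt phi t y (h2 y) - T0); trivial.
  - now apply smooth1_minus.
  - now split.
  - rewrite E2. unfold T0. ring.
  (* The [gap] of the first test vanishes on the first graph and equals (T - T0)^5 on the second,
     while its increment is k (h2 - h1) up to o(h2 - h1). *)
  - intros e He. 
    generalize (filter_and _ _ (Jo x (conj J1x J2x)) (slope_along (Omega phi) (gap phi t x u p q r 0 0) t x u h1 h2 HO
      (gap_smooth _ _ _ _ _ _ _ _ _ HP) Hp E1 E2 (is_derive_continuous _ _ _ D1) (is_derive_continuous _ _ _ D2) e He)).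
    apply filter_imp. intros y [[Y1 Y2] H]. rewrite Fu in H.
    destruct (G1 y Y1) as [_ G1y]. destruct (G2 y Y2) as [_ G2y].
    replace (gap phi t x u p q r 0 0 t y (h1 y)) with 0 in H by (unfold gap; lra).
    replace (gap phi t x u p q r 0 0 t y (h2 y)) with ((Tt phi t y (h2 y) - T0) ^ 5) in H
      by (unfold gap; rewrite G2y; unfold test, T0; ring).
    now rewrite Rminus_0_r in H. }
assert (b0 : b = 0).
{ rewrite W5 in F5. destruct (Req_dec b 0) as [Z|Z]; trivial. exfalso.
  apply (pow_nonzero _ 5) in Z. apply Z. apply Rmult_eq_reg_l with (120 / k).
  replace (120 / k * b ^ 5) with (120 * b ^ 5 / k) by (field; trivial). lra.
  apply Rmult_integral_contrapositive; split. lra. now apply Rinv_neq_0_compat. }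
assert (dx3 (Tt phi) t x u * k = du3 (Tt phi) t x u * kx).
{ unfold b in b0. apply (f_equal (fun z => z * k)) in b0. field_simplify in b0; trivial. lra. }
unfold k, kx in H. lra.
Qed.

(** If T_u <> 0, some p makes k = 1 for every q, so the relation along graphs may be compared at q =
    0 and q = 1: the (x, u)-gradients of X and U are both parallel to that of T, and the Jacobian
    vanishes. If T_u = 0, any q with U_u - q X_u <> 0 gives T_x = 0. *)
Lemma Tt_depends_on_t E phi E' t x u : admissible E phi E' -> Omega phi (t, x, u) ->
  dx3 (Tt phi) t x u = 0 /\ du3 (Tt phi) t x u = 0.
Proof.
intros Ha Hp. destruct (admissible_facts _ _ _ _ _ _ Ha Hp) as [_ [_ [HJ _]]].
assert (H : forall p q, _) by (intros p q; exact (Tt_along_graph E phi E' t x u p q Ha Hp)).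
unfold jacobian in HJ.
set (Tx := dx3 (Tt phi) t x u) in *. set (Tu := du3 (Tt phi) t x u) in *. set (Ts := dt3 (Tt phi) t x u) in *.
set (Xx := dx3 (Xt phi) t x u) in *. set (Xu := du3 (Xt phi) t x u) in *. set (Xs := dt3 (Xt phi) t x u) in *.
set (Ux := dx3 (Ut phi) t x u) in *. set (Uu := du3 (Ut phi) t x u) in *. set (Us := dt3 (Ut phi) t x u) in *.
clearbody Tx Tu Ts Xx Xu Xs Ux Uu Us.
destruct (Req_dec Tu 0) as [Z|Z].
- split; trivial. rewrite Z in H, HJ.
  destruct (Req_dec Xu 0) as [Y|Y].
  + rewrite Y in H, HJ. assert (Uu <> 0). { intro V. apply HJ. rewrite V. ring. }
    specialize (H 0 0). assert (Tx * Uu = 0) by (rewrite <- (Rminus_0_r Uu), <- (Rmult_0_l 0) at 1; rewrite H; lra).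
    apply Rmult_integral in H1. tauto.
  + specialize (H 0 ((Uu - 1) / Xu)).
    replace (Uu - 0 * 0 - (Uu - 1) / Xu * Xu) with 1 in H by (field; trivial).
    replace (Uu - (Uu - 1) / Xu * Xu) with 1 in H by (field; trivial). lra.
- exfalso.
  (* p = (U_u - q X_u - 1) / T_u is the value for which k = 1. *)
  assert (K : forall q, Uu - (Uu - q * Xu - 1) / Tu * Tu - q * Xu <> 0).
  { intro q. replace (Uu - (Uu - q * Xu - 1) / Tu * Tu - q * Xu) with 1 by (field; trivial). lra. }
  generalize (H _ 0 (K 0)) (H _ 1 (K 1)). intros H0 H1.
  apply HJ. apply Rmult_eq_reg_l with Tu; trivial. rewrite Rmult_0_r.
  assert (H2 : Tx * Uu = Tu * Ux) by lra.
  assert (H3 : Tx * Xu = Tu * Xx) by lra.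
  transitivity (Ts * ((Tu * Xx) * Uu - Xu * (Tu * Ux)) - Tu * (Xs * (Tx * Uu) - (Tx * Xu) * Us)
    + Tu * (Xs * (Tu * Ux) - (Tu * Xx) * Us)). ring.
  rewrite <- H2, <- H3. ring.
Qed.

Lemma constant_slope (f df : R -> R) a b l :
  (forall x, Rmin a b <= x <= Rmax a b -> is_derive f x (df x) /\ df x = l) ->
  f b - f a = l * (b - a).
Proof.
intro H. assert (S : Rabs (f b - f a - l * (b - a)) <= 0 * Rabs (b - a)).
{ apply mean_value_slope with df; intros x Hx; destruct (H x Hx) as [H1 H2]; trivial.
  rewrite H2, Rminus_diag, Rabs_R0. lra. }
rewrite Rmult_0_l in S. destruct (Req_dec (f b - f a - l * (b - a)) 0) as [E|E]. lra.
apply Rabs_pos_lt in E. lra.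
Qed.

Lemma affine_in_x W f t y y' u l : smooth3 W f ->
  (forall x, Rmin y y' <= x <= Rmax y y' -> W (t, x, u) /\ dx3 f t x u = l) ->
  f t y' u - f t y u = l * (y' - y).
Proof.
intros Hf H. apply (constant_slope (fun x => f t x u) (fun x => dx3 f t x u)).
intros x Hx. destruct (H x Hx). split; trivial. now apply (smooth3_derivs W f).
Qed.

Lemma affine_in_u W f t x z z' l : smooth3 W f ->
  (forall u, Rmin z z' <= u <= Rmax z z' -> W (t, x, u) /\ du3 f t x u = l) ->
  f t x z' - f t x z = l * (z' - z).
Proof.
intros Hf H. apply (constant_slope (fun u => f t x u) (fun u => du3 f t x u)).
intros u Hu. destruct (H u Hu). split; trivial. now apply (smooth3_derivs W f).
Qed.

Lemma constant_in_xu W f d t0 x0 u0 t y z y' z' : smooth3 W f ->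
  (forall t x u, Rabs (t - t0) < d -> Rabs (x - x0) < d -> Rabs (u - u0) < d -> W (t, x, u)) ->
  (forall t x u, W (t, x, u) -> dx3 f t x u = 0 /\ du3 f t x u = 0) ->
  Rabs (t - t0) < d -> Rabs (y - x0) < d -> Rabs (z - u0) < d -> 
  Rabs (y' - x0) < d -> Rabs (z' - u0) < d -> f t y' z' = f t y z.
Proof.
intros Hf B H Ht Hy Hz Hy' Hz'.
assert (E1 : f t y' z' - f t y z' = 0 * (y' - y)).
{ apply (affine_in_x W); trivial. intros x Hx. 
  assert (W (t, x, z')) by (apply B; trivial; eapply between_close; eassumption). split; trivial. now apply H. }
assert (E2 : f t y z' - f t y z = 0 * (z' - z)).
{ apply (affine_in_u W); trivial. intros x Hx. 
  assert (W (t, y, x)) by (apply B; trivial; eapply between_close; eassumption). split; trivial. now apply H. }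
lra.
Qed.

Lemma graph_near (h : R -> R) x u d : continuous h x -> h x = u -> 0 < d ->
  locally x (fun y => Rabs (y - x) < d /\ Rabs (h y - u) < d).
Proof.
intros C E Hd. apply filter_and. apply locally_R. now exists d.
rewrite continuous_R in C. rewrite <- E. now apply C.
Qed.

(* Here the test functions differ by a multiple of [T - T0] and by [(X - X0)^5],
   in a combination that satisfies the target equation to leading order. *)
Lemma Xt_along_graph E phi E' t x u q : admissible E phi E' -> Omega phi (t, x, u) ->
  let k := du3 (Ut phi) t x u - q * du3 (Xt phi) t x u in k <> 0 ->
  beta E t * (dx3 (Xt phi) t x u +
    du3 (Xt phi) t x u * (- (dx3 (Ut phi) t x u - q * dx3 (Xt phi) t x u) / k)) ^ 5
  = beta E' (Tt phi t x u) * dt3 (Tt phi) t x u.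
Proof.
intros Ha Hp k Hk.
destruct (admissible_facts _ _ _ _ _ _ Ha Hp) as [B [B' [_ [HO [HT [HX HU]]]]]].
destruct (Tt_depends_on_t _ _ _ _ _ _ Ha Hp) as [Tx Tu].
set (T0 := Tt phi t x u) in *. set (U0 := Ut phi t x u). set (X0 := Xt phi t x u).
(* The drop of p by 120 beta' compensates the increase of r by 1 in the target residual. It also
   changes kt by 120 beta' T_t, which balances the jump of the fifth derivative. *)
set (p := 0). set (p' := - (120 * beta E' T0)).
set (r := - (p + U0 * q + alpha E' T0 * U0) / (120 * beta E' T0)).
assert (Hr : p + U0 * q + alpha E' T0 * U0 + beta E' T0 * (120 * r) = 0) by (unfold r; field; trivial).
assert (Hr' : p' + U0 * q + alpha E' T0 * U0 + beta E' T0 * (120 * (r + 1)) = 0) by (unfold r, p', p; field; trivial).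
assert (Hk0 : forall a, du3 (Ut phi) t x u - a * du3 (Tt phi) t x u - q * du3 (Xt phi) t x u = k)
  by (intro a; rewrite Tu; unfold k; ring).
assert (Hkx : forall a, dx3 (Ut phi) t x u - a * dx3 (Tt phi) t x u - q * dx3 (Xt phi) t x u
  = dx3 (Ut phi) t x u - q * dx3 (Xt phi) t x u) by (intro a; rewrite Tx; ring).
set (kx := dx3 (Ut phi) t x u - q * dx3 (Xt phi) t x u) in *.
assert (K1 := admissible_test E phi E' t x u p q r 0 0 Ha Hp).
assert (K2 := admissible_test E phi E' t x u p' q (r + 1) 0 0 Ha Hp).
cbv zeta in K1, K2. rewrite Hk0, Hkx in K1, K2.
destruct (K1 Hk Hr) as [J1 [h1 [J1o [J1x [S1 [E1 [D1 [G1 R1]]]]]]]].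
destruct (K2 Hk Hr') as [J2 [h2 [J2o [J2x [S2 [E2 [D2 [G2 R2]]]]]]]].
clear K1 K2. fold T0 U0 X0 in G1, G2.
assert (Jo : open (fun y => J1 y /\ J2 y)) by now apply open_and.
assert (S1' : smooth1 (fun y => J1 y /\ J2 y) h1) by (apply smooth1_sub with (2 := S1); tauto).
assert (S2' : smooth1 (fun y => J1 y /\ J2 y) h2) by (apply smooth1_sub with (2 := S2); tauto).
set (b := dx3 (Xt phi) t x u + du3 (Xt phi) t x u * (- kx / k)).
assert (Hg : is_derive (fun y => Xt phi t y (h2 y) - X0) x b).
{ replace b with (b - 0) by ring. apply (is_derive_minus (V := R_NormedModule)).
  - generalize (is_derive_along_x (Omega phi) (Xt phi) h2 t x (- kx / k)). rewrite E2. now auto.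
  - apply is_derive_const_R. }
assert (HP : point_transformation phi) by apply Ha.
destruct (gap_derivs phi t x u p q r 0 0 HP Hp) as [_ [_ [_ Fu]]]. rewrite Hk0 in Fu.
destruct (open_box _ _ _ _ HO Hp) as [d [Hd Bx]].
assert (F5 : Derive_n (fun y => h2 y - h1 y) 5 x = 120 * b ^ 5 / k).
{ apply (fifth_derivative (fun y => J1 y /\ J2 y)) with (g := fun y => Xt phi t y (h2 y) - X0); trivial.
  - now apply smooth1_minus.
  - now split.
  - rewrite E2. unfold X0. ring.
  - intros e He.
    assert (C1 := is_derive_continuous _ _ _ D1). assert (C2 := is_derive_continuous _ _ _ D2).
    generalize (filter_and _ _ (filter_and _ _ (Jo x (conj J1x J2x)) (graph_near h2 x u d C2 E2 Hd))
      (slope_along (Omega phi) (gap phi t x u p q r 0 0) t x u h1 h2 HO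
      (gap_smooth _ _ _ _ _ _ _ _ _ HP) Hp E1 E2 C1 C2 e He)).
    apply filter_imp. intros y [[[Y1 Y2] [N1 N2]] H]. rewrite Fu in H.
    destruct (G1 y Y1) as [_ G1y]. destruct (G2 y Y2) as [_ G2y].
    (* T is constant on the graph at fixed t, so the tests, despite their different p, differ there
       exactly by (X - X0)^5. *)
    assert (ET : Tt phi t y (h2 y) = T0).
    { apply (constant_in_xu (Omega phi) (Tt phi) d t x u); trivial; try (rewrite Rminus_diag, Rabs_R0; trivial).
      intros. now apply (Tt_depends_on_t E phi E'). }
    replace (gap phi t x u p q r 0 0 t y (h1 y)) with 0 in H by (unfold gap; fold T0 X0 U0; lra).
    replace (gap phi t x u p q r 0 0 t y (h2 y)) with ((Xt phi t y (h2 y) - X0) ^ 5) in H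
      by (unfold gap; fold T0 X0 U0; rewrite G2y, ET; unfold test; ring).
    now rewrite Rminus_0_r in H. }
rewrite (Derive_n_minus_smooth _ h2 h1 5 x Jo S2' S1') in F5 by now split.
fold kx. fold b.
assert (Q : beta E t * (120 * b ^ 5 / k) = 120 * beta E' T0 * dt3 (Tt phi) t x u / k).
{ rewrite <- F5. unfold p, p' in R1, R2. unfold Rdiv in *. lra. }
apply Rmult_eq_reg_l with (120 / k).
- transitivity (beta E t * (120 * b ^ 5 / k)). field; trivial. rewrite Q. field; trivial.
- apply Rmult_integral_contrapositive; split. lra. now apply Rinv_neq_0_compat.
Qed.

Lemma pow5_lt a b : a < b -> a ^ 5 < b ^ 5.
Proof.
intro L. apply Rminus_lt_0.
(* The quartic cofactor is written as a sum of squares, which shows that it is positive. *)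
replace (b ^ 5 - a ^ 5) with ((b - a) * ((a * (a + b / 2)) ^ 2 + (b * (b + a / 2)) ^ 2 + (a * b) ^ 2 / 2)) by field.
apply Rmult_lt_0_compat. lra.
generalize (pow2_ge_0 (a * (a + b / 2))) (pow2_ge_0 (b * (b + a / 2))) (pow2_ge_0 (a * b)). intros H1 H2 H3.
assert (P : forall z, z <> 0 -> 0 < z ^ 2) by (intros z Hz; rewrite <- Rsqr_pow2; now apply Rsqr_pos_lt).
destruct (Req_dec (a * b) 0) as [Z|Z].
- apply Rmult_integral in Z. destruct Z as [Z|Z]; subst.
  + assert (0 < (b * (b + 0 / 2)) ^ 2) by (apply P; unfold Rdiv; nra). lra.
  + assert (0 < (a * (a + 0 / 2)) ^ 2) by (apply P; unfold Rdiv; nra). lra.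
- apply P in Z. lra.
Qed.

Lemma pow5_inj a b : a ^ 5 = b ^ 5 -> a = b.
Proof.
intro H. destruct (Rtotal_order a b) as [L|[L|L]]; trivial; apply pow5_lt in L; lra.
Qed.

(** If X_u <> 0, then q can be tuned to make k equal to 1 or to 2. The slope of X along the graph is
    (X_x U_u - X_u U_x) / k, but the relation above gives its fifth power a value independent of k;
    so the numerator vanishes, and with it the Jacobian. *)
Lemma Xt_free_of_u E phi E' t x u : admissible E phi E' -> Omega phi (t, x, u) ->
  du3 (Xt phi) t x u = 0 /\ dt3 (Tt phi) t x u <> 0 /\ dx3 (Xt phi) t x u <> 0 /\
  du3 (Ut phi) t x u <> 0 /\
  beta E t * dx3 (Xt phi) t x u ^ 5 = beta E' (Tt phi t x u) * dt3 (Tt phi) t x u.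
Proof.
intros Ha Hp. destruct (admissible_facts _ _ _ _ _ _ Ha Hp) as [B [B' [HJ _]]].
destruct (Tt_depends_on_t _ _ _ _ _ _ Ha Hp) as [Tx Tu].
assert (H : forall q, _) by (intro q; exact (Xt_along_graph E phi E' t x u q Ha Hp)).
unfold jacobian in HJ. rewrite Tx, Tu in HJ.
set (Ts := dt3 (Tt phi) t x u) in *.
set (Xx := dx3 (Xt phi) t x u) in *. set (Xu := du3 (Xt phi) t x u) in *. set (Xs := dt3 (Xt phi) t x u) in *.
set (Ux := dx3 (Ut phi) t x u) in *. set (Uu := du3 (Ut phi) t x u) in *. set (Us := dt3 (Ut phi) t x u) in *.
clearbody Ts Xx Xu Xs Ux Uu Us. cbv zeta in H.
assert (Xu0 : Xu = 0).
{ destruct (Req_dec Xu 0) as [Z|Z]; trivial. exfalso. apply HJ.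
  assert (K : forall c, Uu - (Uu - c) / Xu * Xu = c) by (intro c; field; trivial).
  generalize (H ((Uu - 1) / Xu)) (H ((Uu - 2) / Xu)). rewrite !K. intros H1 H2.
  specialize (H1 R1_neq_R0). assert (N2 : 2 <> 0) by lra. specialize (H2 N2).
  rewrite <- H2 in H1. apply Rmult_eq_reg_l in H1; trivial. apply pow5_inj in H1.
  assert (L1 : Xx + Xu * (- (Ux - (Uu - 1) / Xu * Xx) / 1) = Xx * Uu - Xu * Ux) by (field; trivial).
  assert (L2 : Xx + Xu * (- (Ux - (Uu - 2) / Xu * Xx) / 2) = (Xx * Uu - Xu * Ux) / 2) by (field; trivial).
  rewrite L1, L2 in H1. assert (N : Xx * Uu - Xu * Ux = 0) by lra. rewrite N. ring. }
split; trivial. rewrite Xu0 in H, HJ.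
assert (Ts <> 0) by (intro Z; apply HJ; rewrite Z; ring).
assert (Xx <> 0) by (intro Z; apply HJ; rewrite Z; ring).
assert (Uu <> 0) by (intro Z; apply HJ; rewrite Z; ring).
repeat (split; trivial). specialize (H 0). rewrite Rmult_0_l, Rminus_0_r in H. rewrite <- H; trivial. ring.
Qed.

Lemma Rabs_self_lt x d : 0 < d -> Rabs (x - x) < d.
Proof. intro H. now rewrite Rminus_diag, Rabs_R0. Qed.

(** In beta X_x^5 = beta'(T) T_t everything except X_x depends on t alone; since the fifth power is
    injective, so does X_x, and X is affine in x on the box. *)
Lemma Tt_Xt_near E phi E' d t0 x0 u0 t y z : admissible E phi E' ->
  (forall t x u, Rabs (t - t0) < d -> Rabs (x - x0) < d -> Rabs (u - u0) < d -> Omega phi (t, x, u)) ->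
  Rabs (t - t0) < d -> Rabs (y - x0) < d -> Rabs (z - u0) < d ->
  Tt phi t y z = Tt phi t x0 u0 /\ dt3 (Tt phi) t y z = dt3 (Tt phi) t x0 u0 /\
  dx3 (Xt phi) t y z = dx3 (Xt phi) t x0 u0 /\
  Xt phi t y z = Xt phi t x0 u0 + dx3 (Xt phi) t x0 u0 * (y - x0).
Proof.
intros Ha Bx Ht Hy Hz.
assert (Hd : 0 < d) by (generalize (Rabs_pos (t - t0)); lra).
assert (Hx0 := Rabs_self_lt x0 d Hd). assert (Hu0 := Rabs_self_lt u0 d Hd).
assert (Hp : Omega phi (t, x0, u0)) by (apply Bx; trivial).
destruct (admissible_facts _ _ _ _ _ _ Ha Hp) as [B [B' [_ [HO [HT [HX HU]]]]]].
assert (ET : forall s y' z', Rabs (s - t0) < d -> Rabs (y' - x0) < d -> Rabs (z' - u0) < d ->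
  Tt phi s y' z' = Tt phi s x0 u0).
{ intros s y' z' Hs Hy' Hz'. apply (constant_in_xu (Omega phi) (Tt phi) d t0 x0 u0); trivial.
  intros. now apply (Tt_depends_on_t E phi E'). }
assert (EDT : forall y' z', Rabs (y' - x0) < d -> Rabs (z' - u0) < d ->
  dt3 (Tt phi) t y' z' = dt3 (Tt phi) t x0 u0).
{ intros y' z' Hy' Hz'. apply Derive_ext_loc. apply locally_R. exists (d - Rabs (t - t0)). split. lra.
  intros s Hs. apply ET; trivial. replace (s - t0) with ((s - t) + (t - t0)) by ring.
  eapply Rle_lt_trans. apply Rabs_triang. lra. }
assert (EX : forall y' z', Rabs (y' - x0) < d -> Rabs (z' - u0) < d ->
  dx3 (Xt phi) t y' z' = dx3 (Xt phi) t x0 u0).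
{ intros y' z' Hy' Hz'. apply pow5_inj. apply Rmult_eq_reg_l with (beta E t); trivial.
  destruct (Xt_free_of_u E phi E' t y' z' Ha (Bx _ _ _ Ht Hy' Hz')) as [_ [_ [_ [_ H1]]]].
  destruct (Xt_free_of_u E phi E' t x0 u0 Ha Hp) as [_ [_ [_ [_ H2]]]].
  rewrite H1, H2, (ET t), (EDT y' z'); trivial. }
split; [now apply ET|]. split; [now apply EDT|]. split; [now apply EX|].
assert (X1 : Xt phi t y z - Xt phi t x0 z = dx3 (Xt phi) t x0 u0 * (y - x0)).
{ apply (affine_in_x (Omega phi)); trivial. intros x Hx.
  assert (Rabs (x - x0) < d) by (apply (between_close _ _ x0 d x Hx); trivial). split; auto. }
assert (X2 : Xt phi t x0 z - Xt phi t x0 u0 = 0 * (z - u0)).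
{ apply (affine_in_u (Omega phi)); trivial. intros x Hx.
  assert (Rabs (x - u0) < d) by (apply (between_close _ _ u0 d x Hx); trivial). split; auto.
  apply (Xt_free_of_u E phi E'); auto. }
lra.
Qed.

(* The test functions differ by [(X - X0)^4]; that u_xxxxx is the same for both
   forces U_u to be stationary along the graph. *)
Lemma Ut_slope_along_graph E phi E' t x u q : admissible E phi E' -> Omega phi (t, x, u) ->
  dx3 (du3 (Ut phi)) t x u + du3 (du3 (Ut phi)) t x u *
    (- (dx3 (Ut phi) t x u - q * dx3 (Xt phi) t x u) / du3 (Ut phi) t x u) = 0.
Proof.
intros Ha Hp.
destruct (admissible_facts _ _ _ _ _ _ Ha Hp) as [B [B' [_ [HO [HT [HX HU]]]]]].
destruct (Tt_depends_on_t _ _ _ _ _ _ Ha Hp) as [Tx Tu].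
destruct (Xt_free_of_u _ _ _ _ _ _ Ha Hp) as [Xu [Ts [Xx [Uu _]]]].
set (T0 := Tt phi t x u) in *. set (U0 := Ut phi t x u). set (X0 := Xt phi t x u).
set (r := - (0 + U0 * q + alpha E' T0 * U0) / (120 * beta E' T0)).
assert (Hr : 0 + U0 * q + alpha E' T0 * U0 + beta E' T0 * (120 * r) = 0) by (unfold r; field; trivial).
assert (K1 := admissible_test E phi E' t x u 0 q r 0 0 Ha Hp).
assert (K2 := admissible_test E phi E' t x u 0 q r 0 1 Ha Hp).
cbv zeta in K1, K2. rewrite Xu, Tu, Tx, !Rmult_0_r, !Rminus_0_r in K1, K2.
destruct (K1 Uu Hr) as [J1 [h1 [J1o [J1x [S1 [E1 [D1 [G1 R1]]]]]]]].
destruct (K2 Uu Hr) as [J2 [h2 [J2o [J2x [S2 [E2 [D2 [G2 R2]]]]]]]].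
clear K1 K2. fold T0 U0 X0 in G1, G2.
set (kx := dx3 (Ut phi) t x u - q * dx3 (Xt phi) t x u) in *.
set (k := du3 (Ut phi) t x u) in *.
assert (Jo : open (fun y => J1 y /\ J2 y)) by now apply open_and.
assert (S1' : smooth1 (fun y => J1 y /\ J2 y) h1) by (apply smooth1_sub with (2 := S1); tauto).
assert (S2' : smooth1 (fun y => J1 y /\ J2 y) h2) by (apply smooth1_sub with (2 := S2); tauto).
assert (C1 := is_derive_continuous _ _ _ D1). assert (C2 := is_derive_continuous _ _ _ D2).
assert (HUu := smooth3_du3 _ _ HU).
set (M := du3 (du3 (Ut phi)) t x u).
(* The role of m is played by U_u along the first graph, whose derivative at x is the expression
   claimed to vanish; A is X_x^4. *)
apply (quartic_coefficient (fun y => J1 y /\ J2 y) (fun y => h2 y - h1 y) (fun y => du3 (Ut phi) t y (h1 y))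
  x _ (dx3 (Xt phi) t x u ^ 4) (Rabs M + 1)); trivial.
- now apply smooth1_minus.
- now split.
- lra.
- rewrite (Derive_n_minus_smooth _ h2 h1 5 x Jo S2' S1') by now split.
  assert (Z : beta E t * (Derive_n h2 5 x - Derive_n h1 5 x) = 0) by lra.
  apply Rmult_integral in Z. tauto.
- generalize (is_derive_along_x (Omega phi) (du3 (Ut phi)) h1 t x (- kx / k)). rewrite E1. now auto.
- rewrite E1. exact Uu.
- now apply pow_nonzero.
- generalize (Rabs_pos M). lra.
- destruct (open_box _ _ _ _ HO Hp) as [d0 [Hd0 Bx]].
  destruct (Ck3_strict 0 _ _ _ _ _ HO (HUu 1%nat) Hp 1 Rlt_0_1) as [d1 [Hd1 St]].
  assert (Hd : 0 < Rmin d0 d1) by now apply Rmin_glb_lt.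
  assert (N0 : forall r, r < Rmin d0 d1 -> r < d0) by (intros a Ra; eapply Rlt_le_trans; [exact Ra | apply Rmin_l]).
  assert (N1 : forall r, r < Rmin d0 d1 -> r < d1) by (intros a Ra; eapply Rlt_le_trans; [exact Ra | apply Rmin_r]).
  generalize (filter_and _ _ (Jo x (conj J1x J2x)) (filter_and _ _ (graph_near h1 x u _ C1 E1 Hd)
    (graph_near h2 x u _ C2 E2 Hd))).
  apply filter_imp. intros y [[Y1 Y2] [[Y3 Y4] [_ Y5]]].
  destruct (G1 y Y1) as [_ G1y]. destruct (G2 y Y2) as [_ G2y].
  assert (Ht0 := Rabs_self_lt t d0 Hd0). assert (Ht1 := Rabs_self_lt t d1 Hd1).
  destruct (Tt_Xt_near E phi E' d0 t x u t y (h1 y) Ha Bx) as [V1 [_ [_ V2]]]; auto.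
  destruct (Tt_Xt_near E phi E' d0 t x u t y (h2 y) Ha Bx) as [V3 [_ [_ V4]]]; auto.
  fold T0 X0 in V1, V2, V3, V4. rewrite V1, V2 in G1y. rewrite V3, V4 in G2y.
  (* Exact equality: on both graphs T = T0, and X is the same affine function of y. *)
  replace (dx3 (Xt phi) t x u ^ 4 * (y - x) ^ 4) with (Ut phi t y (h2 y) - Ut phi t y (h1 y))
    by (rewrite G1y, G2y; unfold test; ring).
  replace ((Rabs M + 1) * (h2 y - h1 y) ^ 2) with ((Rabs M + 1) * Rabs (h2 y - h1 y) * Rabs (h2 y - h1 y))
    by (rewrite <- (pow2_abs (h2 y - h1 y)); ring).
  (* Linearizing U in u at h1(y) leaves an error quadratic in h2 - h1, because U_u varies between
     the graphs at most at the rate |U_uu| + 1. *)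
  apply (mean_value_slope (fun z => Ut phi t y z) (fun z => du3 (Ut phi) t y z)).
  + intros z Hz. apply (smooth3_derivs (Omega phi)); trivial. apply Bx; auto. eapply between_close; eauto.
  + intros z Hz. assert (Hzu : Rabs (z - u) < Rmin d0 d1) by (eapply between_close; eauto).
    specialize (St t y (h1 y) t y z Ht1 (N1 _ Y3) (N1 _ Y4) Ht1 (N1 _ Y3) (N1 _ Hzu)).
    rewrite !Rminus_diag, Rabs_R0, !Rmult_0_r, !Rplus_0_l, Rmult_1_l in St. fold M in St.
    assert (Zh : Rabs (z - h1 y) <= Rabs (h2 y - h1 y)).
    { unfold Rmin, Rmax in Hz. destruct (Rle_dec (h1 y) (h2 y)); unfold Rabs; destruct (Rcase_abs (z - h1 y)), (Rcase_abs (h2 y - h1 y)); lra. }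
    apply Rle_trans with ((Rabs M + 1) * Rabs (z - h1 y)).
    * replace (du3 (Ut phi) t y z - du3 (Ut phi) t y (h1 y)) with
        ((du3 (Ut phi) t y z - du3 (Ut phi) t y (h1 y) - M * (z - h1 y)) + M * (z - h1 y)) by ring.
      eapply Rle_trans. apply Rabs_triang. rewrite Rabs_mult. lra.
    * apply Rmult_le_compat_l; trivial. generalize (Rabs_pos M); lra.
Qed.

(** The relation along graphs is affine in q with slope U_uu X_x / U_u, so its instances q = 0 and q
    = 1 force U_uu = 0 and then U_xu = 0. *)
Lemma Ut_affine_in_u E phi E' t x u : admissible E phi E' -> Omega phi (t, x, u) ->
  dx3 (du3 (Ut phi)) t x u = 0 /\ du3 (du3 (Ut phi)) t x u = 0.
Proof.
intros Ha Hp.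
destruct (Xt_free_of_u _ _ _ _ _ _ Ha Hp) as [_ [_ [Xx [Uu _]]]].
assert (H0 := Ut_slope_along_graph E phi E' t x u 0 Ha Hp).
assert (H1 := Ut_slope_along_graph E phi E' t x u 1 Ha Hp).
set (M := du3 (du3 (Ut phi)) t x u) in *. set (N := dx3 (du3 (Ut phi)) t x u) in *.
set (Xx0 := dx3 (Xt phi) t x u) in *. set (Ux := dx3 (Ut phi) t x u) in *. set (a := du3 (Ut phi) t x u) in *.
clearbody M N Xx0 Ux a.
assert (M0 : M = 0).
{ assert (Z : M * (Xx0 / a) = 0).
  { transitivity (N + M * (- (Ux - 1 * Xx0) / a) - (N + M * (- (Ux - 0 * Xx0) / a))). field; trivial. rewrite H0, H1. ring. }
  apply Rmult_integral in Z. destruct Z as [Z|Z]; trivial. exfalso. apply Rmult_integral in Z.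
  destruct Z as [Z|Z]. now apply Xx. revert Z. now apply Rinv_neq_0_compat. }
split; trivial. rewrite M0 in H0. lra.
Qed.

(* Compares the test functions with T- and X-derivatives (p, 0) and (p - U0, 1). *)
Lemma Ut_formula E phi E' t x u : admissible E phi E' -> Omega phi (t, x, u) ->
  Ut phi t x u * dt3 (Tt phi) t x u = dt3 (Xt phi) t x u + u * dx3 (Xt phi) t x u.
Proof.
intros Ha Hp.
destruct (admissible_facts _ _ _ _ _ _ Ha Hp) as [B [B' [_ [HO [HT [HX HU]]]]]].
destruct (Tt_depends_on_t _ _ _ _ _ _ Ha Hp) as [Tx Tu].
destruct (Xt_free_of_u _ _ _ _ _ _ Ha Hp) as [Xu [Ts [Xx [Uu _]]]].
set (T0 := Tt phi t x u) in *. set (U0 := Ut phi t x u). set (X0 := Xt phi t x u).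
set (p := - (alpha E' T0 * U0)).
assert (K1 := admissible_test E phi E' t x u p 0 0 0 0 Ha Hp).
assert (K2 := admissible_test E phi E' t x u (p - U0) 1 0 0 0 Ha Hp).
cbv zeta in K1, K2. rewrite Xu, Tu, Tx, !Rmult_0_r, !Rminus_0_r in K1, K2.
destruct (K1 Uu) as [J1 [h1 [J1o [J1x [S1 [E1 [D1 [G1 R1]]]]]]]]; [unfold p, T0, U0; ring|].
destruct (K2 Uu) as [J2 [h2 [J2o [J2x [S2 [E2 [D2 [G2 R2]]]]]]]]; [unfold p, T0, U0; ring|].
clear K1 K2. fold T0 U0 X0 in G1, G2.
set (k := du3 (Ut phi) t x u) in *.
assert (Jo : open (fun y => J1 y /\ J2 y)) by now apply open_and.
assert (S1' : smooth1 (fun y => J1 y /\ J2 y) h1) by (apply smooth1_sub with (2 := S1); tauto).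
assert (S2' : smooth1 (fun y => J1 y /\ J2 y) h2) by (apply smooth1_sub with (2 := S2); tauto).
assert (C1 := is_derive_continuous _ _ _ D1). assert (C2 := is_derive_continuous _ _ _ D2).
destruct (open_box _ _ _ _ HO Hp) as [d [Hd Bx]].
assert (Ht := Rabs_self_lt t d Hd).
(* U is now affine in u with slope k, and the tests differ by X - X0 = X_x (y - x) on the graphs, so
   h2 - h1 is exactly c (y - x) near x and has no fifth derivative. *)
set (c := dx3 (Xt phi) t x u / k).
assert (W5 : Derive_n h2 5 x - Derive_n h1 5 x = 0).
{ rewrite <- (Derive_n_minus_smooth _ h2 h1 5 x Jo S2' S1') by now split.
  rewrite (Derive_n_ext_loc _ (fun y => c * (y - x))).
  - rewrite (Derive_n_shift _ (fun y => c)) by (intro y; auto_derive; trivial; ring).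
    rewrite (Derive_n_shift _ (fun y => 0)) by (intro y; auto_derive; trivial; ring).
    rewrite (Derive_n_shift _ (fun y => 0)) by (intro y; auto_derive; trivial; ring).
    rewrite (Derive_n_shift _ (fun y => 0)) by (intro y; auto_derive; trivial; ring).
    rewrite (Derive_n_shift _ (fun y => 0)) by (intro y; auto_derive; trivial; ring).
    reflexivity.
  - generalize (filter_and _ _ (Jo x (conj J1x J2x)) (filter_and _ _ (graph_near h1 x u _ C1 E1 Hd)
      (graph_near h2 x u _ C2 E2 Hd))).
    apply filter_imp. intros y [[Y1 Y2] [[Y3 Y4] [_ Y5]]].
    destruct (G1 y Y1) as [_ G1y]. destruct (G2 y Y2) as [_ G2y].
    destruct (Tt_Xt_near E phi E' d t x u t y (h1 y) Ha Bx) as [V1 [_ [_ V2]]]; auto.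
    destruct (Tt_Xt_near E phi E' d t x u t y (h2 y) Ha Bx) as [V3 [_ [_ V4]]]; auto.
    fold T0 X0 in V1, V2, V3, V4. rewrite V1, V2 in G1y. rewrite V3, V4 in G2y.
    assert (A : Ut phi t y (h2 y) - Ut phi t y (h1 y) = k * (h2 y - h1 y)).
    { apply (affine_in_u (Omega phi)); trivial. intros z Hz.
      assert (Hzu : Rabs (z - u) < d) by (eapply between_close; eauto).
      split. now apply Bx.
      apply (constant_in_xu (Omega phi) (du3 (Ut phi)) d t x u); trivial; auto.
      now apply smooth3_du3. intros. now apply (Ut_affine_in_u E phi E'). now apply Rabs_self_lt. now apply Rabs_self_lt. }
    rewrite G1y, G2y in A. unfold test in A. unfold c.
    apply Rmult_eq_reg_l with k; trivial. rewrite <- A. field. trivial. }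
(* Equal fifth derivatives leave the first-order terms, whose difference is the claimed formula
   divided by k. *)
assert (Q : (U0 * dt3 (Tt phi) t x u - (dt3 (Xt phi) t x u + u * dx3 (Xt phi) t x u)) / k = 0).
{ replace (Derive_n h2 5 x) with (Derive_n h1 5 x) in R2 by lra. unfold Rdiv in *. lra. }
apply Rmult_integral in Q. destruct Q as [Q|Q]. lra. apply Rinv_neq_0_compat in Uu. contradiction.
Qed.

(* The transformations T = tau(t), X = xi1(t) x + xi0(t),
   U = (xi1 u + xi1' x + xi0') / tau', together with the conditions under which
   they map the equation with coefficients (a, b) to the one with (a', b'). *)
Definition normal_form (J : R -> Prop) (a b a' b' tau xi1 xi0 : R -> R) : Prop :=
  smooth1 J tau /\ smooth1 J xi1 /\ smooth1 J xi0 /\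
  forall t, J t -> Derive tau t <> 0 /\ xi1 t <> 0 /\
    b' (tau t) * Derive tau t = xi1 t ^ 5 * b t /\
    a' (tau t) * Derive tau t = a t - 2 * (Derive xi1 t / xi1 t) + Derive (Derive tau) t / Derive tau t /\
    Derive (Derive xi1) t = (2 * (Derive xi1 t / xi1 t) - a t) * Derive xi1 t /\
    Derive (Derive xi0) t = (2 * (Derive xi1 t / xi1 t) - a t) * Derive xi0 t.

Lemma open_ball_R (t0 d : R) : open (fun t => Rabs (t - t0) < d).
Proof.
intros t Ht. apply locally_R. exists (d - Rabs (t - t0)). split. lra. intros s Hs.
replace (s - t0) with ((s - t) + (t - t0)) by ring. eapply Rle_lt_trans. apply Rabs_triang. lra.
Qed.

Lemma Derive_n5_affine a b x : Derive_n (fun y => a * y + b) 5 x = 0.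
Proof.
rewrite (Derive_n_shift _ (fun y => a)) by (intro y; auto_derive; trivial; ring).
rewrite !(Derive_n_shift (fun _ => _) (fun y => 0)) by (intro y; auto_derive; trivial; ring).
reflexivity.
Qed.

Lemma is_derive_affine_quotient (e a b c z : R -> R) t e1 a1 b1 c1 z1 y :
  is_derive e t e1 -> is_derive a t a1 -> is_derive b t b1 -> is_derive c t c1 -> is_derive z t z1 ->
  e t <> 0 ->
  is_derive (fun s => / e s * (a s * z s + b s * y + c s)) t
    (/ e t * (a1 * z t + a t * z1 + b1 * y + c1) - e1 / e t ^ 2 * (a t * z t + b t * y + c t)).
Proof.
intros He Ha Hb Hc Hz H0. auto_derive.
- repeat split; trivial; eexists; eassumption.
- apply is_derive_unique in He, Ha, Hb, Hc, Hz.
  change (Derive (fun x => e x) t) with (Derive e t). change (Derive (fun x => a x) t) with (Derive a t).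
  change (Derive (fun x => b x) t) with (Derive b t). change (Derive (fun x => c x) t) with (Derive c t).
  change (Derive (fun x => z x) t) with (Derive z t).
  rewrite He, Ha, Hb, Hc, Hz. field. trivial.
Qed.

(** The functions of t are slices through the base point. With the form of the transformation known,
    tests with q = r = 0 give an h affine in x, so the residual condition becomes an identity affine
    in (x, u), whose coefficients are the remaining conditions. *)
Lemma admissible_local E phi E' t0 x0 u0 : admissible E phi E' -> Omega phi (t0, x0, u0) ->
  exists (d : R) (tau xi1 xi0 : R -> R), 0 < d /\
    normal_form (fun t => Rabs (t - t0) < d) (alpha E) (beta E) (alpha E') (beta E') tau xi1 xi0 /\
    forall t x u, Rabs (t - t0) < d -> Rabs (x - x0) < d -> Rabs (u - u0) < d ->
      Omega phi (t, x, u) /\ Tt phi t x u = tau t /\ Xt phi t x u = xi1 t * x + xi0 t /\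
      Ut phi t x u = / Derive tau t * (xi1 t * u + Derive xi1 t * x + Derive xi0 t).
Proof.
intros Ha Hp.
destruct (admissible_facts _ _ _ _ _ _ Ha Hp) as [_ [_ [_ [HO [HT [HX HU]]]]]].
destruct (open_box _ _ _ _ HO Hp) as [d [Hd Bx]].
set (J := fun t => Rabs (t - t0) < d).
assert (Jo : open J) by apply open_ball_R.
assert (Hx0 := Rabs_self_lt x0 d Hd). assert (Hu0 := Rabs_self_lt u0 d Hd).
set (tau := fun t => Tt phi t x0 u0). set (xi1 := fun t => dx3 (Xt phi) t x0 u0).
set (xi0 := fun t => Xt phi t x0 u0 - xi1 t * x0).
assert (Stau : smooth1 J tau) by (apply smooth3_slice_t with (1 := HT); intros s Hs; now apply Bx).
assert (Sxi1 : smooth1 J xi1) by (apply smooth3_slice_t with (1 := smooth3_dx3 _ _ HX); intros s Hs; now apply Bx).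
assert (Sxi0 : smooth1 J xi0).
{ apply smooth1_minus; trivial. apply smooth3_slice_t with (1 := HX); intros s Hs; now apply Bx.
  apply smooth1_mult; trivial. apply smooth1_const. }
assert (TX : forall t x u, J t -> Rabs (x - x0) < d -> Rabs (u - u0) < d ->
  Tt phi t x u = tau t /\ dt3 (Tt phi) t x u = Derive tau t /\ dx3 (Xt phi) t x u = xi1 t /\
  Xt phi t x u = xi1 t * x + xi0 t).
{ intros t x u Ht Hx Hu. destruct (Tt_Xt_near E phi E' d t0 x0 u0 t x u Ha Bx Ht Hx Hu) as [H1 [H2 [H3 H4]]].
  split; trivial. split; trivial. split; trivial. rewrite H4. unfold xi0, xi1. ring. }
assert (Xd : forall t x u, J t -> Rabs (x - x0) < d -> Rabs (u - u0) < d ->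
  dt3 (Xt phi) t x u = Derive xi1 t * x + Derive xi0 t).
{ intros t x u Ht Hx Hu. unfold dt3. rewrite (Derive_ext_loc _ (fun s => xi1 s * x + xi0 s)).
  - apply is_derive_unique. apply (is_derive_plus (V := R_NormedModule)).
    + apply is_derive_Reals. apply (derivable_pt_lim_scal_right xi1). apply is_derive_Reals. now apply (smooth1_derivable J).
    + now apply (smooth1_derivable J).
  - apply filter_imp with (2 := Jo t Ht). intros s Hs. now apply TX. }
assert (Uf : forall t x u, J t -> Rabs (x - x0) < d -> Rabs (u - u0) < d ->
  Ut phi t x u = / Derive tau t * (xi1 t * u + Derive xi1 t * x + Derive xi0 t)).
{ intros t x u Ht Hx Hu. assert (Hq := Bx t x u Ht Hx Hu).
  destruct (Xt_free_of_u _ _ _ _ _ _ Ha Hq) as [_ [N _]].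
  assert (F := Ut_formula _ _ _ _ _ _ Ha Hq).
  destruct (TX t x u Ht Hx Hu) as [_ [H2 [H3 _]]]. rewrite H2 in N, F. rewrite H3, (Xd t x u Ht Hx Hu) in F.
  apply Rmult_eq_reg_r with (Derive tau t); trivial. rewrite F. field. trivial. }
exists d, tau, xi1, xi0. split; [exact Hd|]. split.
2:{ intros t x u Ht Hx Hu. split. now apply Bx. split. now apply TX. split. now apply TX. now apply Uf. }
split; [exact Stau|]. split; [exact Sxi1|]. split; [exact Sxi0|]. intros t Ht.
assert (Hp0 := Bx t x0 u0 Ht Hx0 Hu0).
destruct (Xt_free_of_u _ _ _ _ _ _ Ha Hp0) as [_ [N1 [N2 [_ HB]]]].
destruct (TX t x0 u0 Ht Hx0 Hu0) as [_ [H2 _]]. rewrite H2 in N1, HB. fold (tau t) (xi1 t) in HB. fold (xi1 t) in N2.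
split; [exact N1|]. split; [exact N2|]. split; [rewrite <- HB; ring|].
set (lam := Derive (Derive tau) t / Derive tau t - alpha E' (tau t) * Derive tau t).
(* the residual condition for the test functions with vanishing X-derivatives *)
assert (L : forall x u, Rabs (x - x0) < d -> Rabs (u - u0) < d ->
  (alpha E t * xi1 t - 2 * Derive xi1 t + lam * xi1 t) * u
  + (lam * Derive xi1 t - Derive (Derive xi1) t) * x + (lam * Derive xi0 t - Derive (Derive xi0) t) = 0).
{ intros x u Hx Hu. assert (Hq := Bx t x u Ht Hx Hu).
  destruct (admissible_facts _ _ _ _ _ _ Ha Hq) as [_ [B' _]].
  destruct (Tt_depends_on_t _ _ _ _ _ _ Ha Hq) as [Tx Tu].
  destruct (Xt_free_of_u _ _ _ _ _ _ Ha Hq) as [Xu [_ [_ [Uu _]]]].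
  destruct (TX t x u Ht Hx Hu) as [V1 [V2 _]].
  set (p := - (alpha E' (Tt phi t x u) * Ut phi t x u)).
  assert (K := admissible_test E phi E' t x u p 0 0 0 0 Ha Hq).
  cbv zeta in K. rewrite Xu, Tu, Tx, !Rmult_0_r in K. rewrite !Rmult_0_l in K. rewrite !Rminus_0_r in K.
  destruct (K Uu) as [J1 [h [J1o [J1x [S1 [E1 [D1 [G1 R1]]]]]]]]; [unfold p; ring|]. clear K.
  assert (Du : du3 (Ut phi) t x u = / Derive tau t * xi1 t).
  { unfold du3. rewrite (Derive_ext_loc _ (fun z => / Derive tau t * (xi1 t * z + Derive xi1 t * x + Derive xi0 t))).
    apply is_derive_unique. auto_derive; trivial. ring.
    apply filter_imp with (2 := open_ball_R u0 d u Hu). intros z Hz. now apply Uf. }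
  assert (Dxx : dx3 (Ut phi) t x u = / Derive tau t * Derive xi1 t).
  { unfold dx3. rewrite (Derive_ext_loc _ (fun y => / Derive tau t * (xi1 t * u + Derive xi1 t * y + Derive xi0 t))).
    apply is_derive_unique. auto_derive; trivial. ring.
    apply filter_imp with (2 := open_ball_R x0 d x Hx). intros z Hz. now apply Uf. }
  assert (Dtt : dt3 (Ut phi) t x u = / Derive tau t * (Derive xi1 t * u + xi1 t * 0 + Derive (Derive xi1) t * x + Derive (Derive xi0) t)
     - Derive (Derive tau) t / Derive tau t ^ 2 * (xi1 t * u + Derive xi1 t * x + Derive xi0 t)).
  { unfold dt3. rewrite (Derive_ext_loc _ (fun s => / Derive tau s * (xi1 s * u + Derive xi1 s * x + Derive xi0 s))).
    apply is_derive_unique. exact (is_derive_affine_quotient (Derive tau) xi1 (Derive xi1) (Derive xi0) (fun _ => u) t _ _ _ _ _ x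
      (smooth1_derivable J _ t (smooth1_Derive J _ Stau) Ht) (smooth1_derivable J _ t Sxi1 Ht)
      (smooth1_derivable J _ t (smooth1_Derive J _ Sxi1) Ht) (smooth1_derivable J _ t (smooth1_Derive J _ Sxi0) Ht)
      (is_derive_const_R u t) N1).
    apply filter_imp with (2 := Jo t Ht). intros s Hs. now apply Uf. }
  (* At fixed t the test is the constant U0, so xi1 h + xi1' y is constant and h is affine. *)
  assert (h5 : Derive_n h 5 x = 0).
  { rewrite <- (Derive_n5_affine (- (Derive xi1 t / xi1 t))
      ((xi1 t * u + Derive xi1 t * x) / xi1 t) x).
    apply Derive_n_ext_loc.
    generalize (filter_and _ _ (J1o x J1x) (filter_and _ _ (open_ball_R x0 d x Hx)
      (graph_near h x u (d - Rabs (u - u0)) (is_derive_continuous _ _ _ D1) E1 ltac:(lra)))).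
    apply filter_imp. intros y [Y1 [Y2 [_ Y3]]]. destruct (G1 y Y1) as [_ G1y].
    assert (Y4 : Rabs (h y - u0) < d).
    { replace (h y - u0) with ((h y - u) + (u - u0)) by ring. eapply Rle_lt_trans. apply Rabs_triang. lra. }
    destruct (TX t y (h y) Ht Y2 Y4) as [V3 _]. rewrite V1, V3, (Uf t y (h y)), (Uf t x u) in G1y; trivial.
    unfold test in G1y. apply Rmult_eq_reg_l with (/ Derive tau t * xi1 t).
    2:{ apply Rmult_integral_contrapositive. split; trivial. now apply Rinv_neq_0_compat. }
    transitivity (/ Derive tau t * (xi1 t * h y + Derive xi1 t * y + Derive xi0 t) - / Derive tau t * (Derive xi1 t * y + Derive xi0 t)). ring.
    rewrite G1y. field. now split. }
  rewrite h5 in R1. unfold p in R1. rewrite Du, Dxx, Dtt, V1, V2, (Uf t x u Ht Hx Hu) in R1.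
  apply Rmult_eq_reg_r with (/ xi1 t). 2: now apply Rinv_neq_0_compat.
  rewrite Rmult_0_l, <- R1. unfold lam. field. now split. }
(* Shifting x or u by d / 2 inside the box isolates the two linear coefficients of the affine
   identity [L]; the constant term follows. *)
assert (Hd2 : Rabs (x0 + d / 2 - x0) < d) by (replace (x0 + d / 2 - x0) with (d / 2) by ring; rewrite Rabs_pos_eq; lra).
assert (Hd3 : Rabs (u0 + d / 2 - u0) < d) by (replace (u0 + d / 2 - u0) with (d / 2) by ring; rewrite Rabs_pos_eq; lra).
assert (L1 := L x0 u0 Hx0 Hu0). assert (L2 := L _ u0 Hd2 Hu0). assert (L3 := L x0 _ Hx0 Hd3).
assert (A1 : alpha E t * xi1 t - 2 * Derive xi1 t + lam * xi1 t = 0) by (apply Rmult_eq_reg_r with (d / 2); lra).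
assert (A2 : lam * Derive xi1 t - Derive (Derive xi1) t = 0) by (apply Rmult_eq_reg_r with (d / 2); lra).
rewrite A1, A2 in L1.
assert (El : lam = 2 * (Derive xi1 t / xi1 t) - alpha E t).
{ apply Rmult_eq_reg_r with (xi1 t); trivial.
  transitivity (2 * Derive xi1 t - alpha E t * xi1 t). lra. field. trivial. }
rewrite <- El. split; [unfold lam in El; lra|]. split; lra.
Qed.

(** * Reconstruction of the group element *)

Lemma ball_interval t0 d a b c : Rabs (a - t0) < d -> Rabs (b - t0) < d ->
  Rmin a b <= c <= Rmax a b -> Rabs (c - t0) < d.
Proof. intros. eapply between_close; eassumption. Qed.

Lemma antiderivative_near (f : R -> R) t0 d : 0 < d ->
  (forall t, Rabs (t - t0) < d -> continuous f t) ->
  exists F, F t0 = 0 /\ forall t, Rabs (t - t0) < d -> is_derive F t (f t).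
Proof.
intros Hd Hf. exists (fun t => RInt f t0 t). split. { exact (RInt_point (V := R_CompleteNormedModule) t0 f). }
intros t Ht. apply (is_derive_RInt (V := R_CompleteNormedModule) f _ t0).
- apply filter_imp with (2 := open_ball_R t0 d t Ht). intros s Hs.
  apply (RInt_correct (V := R_CompleteNormedModule)). apply (ex_RInt_continuous (V := R_CompleteNormedModule)).
  intros z Hz. apply Hf. eapply (ball_interval t0 d t0 s); trivial. now apply Rabs_self_lt.
- now apply Hf.
Qed.

Lemma zero_derivative_near (f : R -> R) t0 d t : 0 < d ->
  (forall t, Rabs (t - t0) < d -> is_derive f t 0) -> Rabs (t - t0) < d -> f t = f t0.
Proof.
intros Hd Hf Ht.
assert (E : f t - f t0 = 0 * (t - t0)).
{ apply (constant_slope f (fun _ => 0)). intros x Hx. split; trivial. apply Hf.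
  eapply (ball_interval t0 d t0 t); trivial. now apply Rabs_self_lt. }
lra.
Qed.

Lemma is_derive_mult_R (f g : R -> R) x l m : is_derive f x l -> is_derive g x m ->
  is_derive (fun y => f y * g y) x (l * g x + f x * m).
Proof.
intros Hf Hg. apply is_derive_Reals in Hf. apply is_derive_Reals in Hg. apply is_derive_Reals.
exact (derivable_pt_lim_mult _ _ _ _ _ Hf Hg).
Qed.

Lemma is_derive_plus_R (f g : R -> R) x l m : is_derive f x l -> is_derive g x m ->
  is_derive (fun y => f y + g y) x (l + m).
Proof. intros Hf Hg. now apply (is_derive_plus (V := R_NormedModule)). Qed.

Lemma is_derive_minus_R (f g : R -> R) x l m : is_derive f x l -> is_derive g x m ->
  is_derive (fun y => f y - g y) x (l - m).
Proof. intros Hf Hg. now apply (is_derive_minus (V := R_NormedModule)). Qed.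

Lemma is_derive_inv_R (f : R -> R) x l : is_derive f x l -> f x <> 0 ->
  is_derive (fun y => / f y) x (- l / f x ^ 2).
Proof. intros Hf H. exact (is_derive_inv f x l Hf H). Qed.

Lemma is_derive_exp_comp (f : R -> R) x l : is_derive f x l ->
  is_derive (fun y => exp (f y)) x (l * exp (f x)).
Proof.
intro Hf. apply (is_derive_comp (V := R_NormedModule) exp f); trivial.
apply is_derive_exp.
Qed.

Lemma Derive_near (J : R -> Prop) f g t : open J -> J t -> (forall s, J s -> f s = g s) -> Derive f t = Derive g t.
Proof.
intros HJ Ht E. apply Derive_ext_loc. apply filter_imp with (2 := HJ t Ht). exact E.
Qed.

(* With A, B antiderivatives of a and exp(-A): the equations for xi1 and xi0 say
   that 1/xi1 = k B + c and xi0' = m exp(-A) xi1^2. *)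
Lemma normal_form_integrals a b a' b' tau xi1 xi0 t0 d : 0 < d ->
  smooth1 (fun t => Rabs (t - t0) < d) a ->
  normal_form (fun t => Rabs (t - t0) < d) a b a' b' tau xi1 xi0 ->
  exists (A B : R -> R) (k c m : R), B t0 = 0 /\ c <> 0 /\
    forall t, Rabs (t - t0) < d ->
      is_derive A t (a t) /\ is_derive B t (exp (- A t)) /\
      xi1 t * (k * B t + c) = 1 /\
      Derive xi1 t = - k * exp (- A t) * xi1 t ^ 2 /\
      Derive xi0 t = m * exp (- A t) * xi1 t ^ 2.
Proof.
intros Hd Sa [_ [S1 [S0 HN]]].
set (J := fun t => Rabs (t - t0) < d) in *.
destruct (antiderivative_near a t0 d Hd) as [A [_ HA]].
{ intros t Ht. eapply is_derive_continuous. now apply (smooth1_derivable J). }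
destruct (antiderivative_near (fun t => exp (- A t)) t0 d Hd) as [B [B0 HB]].
{ intros t Ht. eapply is_derive_continuous. apply (is_derive_exp_comp (fun s => - A s)).
  apply (is_derive_opp (V := R_NormedModule)). now apply HA. }
assert (J0 : J t0) by now apply Rabs_self_lt.
assert (D1 : forall t, J t -> is_derive xi1 t (Derive xi1 t)) by (intros; now apply (smooth1_derivable J)).
assert (D2 : forall t, J t -> is_derive (Derive xi1) t (Derive (Derive xi1) t)) by (intros; apply (smooth1_derivable J); trivial; now apply smooth1_Derive).
assert (D0 : forall t, J t -> is_derive (Derive xi0) t (Derive (Derive xi0) t)) by (intros; apply (smooth1_derivable J); trivial; now apply smooth1_Derive).
(* f' exp(A) / xi1^2 is a first integral of f'' = (2 xi1' / xi1 - a) f', the linear equation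
   satisfied by both xi1 and xi0. *)
set (I := fun (f : R -> R) t => Derive f t * exp (A t) * / (xi1 t * xi1 t)).
assert (CI : forall f, (forall t, J t -> is_derive (Derive f) t ((2 * (Derive xi1 t / xi1 t) - a t) * Derive f t)) ->
   forall t, J t -> I f t = I f t0).
{ intros f Hf t Ht. apply (zero_derivative_near (I f) t0 d t Hd); trivial. intros s Hs.
  destruct (HN s Hs) as [_ [N1 _]].
  replace 0 with (((2 * (Derive xi1 s / xi1 s) - a s) * Derive f s * exp (A s) + Derive f s * (a s * exp (A s))) * / (xi1 s * xi1 s)
    + Derive f s * exp (A s) * (- (Derive xi1 s * xi1 s + xi1 s * Derive xi1 s) / (xi1 s * xi1 s) ^ 2)) by (field; trivial).
  apply (is_derive_mult_R (fun r => Derive f r * exp (A r)) (fun r => / (xi1 r * xi1 r))).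
  - apply (is_derive_mult_R (Derive f) (fun r => exp (A r))). now apply Hf. apply is_derive_exp_comp. now apply HA.
  - apply (is_derive_inv_R (fun r => xi1 r * xi1 r)). apply is_derive_mult_R; now apply D1.
    now apply Rmult_integral_contrapositive. }
set (k := - I xi1 t0). set (m := I xi0 t0). set (c := / xi1 t0).
assert (EI : forall f t, J t -> Derive f t = I f t * exp (- A t) * xi1 t ^ 2).
{ intros f t Ht. destruct (HN t Ht) as [_ [N1 _]]. unfold I. rewrite exp_Ropp. field. split; trivial.
  generalize (exp_pos (A t)); lra. }
assert (F1 : forall t, J t -> Derive xi1 t = - k * exp (- A t) * xi1 t ^ 2).
{ intros t Ht. unfold k. rewrite Ropp_involutive, <- (CI xi1) with (t := t); trivial. now apply EI.
  intros s Hs. replace ((2 * (Derive xi1 s / xi1 s) - a s) * Derive xi1 s) with (Derive (Derive xi1) s) by apply HN, Hs.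
  now apply D2. }
assert (F0 : forall t, J t -> Derive xi0 t = m * exp (- A t) * xi1 t ^ 2).
{ intros t Ht. unfold m. rewrite <- (CI xi0) with (t := t); trivial. now apply EI.
  intros s Hs. replace ((2 * (Derive xi1 s / xi1 s) - a s) * Derive xi0 s) with (Derive (Derive xi0) s) by apply HN, Hs.
  now apply D0. }
destruct (HN t0 J0) as [_ [N0 _]].
exists A, B, k, c, m. split; [exact B0|]. split; [now apply Rinv_neq_0_compat|].
intros t Ht. destruct (HN t Ht) as [_ [N1 _]].
split; [now apply HA|]. split; [now apply HB|]. split; [|split; [now apply F1 | now apply F0]].
(* The derivative of 1 / xi1 is - xi1' / xi1^2 = k exp(-A), that is, k B'. *)
assert (E : / xi1 t - k * B t = / xi1 t0 - k * B t0).
{ apply (zero_derivative_near (fun s => / xi1 s - k * B s) t0 d t Hd); trivial. intros s Hs.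
  destruct (HN s Hs) as [_ [Ns _]].
  replace 0 with (- Derive xi1 s / xi1 s ^ 2 - (0 * B s + k * exp (- A s))) by (rewrite (F1 s Hs); field; trivial).
  apply (is_derive_minus_R (fun s => / xi1 s) (fun s => k * B s)).
  - apply is_derive_inv_R; trivial. now apply D1.
  - apply (is_derive_mult_R (fun _ => k) B). apply is_derive_const_R. now apply HB. }
rewrite B0, Rmult_0_r, Rminus_0_r in E. fold c in E.
replace (k * B t + c) with (/ xi1 t) by lra. now apply Rinv_r.
Qed.

Lemma open_interval_ball t0 d : 0 < d -> Defs.open_interval (fun t => Rabs (t - t0) < d).
Proof.
intro Hd. split; [apply open_ball_R|]. split. exists t0. now apply Rabs_self_lt.
intros a b c Ha Hb Hc. apply (ball_interval t0 d a b); trivial.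
unfold Rmin, Rmax. destruct (Rle_dec a b); lra.
Qed.

Lemma Derive_id_R t : Derive (fun s : R => s) t = 1.
Proof. apply is_derive_unique, is_derive_id_R. Qed.

Lemma Derive_id_2 t : Derive_n (fun s : R => s) 2 t = 0.
Proof.
rewrite (Derive_n_shift _ (fun _ => 1)) by (intro; apply is_derive_id_R).
rewrite (Derive_n_shift _ (fun _ => 0)) by (intro; apply is_derive_const_R). reflexivity.
Qed.

Lemma ln_derivative (f : R -> R) t l : is_derive f t l -> 0 < f t ->
  is_derive (fun s => ln (f s)) t (l * / f t).
Proof.
intros Hf H. apply (is_derive_comp (V := R_NormedModule) ln f); trivial.
apply is_derive_Reals. now apply derivable_pt_lim_ln.
Qed.

(* The general transformation as the composite of the generator with
   x -> x / (B + b), B + b > 0, and a generator for the transformed equation. *)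
Lemma normal_form_generated E E' t0 d tau xi1 xi0 : 0 < d ->
  smooth1 (fun t => Rabs (t - t0) < d) (alpha E) ->
  normal_form (fun t => Rabs (t - t0) < d) (alpha E) (beta E) (alpha E') (beta E') tau xi1 xi0 ->
  exists (w : group_element) (J : R -> Prop) (psi : transformation) (dom1 : R -> Prop),
    Defs.open_interval J /\ J t0 /\ (forall t, J t -> Rabs (t - t0) < d) /\
    (forall s, dom1 s <-> exists t, J t /\ s = tau t) /\
    acts w (restrict E J) psi (restrict E' dom1) /\
    forall t x u, J t -> Omega psi (t, x, u) /\ Tt psi t x u = tau t /\
      Xt psi t x u = xi1 t * x + xi0 t /\
      Ut psi t x u = / Derive tau t * (xi1 t * u + Derive xi1 t * x + Derive xi0 t).
Proof.
intros Hd Sa HN.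
destruct (normal_form_integrals _ _ _ _ _ _ _ _ _ Hd Sa HN) as [A [B [k [c [m [B0 [c0 HI]]]]]]].
destruct HN as [St [S1 [S0 HN]]].
(* b >= 2 keeps B + b positive where |B| < 1, and c - k b is the divisor in [del]. It cannot vanish
   for both b = 2 and b = 3, as c <> 0. *)
assert (exists b, 2 <= b /\ c - k * b <> 0) as [b [Hb Hcb]].
{ destruct (Req_dec (c - k * 2) 0) as [Z|Z].
  - exists 3. split. lra. intro Y. apply c0. lra.
  - exists 2. split; trivial; lra. }
assert (exists d', 0 < d' /\ d' <= d /\ forall t, Rabs (t - t0) < d' -> Rabs (B t) < 1) as [d' [Hd' [Hdd HB1]]].
{ destruct (HI t0 (Rabs_self_lt t0 d Hd)) as [_ [HB _]].
  assert (L := is_derive_close _ _ _ _ HB Rlt_0_1). apply locally_R in L. destruct L as [e [He L]].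
  exists (Rmin d e). split. now apply Rmin_glb_lt. split. apply Rmin_l. intros t Ht.
  specialize (L t). rewrite B0, Rminus_0_r in L. apply L. eapply Rlt_le_trans. exact Ht. apply Rmin_r. }
set (J := fun t => Rabs (t - t0) < d').
assert (JJ : forall t, J t -> Rabs (t - t0) < d) by (unfold J; intros; lra).
assert (Jo : open J) by apply open_ball_R.
assert (HJ : Defs.open_interval J) by now apply open_interval_ball.
set (J0 := Rabs_self_lt t0 d' Hd' : J t0).
assert (Bp : forall t, J t -> 0 < B t + b).
{ intros t Ht. specialize (HB1 t Ht). apply Rabs_def2 in HB1. lra. }
set (g1 := MkParameters (fun t => t) 0 0 1 b).
set (W := X1 g1 B).
assert (W1 : forall t, J t -> W t = / (B t + b)) by (intros; unfold W, X1; simpl; f_equal; ring).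
assert (DW : forall t, J t -> Derive W t = - exp (- A t) / (B t + b) ^ 2).
{ intros t Ht. rewrite (Derive_near J _ (fun s => / (B s + b)) t Jo Ht W1). apply is_derive_unique.
  apply (is_derive_inv_R (fun s => B s + b)).
  - replace (exp (- A t)) with (exp (- A t) + 0) by ring. apply is_derive_plus_R. now apply HI, JJ. apply is_derive_const_R.
  - generalize (Bp t Ht). lra. }
set (E1 := Equation J
  (fun t => / Derive (Defs.tau g1) t * (alpha E t - 2 * (Derive W t / W t) + Derive_n (Defs.tau g1) 2 t / Derive (Defs.tau g1) t))
  (fun t => W t ^ 5 / Derive (Defs.tau g1) t * beta E t)).
assert (a1 : forall t, J t -> alpha E1 t = alpha E t + 2 * (exp (- A t) * / (B t + b))).
{ intros t Ht. change (alpha E1 t) with (/ Derive (fun s => s) t * (alpha E t - 2 * (Derive W t / W t)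
    + Derive_n (fun s => s) 2 t / Derive (fun s => s) t)). rewrite Derive_id_R, Derive_id_2, DW, W1; trivial. field. generalize (Bp t Ht); lra. }
(* Antiderivatives for the intermediate equation: its alpha is a + 2 B' / (B + b), so exp(- A1) =
   exp(- A) / (B + b)^2, which is the derivative of - 1 / (B + b). *)
set (A1 := fun t => A t + 2 * ln (B t + b)).
set (B1 := fun t => - / (B t + b)).
assert (DA1 : forall t, J t -> is_derive A1 t (alpha E1 t)).
{ intros t Ht. rewrite a1; trivial. apply is_derive_plus_R. now apply HI, JJ.
  replace (2 * (exp (- A t) * / (B t + b))) with (0 * ln (B t + b) + 2 * (exp (- A t) * / (B t + b))) by ring.
  apply (is_derive_mult_R (fun _ => 2) (fun s => ln (B s + b))). apply is_derive_const_R.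
  apply (ln_derivative (fun s => B s + b)); [|now apply Bp].
  replace (exp (- A t)) with (exp (- A t) + 0) by ring. apply is_derive_plus_R. now apply HI, JJ. apply is_derive_const_R. }
assert (DB1 : forall t, J t -> is_derive B1 t (exp (- A1 t))).
{ intros t Ht. assert (P := Bp t Ht).
  replace (exp (- A1 t)) with (- (- exp (- A t) / (B t + b) ^ 2)).
  2:{ unfold A1. rewrite Ropp_plus_distr, exp_plus, (exp_Ropp (2 * _)).
      replace (2 * ln (B t + b)) with (ln (B t + b) + ln (B t + b)) by ring. rewrite exp_plus, exp_ln; trivial. field. lra. }
  apply (is_derive_opp (V := R_NormedModule)). apply (is_derive_inv_R (fun s => B s + b)); [|lra].
  replace (exp (- A t)) with (exp (- A t) + 0) by ring. apply is_derive_plus_R. now apply HI, JJ. apply is_derive_const_R. }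
(* With Y = (B + b) xi1 one has Y' = (c - k b) exp(- A) xi1^2, so xi0' = m exp(- A) xi1^2 is [del]
   times Y'; [del2] is the constant of integration. *)
set (del := m / (c - k * b)).
set (del2 := xi0 t0 - del * ((B t0 + b) * xi1 t0)).
(* delta3 and delta4 are read off from 1 / Y = (k B + c) / (B + b) = (k b - c) B1 + k. *)
set (g2 := MkParameters tau del del2 (k * b - c) k).
set (Y := X1 g2 B1).
assert (DY0 : forall t, J t -> is_derive (fun s => (B s + b) * xi1 s) t (exp (- A t) * xi1 t + (B t + b) * Derive xi1 t)).
{ intros t Ht. apply (is_derive_mult_R (fun s => B s + b) xi1).
  - replace (exp (- A t)) with (exp (- A t) + 0) by ring. apply is_derive_plus_R. now apply HI, JJ. apply is_derive_const_R.
  - apply (smooth1_derivable (fun t => Rabs (t - t0) < d)); trivial. now apply JJ. }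
assert (den : forall t, J t -> delta3 g2 * B1 t + delta4 g2 = / ((B t + b) * xi1 t)).
{ intros t Ht. simpl. unfold B1. assert (P := Bp t Ht). destruct (HN t (JJ t Ht)) as [_ [N1 _]].
  destruct (HI t (JJ t Ht)) as [_ [_ [Hk _]]].
  apply Rmult_eq_reg_r with ((B t + b) * xi1 t). 2: apply Rmult_integral_contrapositive; split; lra.
  rewrite Rinv_l by (apply Rmult_integral_contrapositive; split; lra). rewrite <- Hk. field. lra. }
assert (Y1 : forall t, J t -> Y t = (B t + b) * xi1 t).
{ intros t Ht. unfold Y, X1. rewrite den; trivial. apply Rinv_inv. }
assert (DY : forall t, J t -> Derive Y t = exp (- A t) * xi1 t + (B t + b) * Derive xi1 t).
{ intros t Ht. rewrite (Derive_near J _ _ t Jo Ht Y1). apply is_derive_unique. now apply DY0. }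
assert (Dx0 : forall t, J t -> Derive xi0 t = del * Derive Y t).
{ intros t Ht. rewrite DY; trivial. destruct (HI t (JJ t Ht)) as [_ [_ [Hk [F1 F0]]]]. rewrite F1, F0.
  transitivity (del * exp (- A t) * xi1 t * (xi1 t * (k * B t + c) - (B t + b) * k * xi1 t)).
  - unfold del. field. exact Hcb.
  - rewrite Hk. ring. }
assert (X0 : forall t, J t -> xi0 t = del * Y t + del2).
{ intros t Ht.
  assert (Z : xi0 t - del * ((B t + b) * xi1 t) = xi0 t0 - del * ((B t0 + b) * xi1 t0)).
  { apply (zero_derivative_near (fun s => xi0 s - del * ((B s + b) * xi1 s)) t0 d'); trivial. intros s Hs.
    replace 0 with (Derive xi0 s - (0 * ((B s + b) * xi1 s) + del * Derive Y s)) by (rewrite (Dx0 s Hs); ring).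
    apply is_derive_minus_R.
    - apply (smooth1_derivable (fun t => Rabs (t - t0) < d)); trivial. now apply JJ.
    - apply (is_derive_mult_R (fun _ => del) (fun s => (B s + b) * xi1 s)). apply is_derive_const_R.
      rewrite DY; trivial. now apply DY0. }
  rewrite Y1; trivial. unfold del2. lra. }
set (dom1 := fun s => exists t, J t /\ s = tau t).
(* The inner identity is the action of the empty tail of the list. *)
exists [g1; g2], J, (compose (compose (identity_on (restrict E' dom1)) (variables_part g2 E1 B1))
   (variables_part g1 (restrict E J) B)), dom1.
split; [exact HJ|]. split; [exact J0|]. split; [exact JJ|]. split; [intro s; reflexivity|]. split.
- exists (variables_part g1 (restrict E J) B), E1, (compose (identity_on (restrict E' dom1)) (variables_part g2 E1 B1)).
  split; [|split; [|reflexivity]].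
  + exists A, B. split; [|split; [reflexivity|]].
    * split; [|split].
      { simpl. intro Z. injection Z. lra. }
      { simpl. now apply smooth1_id. }
      { simpl. intros t Ht. assert (P := Bp t Ht). split. now apply HI, JJ. split. now apply HI, JJ.
        split. rewrite Derive_id_R. lra. lra. }
    * split.
      { intro s. simpl. split. intro Hs; now exists s. intros [t [Ht Es]]. now subst. }
      { intros t Ht. split; reflexivity. }
  + exists (variables_part g2 E1 B1), (restrict E' dom1), (identity_on (restrict E' dom1)).
    split; [|split; [split; reflexivity | reflexivity]].
    exists A1, B1. split; [|split; [reflexivity|]].
    * split; [|split].
      { intro Z. injection Z. intros. lra. }
      { simpl. apply smooth1_sub with (2 := St). exact JJ. }
      { intros t Ht. change (J t) in Ht. split; [now apply DA1|]. split; [now apply DB1|].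
        destruct (HN t (JJ t Ht)) as [N0 [N1 _]]. split; [exact N0|]. rewrite den; trivial.
        apply Rinv_neq_0_compat, Rmult_integral_contrapositive. split; trivial. generalize (Bp t Ht); lra. }
    * split. { intro s. reflexivity. }
      intros t Ht. change (J t) in Ht. destruct (HN t (JJ t Ht)) as [N0 [N1 [R1 [R2 _]]]].
      assert (P := Bp t Ht).
      fold Y. change (Derive_n (Defs.tau g2) 2 t) with (Derive (Derive tau) t).
      change (Defs.tau g2) with tau.
      split.
      { rewrite a1, DY, Y1; trivial. change (alpha (restrict E' dom1)) with (alpha E').
        apply Rmult_eq_reg_r with (Derive tau t); trivial. rewrite R2. field. repeat split; trivial. lra. }
      { rewrite Y1; trivial. change (beta (restrict E' dom1)) with (beta E').
        change (beta E1 t) with (W t ^ 5 / Derive (fun s : R => s) t * beta E t).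
        rewrite Derive_id_R, W1; trivial.
        apply Rmult_eq_reg_r with (Derive tau t); trivial. rewrite R1. field. repeat split; trivial. lra. }
- intros t x u Ht. destruct (HN t (JJ t Ht)) as [N0 [N1 _]]. assert (P := Bp t Ht).
  split; [|split; [|split]].
  + split. exact Ht. split. exact Ht. now exists t.
  + reflexivity.
  + simpl. fold Y. fold W. rewrite X0, !Y1, W1; trivial. field. lra.
  + simpl. fold Y. fold W. rewrite Derive_id_R, Dx0, !DY, Y1, DW, W1; trivial.
    field. split; trivial. lra.
Qed.

Lemma admissible_generated E phi E' : admissible E phi E' -> generated E phi E'.
Proof.
intros Ha t x u Hp.
destruct (admissible_local E phi E' t x u Ha Hp) as [d [tau [xi1 [xi0 [Hd [HN HL]]]]]].
assert (Hin : forall s, Rabs (s - t) < d -> dom E s /\ dom E' (tau s)).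
{ intros s Hs. destruct (HL s x u Hs (Rabs_self_lt x d Hd) (Rabs_self_lt u d Hd)) as [H1 [H2 _]].
  rewrite <- H2. now apply Ha. }
assert (Sa : smooth1 (fun s => Rabs (s - t) < d) (alpha E)).
{ apply smooth1_sub with (dom E). intros s Hs. now apply Hin. apply Ha. }
destruct (normal_form_generated E E' t d tau xi1 xi0 Hd Sa HN) as [w [J [psi [dom1 [HJ [Jt [JJ [Hdom [Hw Hpsi]]]]]]]]].
exists w, J, psi, (restrict E' dom1). split; [exact HJ|]. split; [exact Jt|].
split; [intros s Hs; now apply Hin, JJ|]. split; [exact Hw|]. split.
- intros s Hs. apply Hdom in Hs. destruct Hs as [r [Hr Es]]. subst s. split; [now apply Hin, JJ | split; reflexivity].
- destruct HJ as [Jo _]. assert (L := Jo t Jt). apply locally_R in L. destruct L as [e [He L]].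
  apply locally_R3. exists (Rmin d e). split. now apply Rmin_glb_lt.
  intros s y z Hs Hy Hz.
  assert (M : forall r, r < Rmin d e -> r < d /\ r < e).
  { intros r Hr. generalize (Rmin_l d e) (Rmin_r d e). lra. }
  apply M in Hs, Hy, Hz.
  destruct (HL s y z) as [L1 [L2 [L3 L4]]]; try tauto. 
  destruct (Hpsi s y z) as [P1 [P2 [P3 P4]]]. apply L; tauto.
  rewrite L2, L3, L4, P2, P3, P4. now repeat split.
Qed.

(** * Group elements are admissible *)

Lemma smooth1_intro J f : (forall t, J t -> ex_derive f t) -> smooth1 J (Derive f) -> smooth1 J f.
Proof.
intros H1 H n t Ht. destruct n as [|[|n]]. exact I. now apply H1.
apply ex_derive_ext with (2 := H (S n) t Ht). intro s. symmetry. apply Derive_n_Derive.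
Qed.

Lemma smooth1_antiderivative J f F : open J -> smooth1 J f -> (forall t, J t -> is_derive F t (f t)) -> smooth1 J F.
Proof.
intros HJ Hf HF. apply smooth1_intro.
- intros t Ht. eexists. now apply HF.
- apply smooth1_ext with f; trivial. intros t Ht. symmetry. now apply is_derive_unique, HF.
Qed.

Lemma smooth1_exp J : smooth1 J exp.
Proof.
intros n t _. destruct n. exact I. eexists. apply (is_derive_n_exp (S n)).
Qed.

Lemma continuity_pt_smooth1 J f t : smooth1 J f -> J t -> continuity_pt f t.
Proof.
intros H Ht. apply continuity_pt_filterlim. eapply is_derive_continuous. now apply (smooth1_derivable J f).
Qed.

Lemma interval_convex (J : R -> Prop) a b c : Defs.open_interval J -> J a -> J b ->
  Rmin a b <= c <= Rmax a b -> J c.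
Proof.
intros [_ [_ H]] Ha Hb Hc. unfold Rmin, Rmax in Hc. destruct (Rle_dec a b).
- now apply (H a b).
- now apply (H b a).
Qed.

Lemma interval_injective (J : R -> Prop) f a b : Defs.open_interval J -> smooth1 J f ->
  (forall t, J t -> Derive f t <> 0) -> J a -> J b -> f a = f b -> a = b.
Proof.
intros HJ Hf N Ha Hb E.
destruct (MVT_gen f a b (Derive f)) as [c [Hc Ec]].
- intros x Hx. apply (smooth1_derivable J); trivial. apply (interval_convex J a b); trivial. lra.
- intros x Hx. apply (continuity_pt_smooth1 J); trivial. now apply (interval_convex J a b).
- rewrite E, Rminus_diag in Ec. symmetry in Ec. apply Rmult_integral in Ec. destruct Ec as [Ec|Ec]. 2: lra.
  exfalso. revert Ec. apply N. now apply (interval_convex J a b).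
Qed.

Lemma interval_image_convex (J : R -> Prop) f a b c : Defs.open_interval J -> smooth1 J f ->
  J a -> J b -> f a <= c <= f b -> exists t, J t /\ c = f t.
Proof.
intros HJ Hf Ha Hb Hc.
destruct (Rtotal_order a b) as [L|[L|L]].
- destruct (f_interv_is_interv f a b c L Hc) as [t [Ht Et]].
  { intros x Hx. apply (continuity_pt_smooth1 J); trivial. apply (proj2 (proj2 HJ) a b); trivial. }
  exists t. split; [|now symmetry]. apply (proj2 (proj2 HJ) a b); trivial.
- subst. exists b. split; trivial. lra.
- destruct (f_interv_is_interv (fun x => - f x) b a (- c) L) as [t [Ht Et]]. lra.
  { intros x Hx. apply continuity_pt_opp. apply (continuity_pt_smooth1 J); trivial. apply (proj2 (proj2 HJ) b a); trivial. }
  exists t. split; [|lra]. apply (proj2 (proj2 HJ) b a); trivial.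
Qed.

(** The implicit function theorem for f(u) - t = 0, with x as a dummy variable fixed at 0. *)
Lemma local_inverse (J : R -> Prop) f t0 : open J -> smooth1 J f -> J t0 -> Derive f t0 <> 0 ->
  exists (K : R -> Prop) (g : R -> R), open K /\ K (f t0) /\ smooth1 K g /\
    forall s, K s -> J (g s) /\ f (g s) = s.
Proof.
intros HJ Hf H0 N.
set (W := fun p : R * R * R => J (snd p)).
assert (HW : open W).
{ intros [[a b] c] Hp. apply HJ, locally_R in Hp. destruct Hp as [e [He Hp]].
  apply locally_R3. exists e. split; trivial. intros a' b' c' _ _ Hc. now apply Hp. }
set (F := fun t _ u : R => f u - t).
assert (HF : smooth3 W F).
{ intro k. apply Ck3_minus; trivial. 2: now apply Ck3_pr_t.
  apply (Ck3_comp W HW k (fun p => J (fst (fst p))) (fun t _ _ => f t) (fun _ _ u => u) (fun _ _ _ => 0) (fun _ _ _ => 0)).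
  - now apply open_strip.
  - intro j. now apply Ck3_of_smooth1.
  - now apply Ck3_pr_u.
  - now apply Ck3_const.
  - now apply Ck3_const.
  - intros t x u H. exact H. }
destruct (implicit_function W F (f t0) 0 t0 HW HF H0) as [D [u [HD [Dp [Hu [_ Hs]]]]]].
- unfold F. ring.
- unfold du3, F. rewrite (is_derive_unique _ _ (Derive f t0 - 0)). lra.
  apply is_derive_minus_R. now apply (smooth1_derivable J). apply is_derive_const_R.
- exists (fun s => D (s, 0)), (fun s => u s 0). split; [|split; [exact Dp|split]].
  + intros s Hsd. apply HD, locally_R2 in Hsd. destruct Hsd as [e [He Hsd]]. apply locally_R.
    exists e. split; trivial. intros y Hy. apply Hsd; trivial. now apply Rabs_self_lt.
  + apply (smooth3_slice_t _ (fun p => D (fst p)) (fun t x _ => u t x) 0 0); trivial.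
    intro k. now apply Ck3_of_Ck2.
  + intros s Hsd. destruct (Hs s 0 Hsd) as [H1 [H2 _]]. split; trivial. unfold F in H2. lra.
Qed.

(** Locally h' is h composed with a smooth inverse of f, and smoothness is a local property. *)
Lemma smooth1_pullback (J K : R -> Prop) f h h' : open J -> smooth1 J f -> (forall t, J t -> Derive f t <> 0) ->
  smooth1 J h -> (forall s, K s <-> exists t, J t /\ s = f t) -> (forall t, J t -> h' (f t) = h t) ->
  smooth1 K h'.
Proof.
intros HJ Hf N Hh HK E. apply smooth1_local. intros s Hs. apply HK in Hs. destruct Hs as [t [Ht ->]].
destruct (local_inverse J f t HJ Hf Ht (N t Ht)) as [V [g [HV [V0 [Hg G]]]]].
exists V. split; trivial. apply smooth1_ext with (fun s => h (g s)); trivial.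
- intros s Hs. destruct (G s Hs) as [G1 G2]. rewrite <- (E (g s) G1). now rewrite G2.
- apply smooth1_comp with J; trivial. intros r Hr. now apply G.
Qed.

Lemma open_interval_image (J K : R -> Prop) f : Defs.open_interval J -> smooth1 J f ->
  (forall t, J t -> Derive f t <> 0) -> (forall s, K s <-> exists t, J t /\ s = f t) -> Defs.open_interval K.
Proof.
intros HJ Hf N HK. destruct HJ as [HJo [[t0 H0] HJc]] eqn:EJ. clear EJ. split; [|split].
- intros s Hs. apply HK in Hs. destruct Hs as [t [Ht ->]].
  destruct (local_inverse J f t HJo Hf Ht (N t Ht)) as [V [g [HV [V0 [Hg G]]]]].
  apply filter_imp with (2 := HV _ V0). intros s Hs. apply HK. destruct (G s Hs). exists (g s). now split.
- exists (f t0). apply HK. now exists t0.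
- intros a b c Ha Hb Hc. apply HK in Ha. apply HK in Hb. destruct Ha as [a' [Ha ->]]. destruct Hb as [b' [Hb ->]].
  apply HK. apply (interval_image_convex J f a' b'); trivial.
Qed.

Lemma in_class_image E E' f fa fb : in_class E -> smooth1 (dom E) f ->
  (forall t, dom E t -> Derive f t <> 0) -> smooth1 (dom E) fa -> smooth1 (dom E) fb ->
  (forall t, dom E t -> fb t <> 0) ->
  (forall s, dom E' s <-> exists t, dom E t /\ s = f t) ->
  (forall t, dom E t -> alpha E' (f t) = fa t /\ beta E' (f t) = fb t) -> in_class E'.
Proof.
intros [HE _] Hf N Hfa Hfb Nb HD HH. assert (Ho := proj1 HE). split; [|split; [|split]].
- now apply (open_interval_image (dom E) _ f).
- apply (smooth1_pullback (dom E) _ f fa); trivial. intros t Ht. now apply HH.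
- apply (smooth1_pullback (dom E) _ f fb); trivial. intros t Ht. now apply HH.
- intros s Hs. apply HD in Hs. destruct Hs as [t [Ht ->]]. destruct (HH t Ht) as [_ ->]. now apply Nb.
Qed.

(** A and B are given only as antiderivatives; their smoothness comes from A' = alpha and then B' =
    exp(- A). *)
Lemma regular_smooth g E A B : in_class E -> regular g E A B ->
  smooth1 (dom E) (X1 g B) /\
  (forall t, dom E t -> is_derive (X1 g B) t (- delta3 g * exp (- A t) * X1 g B t ^ 2)).
Proof.
intros [[Ho _] [Sa _]] [_ [_ H]].
assert (SA : smooth1 (dom E) A) by (apply (smooth1_antiderivative _ (alpha E)); trivial; intros; now apply H).
assert (SB : smooth1 (dom E) B).
{ apply (smooth1_antiderivative _ (fun t => exp (- A t))); trivial. 2: intros; now apply H.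
  apply (smooth1_comp _ (fun _ => True) exp (fun t => - A t)); trivial. apply open_true.
  apply smooth1_exp. apply smooth1_ext with (fun t => 0 - A t); trivial. intros; ring.
  apply smooth1_minus; trivial. apply smooth1_const. }
split.
- apply smooth1_inv; trivial. intros; now apply H.
  apply smooth1_plus; trivial. apply smooth1_mult; trivial. apply smooth1_const. apply smooth1_const.
- intros t Ht. destruct (H t Ht) as [_ [HB [_ N]]].
  replace (- delta3 g * exp (- A t) * X1 g B t ^ 2) with
    (- (0 * B t + delta3 g * exp (- A t) + 0) / (delta3 g * B t + delta4 g) ^ 2) by (unfold X1; field; trivial).
  apply (is_derive_inv_R (fun s => delta3 g * B s + delta4 g)); trivial.
  apply is_derive_plus_R. apply (is_derive_mult_R (fun _ => delta3 g) B); trivial.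
  apply is_derive_const_R. apply is_derive_const_R.
Qed.

Lemma elements_exist g E A B : in_class E -> regular g E A B ->
  exists E' : equation, in_class E' /\ elements_part g E B E'.
Proof.
intros HE HR. destruct (regular_smooth g E A B HE HR) as [S1 D1].
assert (Hc := HE). destruct Hc as [HI [Sa [Sb Nb]]]. assert (Ho := proj1 HI).
destruct HR as [_ [St H]].
set (fa := fun t => / Derive (tau g) t * (alpha E t - 2 * (Derive (X1 g B) t / X1 g B t)
   + Derive_n (tau g) 2 t / Derive (tau g) t)).
set (fb := fun t => X1 g B t ^ 5 / Derive (tau g) t * beta E t).
assert (N1 : forall t, dom E t -> X1 g B t <> 0) by (intros; unfold X1; now apply Rinv_neq_0_compat, H).
assert (Nt : forall t, dom E t -> Derive (tau g) t <> 0) by (intros; now apply H).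
(* The inverse of tau on its image, determined there because tau' <> 0 on an interval makes tau
   injective; the new coefficients are defined through it. *)
set (inv := fun s => epsilon (inhabits 0) (fun t => dom E t /\ tau g t = s)).
assert (Hinv : forall t, dom E t -> inv (tau g t) = t).
{ intros t Ht. destruct (epsilon_spec (inhabits 0) (fun r => dom E r /\ tau g r = tau g t)) as [H1 H2].
  now exists t. apply (interval_injective (dom E) (tau g)); trivial. }
set (E' := Equation (fun s => exists t, dom E t /\ s = tau g t) (fun s => fa (inv s)) (fun s => fb (inv s))).
assert (HH : forall t, dom E t -> alpha E' (tau g t) = fa t /\ beta E' (tau g t) = fb t).
{ intros t Ht. simpl. now rewrite Hinv. }
exists E'. split.
- apply (in_class_image E E' (tau g) fa fb); trivial.
  + assert (I1 : smooth1 (dom E) (fun t => / Derive (tau g) t)) by (apply smooth1_inv; trivial; now apply smooth1_Derive).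
    apply smooth1_mult; trivial. apply smooth1_plus; trivial. apply smooth1_minus; trivial.
    apply smooth1_mult; trivial. apply smooth1_const. apply smooth1_mult; trivial. now apply smooth1_Derive.
    now apply smooth1_inv. apply smooth1_mult; trivial. now apply (smooth1_Derive_n _ _ 2).
  + apply smooth1_mult; trivial. apply smooth1_mult; trivial. now apply smooth1_pow.
    apply smooth1_inv; trivial. now apply smooth1_Derive.
  + intros t Ht. unfold fb. apply Rmult_integral_contrapositive; split; [|now apply Nb].
    apply Rmult_integral_contrapositive; split. now apply pow_nonzero, N1. now apply Rinv_neq_0_compat, Nt.
  + intro s. reflexivity.
- split. intro s. reflexivity. exact HH.
Qed.

(** The invariant of the induction on words: the normal form on the whole domain. It holds for the
    generators and, unlike their own shape, is closed under composition. *)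
Definition has_normal_form (E : equation) (phi : transformation) (E' : equation) : Prop :=
  exists tau xi1 xi0 : R -> R,
    normal_form (dom E) (alpha E) (beta E) (alpha E') (beta E') tau xi1 xi0 /\
    (forall s, dom E' s <-> exists t, dom E t /\ s = tau t) /\
    (forall t x u, Omega phi (t, x, u) <-> dom E t) /\
    (forall t x u, dom E t -> Tt phi t x u = tau t /\ Xt phi t x u = xi1 t * x + xi0 t /\
      Ut phi t x u = / Derive tau t * (xi1 t * u + Derive xi1 t * x + Derive xi0 t)).

Lemma identity_normal_form E : in_class E -> has_normal_form E (identity_on E) E.
Proof.
intros [[Ho _] _]. exists (fun t => t), (fun _ => 1), (fun _ => 0).
assert (Z : forall c t, Derive (fun _ : R => c) t = 0) by (intros; apply is_derive_unique, is_derive_const_R).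
assert (I2 : forall t, Derive (Derive (fun s : R => s)) t = 0) by exact Derive_id_2.
assert (Z2 : forall c t, Derive (Derive (fun _ : R => c)) t = 0).
{ intros c t. rewrite (Derive_ext _ (fun _ => 0)) by apply Z. apply Z. }
split; [|split; [|split]].
- split; [now apply smooth1_id|]. split; [apply smooth1_const|]. split; [apply smooth1_const|].
  intros t Ht. rewrite I2, !Z2, !Z, Derive_id_R. repeat split; lra || field || ring.
- intro s. split. intro Hs; now exists s. intros [t [Ht Es]]. now subst.
- intros. reflexivity.
- intros t x u Ht. rewrite !Z, Derive_id_R. simpl. repeat split; field.
Qed.

(** xi1 = X1 satisfies X1' = - delta3 exp(- A) X1^2, and one more derivative gives its second-order
    equation. As xi0 = delta1 X1 + delta2, the same linear equation holds for xi0. *)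
Lemma generator_normal_form g E phi E' : in_class E -> generator g E phi E' -> has_normal_form E phi E'.
Proof.
intros HE [A [B [HR [-> [HD HH]]]]].
destruct (regular_smooth g E A B HE HR) as [S1 D1].
assert (Ho := proj1 (proj1 HE)).
destruct HR as [_ [St H]].
assert (N1 : forall t, dom E t -> X1 g B t <> 0) by (intros; unfold X1; now apply Rinv_neq_0_compat, H).
assert (DX : forall t, dom E t -> Derive (X1 g B) t = - delta3 g * exp (- A t) * X1 g B t ^ 2)
  by (intros; now apply is_derive_unique, D1).
assert (DX2 : forall t, dom E t -> Derive (Derive (X1 g B)) t =
   (2 * (Derive (X1 g B) t / X1 g B t) - alpha E t) * Derive (X1 g B) t).
{ intros t Ht. rewrite (Derive_near (dom E) _ _ t Ho Ht DX). apply is_derive_unique.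
  replace ((2 * (Derive (X1 g B) t / X1 g B t) - alpha E t) * Derive (X1 g B) t) with
   ((0 * exp (- A t) + - delta3 g * (- alpha E t * exp (- A t))) * X1 g B t ^ 2
    + - delta3 g * exp (- A t) * (Derive (X1 g B) t * (X1 g B t * 1) + X1 g B t * (Derive (X1 g B) t * 1 + X1 g B t * 0)))
   by (rewrite DX; trivial; field; now apply N1).
  apply (is_derive_mult_R (fun s => - delta3 g * exp (- A s)) (fun s => X1 g B s ^ 2)).
  - apply (is_derive_mult_R (fun _ => - delta3 g) (fun s => exp (- A s))). apply is_derive_const_R.
    apply (is_derive_exp_comp (fun s => - A s)). apply (is_derive_opp (V := R_NormedModule)). now apply H.
  - assert (DD := smooth1_derivable _ _ _ S1 Ht).
    apply (is_derive_mult_R (X1 g B) (fun s => X1 g B s * 1)); trivial.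
    apply (is_derive_mult_R (X1 g B) (fun _ => 1)); trivial. apply is_derive_const_R. }
assert (SX0 : smooth1 (dom E) (fun t => delta1 g * X1 g B t + delta2 g)).
{ apply smooth1_plus; trivial. apply smooth1_mult; trivial. apply smooth1_const. apply smooth1_const. }
assert (DX0 : forall t, dom E t -> Derive (fun t => delta1 g * X1 g B t + delta2 g) t = delta1 g * Derive (X1 g B) t).
{ intros t Ht. apply is_derive_unique.
  replace (delta1 g * Derive (X1 g B) t) with (0 * X1 g B t + delta1 g * Derive (X1 g B) t + 0) by ring.
  apply is_derive_plus_R. apply (is_derive_mult_R (fun _ => delta1 g) (X1 g B)). apply is_derive_const_R.
  now apply (smooth1_derivable (dom E)). apply is_derive_const_R. }
assert (DX02 : forall t, dom E t -> Derive (Derive (fun t => delta1 g * X1 g B t + delta2 g)) t = delta1 g * Derive (Derive (X1 g B)) t).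
{ intros t Ht. rewrite (Derive_near (dom E) _ _ t Ho Ht DX0). apply is_derive_unique.
  replace (delta1 g * Derive (Derive (X1 g B)) t) with (0 * Derive (X1 g B) t + delta1 g * Derive (Derive (X1 g B)) t) by ring.
  apply (is_derive_mult_R (fun _ => delta1 g) (Derive (X1 g B))). apply is_derive_const_R.
  apply (smooth1_derivable (dom E)); trivial. now apply smooth1_Derive. }
exists (tau g), (X1 g B), (fun t => delta1 g * X1 g B t + delta2 g). split; [|split; [exact HD|split]].
- split; [exact St|]. split; [exact S1|]. split; [exact SX0|]. intros t Ht.
  destruct (H t Ht) as [_ [_ [Nt _]]]. destruct (HH t Ht) as [Ha Hb].
  split; [exact Nt|]. split; [now apply N1|]. split; [rewrite Hb; field; trivial|].
  split; [|split].
  + rewrite Ha. change (Derive_n (tau g) 2 t) with (Derive (Derive (tau g)) t). field. split; trivial. now apply N1.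
  + now apply DX2.
  + rewrite DX02, DX0, DX2; trivial. ring.
- intros. reflexivity.
- intros t x u Ht. rewrite DX0; trivial. simpl. repeat split; ring.
Qed.

Lemma is_derive_comp_R (f g : R -> R) t l m : is_derive f (g t) l -> is_derive g t m ->
  is_derive (fun s => f (g s)) t (m * l).
Proof. intros Hf Hg. now apply (is_derive_comp (V := R_NormedModule) f g). Qed.

(** Maps affine in x compose to xi1 = (b1 o T) a1 and xi0 = (b1 o T) a0 + b0 o T. The conditions
    follow by eliminating all second derivatives of these functions and the coefficients of the
    intermediate equation. *)
Lemma compose_normal_form E phi1 E1 phi2 E2 : in_class E -> in_class E1 ->
  has_normal_form E phi1 E1 -> has_normal_form E1 phi2 E2 -> has_normal_form E (compose phi2 phi1) E2.
Proof.
intros [[Ho _] _] [[Ho1 _] _] [T [a1 [a0 [[ST [S1 [S0 H]]] [HD [HO HF]]]]]] [T' [b1 [b0 [[ST' [S1' [S0' H']]] [HD' [HO' HF']]]]]].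
set (J := dom E) in *. set (K := dom E1) in *.
assert (JK : forall t, J t -> K (T t)) by (intros t Ht; apply HD; now exists t).
assert (d1 : forall f t, smooth1 J f -> J t -> is_derive f t (Derive f t)) by (intros; now apply (smooth1_derivable J)).
assert (d2 : forall f t, smooth1 J f -> J t -> is_derive (Derive f) t (Derive (Derive f) t))
  by (intros; apply (smooth1_derivable J); trivial; now apply smooth1_Derive).
assert (c1 : forall f t, smooth1 K f -> J t -> is_derive (fun s => f (T s)) t (Derive T t * Derive f (T t))).
{ intros f t Hf Ht. apply is_derive_comp_R; auto. apply (smooth1_derivable K); auto. }
assert (dT : forall t, J t -> Derive (fun s => T' (T s)) t = Derive T t * Derive T' (T t))
  by (intros; now apply is_derive_unique, c1).
assert (dT2 : forall t, J t -> Derive (Derive (fun s => T' (T s))) t =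
   Derive (Derive T) t * Derive T' (T t) + Derive T t * (Derive T t * Derive (Derive T') (T t))).
{ intros t Ht. rewrite (Derive_near J _ _ t Ho Ht dT). apply is_derive_unique.
  apply (is_derive_mult_R (Derive T) (fun s => Derive T' (T s))); auto. apply c1; trivial. now apply smooth1_Derive. }
assert (dm : forall f h t, smooth1 J f -> smooth1 K h -> J t -> Derive (fun s => h (T s) * f s) t
   = Derive T t * Derive h (T t) * f t + h (T t) * Derive f t).
{ intros f h t Hf Hh Ht. apply is_derive_unique. apply (is_derive_mult_R (fun s => h (T s)) f); auto. }
assert (dm2 : forall f h t, smooth1 J f -> smooth1 K h -> J t -> Derive (Derive (fun s => h (T s) * f s)) t
   = (Derive (Derive T) t * Derive h (T t) + Derive T t * (Derive T t * Derive (Derive h) (T t))) * f t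
     + Derive T t * Derive h (T t) * Derive f t + (Derive T t * Derive h (T t) * Derive f t + h (T t) * Derive (Derive f) t)).
{ intros f h t Hf Hh Ht.
  rewrite (Derive_near J _ _ t Ho Ht (fun s Hs => dm f h s Hf Hh Hs)). apply is_derive_unique.
  apply is_derive_plus_R.
  - apply (is_derive_mult_R (fun s => Derive T s * Derive h (T s)) f); auto.
    apply (is_derive_mult_R (Derive T) (fun s => Derive h (T s))); auto. apply c1; trivial. now apply smooth1_Derive.
  - apply (is_derive_mult_R (fun s => h (T s)) (Derive f)); auto. }
set (x1 := fun t => b1 (T t) * a1 t). set (x0 := fun t => b1 (T t) * a0 t + b0 (T t)).
assert (Sc : forall f, smooth1 K f -> smooth1 J (fun t => f (T t))).
{ intros f Hf. now apply smooth1_comp with K. }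
assert (Sp : smooth1 J (fun t => b1 (T t) * a0 t)) by (apply smooth1_mult; auto).
assert (dx0 : forall t, J t -> Derive x0 t = Derive T t * Derive b1 (T t) * a0 t + b1 (T t) * Derive a0 t
    + Derive T t * Derive b0 (T t)).
{ intros t Ht. apply is_derive_unique. apply is_derive_plus_R; auto. rewrite <- dm; trivial. now apply d1. }
assert (dx02 : forall t, J t -> Derive (Derive x0) t =
   (Derive (Derive T) t * Derive b1 (T t) + Derive T t * (Derive T t * Derive (Derive b1) (T t))) * a0 t
     + Derive T t * Derive b1 (T t) * Derive a0 t + (Derive T t * Derive b1 (T t) * Derive a0 t + b1 (T t) * Derive (Derive a0) t)
   + (Derive (Derive T) t * Derive b0 (T t) + Derive T t * (Derive T t * Derive (Derive b0) (T t)))).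
{ intros t Ht. rewrite <- dm2; trivial.
  rewrite (Derive_near J _ (fun s => Derive (fun r => b1 (T r) * a0 r) s + Derive T s * Derive b0 (T s)) t Ho Ht).
  - apply is_derive_unique. apply is_derive_plus_R. now apply d2.
    apply (is_derive_mult_R (Derive T) (fun s => Derive b0 (T s))); auto. apply c1; trivial. now apply smooth1_Derive.
  - intros s Hs. rewrite dx0, dm; trivial. }
exists (fun t => T' (T t)), x1, x0. split; [|split; [|split]].
- split; [now apply Sc|]. split; [apply smooth1_mult; auto|]. split; [apply smooth1_plus; auto|].
  intros t Ht. destruct (H t Ht) as [N [M [R1 [R2 [R3 R4]]]]].
  destruct (H' (T t) (JK t Ht)) as [N' [M' [R1' [R2' [R3' R4']]]]].
  rewrite dT2, dT, dx02, dx0; trivial. unfold x1. rewrite dm2, dm; trivial.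
  rewrite R3, R4, R3', R4'.
  assert (E1a : alpha E1 (T t) = (alpha E t - 2 * (Derive a1 t / a1 t) + Derive (Derive T) t / Derive T t) / Derive T t)
    by (rewrite <- R2; field; trivial).
  assert (E1b : beta E1 (T t) = a1 t ^ 5 * beta E t / Derive T t) by (rewrite <- R1; field; trivial).
  split; [now apply Rmult_integral_contrapositive|]. split; [now apply Rmult_integral_contrapositive|].
  split; [|split; [|split]].
  + transitivity (Derive T t * (beta E2 (T' (T t)) * Derive T' (T t))). ring. rewrite R1', E1b. field. trivial.
  + transitivity (Derive T t * (alpha E2 (T' (T t)) * Derive T' (T t))). ring. rewrite R2', E1a. field. repeat split; trivial.
  + rewrite E1a. field. repeat split; trivial.
  + rewrite E1a. field. repeat split; trivial.
- intro s. rewrite HD'. split.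
  + intros [r [Hr ->]]. apply HD in Hr. destruct Hr as [t [Ht ->]]. now exists t.
  + intros [t [Ht ->]]. exists (T t). split; auto.
- intros t x u. simpl. split.
  + intros [H1 _]. now apply HO in H1.
  + intro Ht. destruct (HF t x u Ht) as [F1 _]. split. now apply HO. apply HO'. rewrite F1. now apply JK.
- intros t x u Ht. destruct (HF t x u Ht) as [F1 [F2 F3]]. simpl. rewrite F1, F2, F3.
  destruct (HF' (T t) (a1 t * x + a0 t) (/ Derive T t * (a1 t * u + Derive a1 t * x + Derive a0 t)) (JK t Ht)) as [G1 [G2 G3]].
  rewrite G1, G2, G3. destruct (H t Ht) as [N [M _]]. destruct (H' (T t) (JK t Ht)) as [N' [M' _]].
  split; [reflexivity|]. split; [unfold x1, x0; ring|].
  rewrite dT, dx0; trivial. unfold x1. rewrite dm; trivial. field. now split.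
Qed.

(** * Direct substitution into the target equation *)

Lemma smooth2_chain_t D v (a b : R -> R) t a1 b1 : open D -> smooth2 D v -> D (a t, b t) ->
  is_derive a t a1 -> is_derive b t b1 ->
  is_derive (fun s => v (a s) (b s)) t (dt v (a t) (b t) * a1 + dx v (a t) (b t) * b1).
Proof.
intros HD Hv Hp Ha Hb.
replace (dt v (a t) (b t) * a1 + dx v (a t) (b t) * b1) with
  (dt v (a t) (b t) * a1 + dx v (a t) (b t) * b1 + du3 (fun t x _ => v t x) (a t) (b t) 0 * 0) by ring.
apply (chain_rule3 0 (fun p => D (fst p)) (fun t x _ => v t x) a b (fun _ => 0)); trivial.
- now apply open_fst.
- now apply Ck3_of_Ck2.
- apply is_derive_const_R.
Qed.

Lemma smooth2_derivs D v t x : smooth2 D v -> D (t, x) ->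
  is_derive (fun s => v s x) t (dt v t x) /\ is_derive (fun y => v t y) x (dx v t x).
Proof.
intros Hv Hp. destruct (Hv 1%nat) as [_ [H _]]. destruct (H t x Hp). split; now apply Derive_correct.
Qed.

Lemma Derive_n_affine_arg (K : R -> Prop) f n a b x : open K -> smooth1 K f -> K (a * x + b) ->
  Derive_n (fun y => f (a * y + b)) n x = a ^ n * Derive_n f n (a * x + b).
Proof.
intros HK Hf Hx. rewrite (Derive_n_comp_scal (fun y => f (y + b))).
- now rewrite Derive_n_comp_trans.
- assert (L := HK _ Hx). apply locally_R in L. destruct L as [e [He L]]. apply locally_R.
  exists e. split; trivial. intros y Hy k _. apply ex_derive_n_comp_trans. apply Hf. apply L.
  now replace (y + b - (a * x + b)) with (y - a * x) by ring.
Qed.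

Lemma Derive_n5_plus_affine (K : R -> Prop) f c a b x : open K -> smooth1 K f -> K x ->
  Derive_n (fun y => c * f y + (a * y + b)) 5 x = c * Derive_n f 5 x.
Proof.
intros HK Hf Hx. rewrite Derive_n_plus.
- rewrite Derive_n5_affine, Derive_n_scal_l. ring.
- apply smooth1_derivs_near with K; trivial. apply smooth1_mult; trivial. apply smooth1_const.
- apply smooth1_derivs_near with K; trivial. apply smooth1_plus; trivial. apply smooth1_mult; trivial.
  apply smooth1_const. now apply smooth1_id. apply smooth1_const.
Qed.

(** Differentiating v(T, xi1 x + xi0) = U in t, once in x and five times in x determines v_T, v_X
    and v_XXXXX; the two residuals then turn out to be proportional. *)
Lemma normal_form_maps E phi E' : in_class E -> has_normal_form E phi E' -> maps E E' phi.
Proof.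
intros [[Ho _] _] [T [a1 [a0 [[ST [S1 [S0 H]]] [_ [HO HF]]]]]].
intros D D' u v t x Tu Xu Uu HD Hu HD' Hv HH Hp _.
destruct (HH t x Hp) as [Op [Dp _]]. apply HO in Op.
destruct (H t Op) as [N [M [R1 [R2 [R3 R4]]]]].
assert (ET : forall s y, D (s, y) -> Tu s y = T s /\ Xu s y = a1 s * y + a0 s /\
  v (T s) (a1 s * y + a0 s) = / Derive T s * (a1 s * u s y + Derive a1 s * y + Derive a0 s)).
{ intros s y Hs. destruct (HH s y Hs) as [O1 [_ V]]. apply HO in O1. destruct (HF s y (u s y) O1) as [F1 [F2 F3]].
  unfold Tu, Xu, Uu in *. rewrite F1, F2, F3 in V. now repeat split. }
destruct (ET t x Hp) as [E1 [E2 E3]]. rewrite E1, E2 in Dp |- *.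
assert (Lx : locally x (fun y => D (t, y))) by exact (open_slice D t HD x Hp).
assert (Lt : locally t (fun s => D (s, x))).
{ apply HD, locally_R2 in Hp. destruct Hp as [e [He Hp]]. apply locally_R. exists e. split; trivial.
  intros s Hs. apply Hp; trivial. now apply Rabs_self_lt. }
assert (dd : forall f, smooth1 (dom E) f -> is_derive f t (Derive f t)) by (intros; now apply (smooth1_derivable (dom E))).
destruct (smooth2_derivs D u t x Hu Hp) as [ut ux].
assert (Vx : dx v (T t) (a1 t * x + a0 t) * a1 t = / Derive T t * (a1 t * dx u t x + Derive a1 t)).
{ assert (A : is_derive (fun y => v (T t) (a1 t * y + a0 t)) x (dx v (T t) (a1 t * x + a0 t) * a1 t)).
  { replace (dx v (T t) (a1 t * x + a0 t) * a1 t) with (dt v (T t) (a1 t * x + a0 t) * 0 + dx v (T t) (a1 t * x + a0 t) * a1 t) by ring.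
    apply (smooth2_chain_t D' v (fun _ => T t) (fun y => a1 t * y + a0 t)); trivial. apply is_derive_const_R.
    auto_derive; trivial. ring. }
  apply is_derive_unique in A. rewrite <- A. apply is_derive_unique.
  apply is_derive_ext_loc with (fun y => / Derive T t * (a1 t * u t y + Derive a1 t * y + Derive a0 t)).
  - apply filter_imp with (2 := Lx). intros y Hy. symmetry. now apply ET.
  - replace (/ Derive T t * (a1 t * dx u t x + Derive a1 t)) with
      (0 * (a1 t * u t x + Derive a1 t * x + Derive a0 t) + / Derive T t * ((0 * u t x + a1 t * dx u t x) + (0 * x + Derive a1 t * 1) + 0)) by ring.
    apply (is_derive_mult_R (fun _ => / Derive T t) (fun y => a1 t * u t y + Derive a1 t * y + Derive a0 t)).
    apply is_derive_const_R. apply is_derive_plus_R; [apply is_derive_plus_R|].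
    + apply (is_derive_mult_R (fun _ => a1 t) (fun y => u t y)); trivial. apply is_derive_const_R.
    + apply (is_derive_mult_R (fun _ => Derive a1 t) (fun y => y)); trivial. apply is_derive_const_R. apply is_derive_id_R.
    + apply is_derive_const_R. }
assert (Vt : dt v (T t) (a1 t * x + a0 t) * Derive T t + dx v (T t) (a1 t * x + a0 t) * (Derive a1 t * x + Derive a0 t)
  = / Derive T t * (Derive a1 t * u t x + a1 t * dt u t x + Derive (Derive a1) t * x + Derive (Derive a0) t)
    - Derive (Derive T) t / Derive T t ^ 2 * (a1 t * u t x + Derive a1 t * x + Derive a0 t)).
{ assert (A : is_derive (fun s => v (T s) (a1 s * x + a0 s)) t
    (dt v (T t) (a1 t * x + a0 t) * Derive T t + dx v (T t) (a1 t * x + a0 t) * (Derive a1 t * x + Derive a0 t))).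
  { apply (smooth2_chain_t D' v T (fun s => a1 s * x + a0 s)); auto.
    replace (Derive a1 t * x + Derive a0 t) with (Derive a1 t * x + a1 t * 0 + Derive a0 t) by ring.
    apply is_derive_plus_R; auto. apply (is_derive_mult_R a1 (fun _ => x)); auto. apply is_derive_const_R. }
  apply is_derive_unique in A. rewrite <- A. apply is_derive_unique.
  apply is_derive_ext_loc with (fun s => / Derive T s * (a1 s * u s x + Derive a1 s * x + Derive a0 s)).
  - apply filter_imp with (2 := Lt). intros s Hs. symmetry. now apply ET.
  - apply (is_derive_affine_quotient (Derive T) a1 (Derive a1) (Derive a0) (fun s => u s x)); trivial;
      apply dd; trivial; now apply smooth1_Derive. }
assert (V5 : a1 t ^ 5 * Derive_n (fun y => v (T t) y) 5 (a1 t * x + a0 t) = / Derive T t * a1 t * Derive_n (fun y => u t y) 5 x).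
{ rewrite <- (Derive_n_affine_arg (fun y => D' (T t, y))); trivial.
  - rewrite <- (Derive_n5_plus_affine (fun y => D (t, y)) _ _ (/ Derive T t * Derive a1 t) (/ Derive T t * Derive a0 t)); trivial.
    + apply Derive_n_ext_loc. apply filter_imp with (2 := Lx). intros y Hy. destruct (ET t y Hy) as [_ [_ ->]]. ring.
    + now apply open_slice.
    + now apply (smooth2_slice_x _ D).
  - now apply open_slice.
  - now apply (smooth2_slice_x _ D'). }
(* The factor xi1 / tau'^2 is nonzero, so both residuals vanish together. *)
assert (K : residual E' v (T t) (a1 t * x + a0 t) = a1 t / Derive T t ^ 2 * residual E u t x).
{ unfold residual. rewrite E3.
  set (vx := dx v (T t) (a1 t * x + a0 t)) in *. set (vt := dt v (T t) (a1 t * x + a0 t)) in *.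
  set (v5 := Derive_n (fun y => v (T t) y) 5 (a1 t * x + a0 t)) in *.
  set (u5 := Derive_n (fun y => u t y) 5 x) in *.
  set (u1 := dx u t x) in *. set (u2 := dt u t x) in *.
  assert (Ea : alpha E' (T t) = (alpha E t - 2 * (Derive a1 t / a1 t) + Derive (Derive T) t / Derive T t) / Derive T t)
    by (rewrite <- R2; field; trivial).
  assert (Eb : beta E' (T t) = a1 t ^ 5 * beta E t / Derive T t) by (rewrite <- R1; field; trivial).
  assert (Ev : vx = / Derive T t * (a1 t * u1 + Derive a1 t) / a1 t) by (rewrite <- Vx; field; trivial).
  assert (E5 : v5 = / Derive T t * a1 t * u5 / a1 t ^ 5) by (rewrite <- V5; field; trivial).
  rewrite R3, R4, Ev in Vt.
  assert (Et : vt = (/ Derive T t * (Derive a1 t * u t x + a1 t * u2 + (2 * (Derive a1 t / a1 t) - alpha E t) * Derive a1 t * x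
    + (2 * (Derive a1 t / a1 t) - alpha E t) * Derive a0 t)
    - Derive (Derive T) t / Derive T t ^ 2 * (a1 t * u t x + Derive a1 t * x + Derive a0 t)
    - / Derive T t * (a1 t * u1 + Derive a1 t) / a1 t * (Derive a1 t * x + Derive a0 t)) / Derive T t)
    by (rewrite <- Vt; field; now split).
  rewrite Et, Ev, E5, Ea, Eb. field. now split. }
rewrite K. assert (NN : a1 t / Derive T t ^ 2 <> 0).
{ apply Rmult_integral_contrapositive; split; trivial. apply Rinv_neq_0_compat. now apply pow_nonzero. }
split.
- intros ->. ring.
- intro Z. apply Rmult_integral in Z. tauto.
Qed.

Lemma normal_form_point_transformation E phi E' : in_class E -> has_normal_form E phi E' ->
  point_transformation phi.
Proof.
intros [[Ho [[t0 Ht0] _]] _] [T [a1 [a0 [[ST [S1 [S0 H]]] [_ [HO HF]]]]]].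
assert (Oo : open (Omega phi)).
{ apply open_ext with (2 := open_strip (dom E) Ho). intros [[t x] u]. symmetry. apply HO. }
assert (lift : forall f k, smooth1 (dom E) f -> Ck3 k (Omega phi) (fun t _ _ => f t)).
{ intros f k Hf. apply Ck3_sub with (2 := Ck3_of_smooth1 k (dom E) f Ho Hf). intros [[t x] u]. apply HO. }
split; [exact Oo|]. split; [exists (t0, 0, 0); now apply HO|]. split; [|split; [|split]].
- intro k. apply (Ck3_ext _ Oo) with (fun t _ _ => T t). intros t x u Hp. symmetry. apply HF. now apply HO in Hp.
  now apply lift.
- intro k. apply (Ck3_ext _ Oo) with (fun t x _ => a1 t * x + a0 t).
  intros t x u Hp. symmetry. apply HF. now apply HO in Hp.
  apply Ck3_plus; auto. apply Ck3_mult; auto. now apply Ck3_pr_x.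
- intro k. apply (Ck3_ext _ Oo) with (fun t x u => / Derive T t * (a1 t * u + Derive a1 t * x + Derive a0 t)).
  intros t x u Hp. symmetry. apply HF. now apply HO in Hp.
  apply Ck3_mult; auto. apply lift. apply smooth1_inv; trivial. intros; now apply H. now apply smooth1_Derive.
  repeat apply Ck3_plus; try apply Ck3_mult; auto.
  now apply Ck3_pr_u. apply lift, smooth1_Derive; trivial. now apply Ck3_pr_x. apply lift, smooth1_Derive; trivial.
- intros t x u Hp. apply HO in Hp. destruct (H t Hp) as [N [M _]].
  assert (dT : dt3 (Tt phi) t x u = Derive T t).
  { apply (Derive_near (dom E)); trivial. intros s Hs. now apply HF. }
  assert (Tx : dx3 (Tt phi) t x u = 0).
  { unfold dx3. rewrite (Derive_ext _ (fun _ => T t)). apply is_derive_unique, is_derive_const_R. intro y. now apply HF. }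
  assert (Tu : du3 (Tt phi) t x u = 0).
  { unfold du3. rewrite (Derive_ext _ (fun _ => T t)). apply is_derive_unique, is_derive_const_R. intro y. now apply HF. }
  assert (Xu : du3 (Xt phi) t x u = 0).
  { unfold du3. rewrite (Derive_ext _ (fun _ => a1 t * x + a0 t)). apply is_derive_unique, is_derive_const_R. intro y. now apply HF. }
  assert (Xx : dx3 (Xt phi) t x u = a1 t).
  { unfold dx3. rewrite (Derive_ext _ (fun y => a1 t * y + a0 t)) by (intro y; now apply HF).
    apply is_derive_unique. auto_derive; trivial. ring. }
  assert (Uu : du3 (Ut phi) t x u = / Derive T t * a1 t).
  { unfold du3. rewrite (Derive_ext _ (fun z => / Derive T t * (a1 t * z + Derive a1 t * x + Derive a0 t))) by (intro y; now apply HF).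
    apply is_derive_unique. auto_derive; trivial. ring. }
  unfold jacobian. cbv zeta. rewrite dT, Tx, Tu, Xu, Xx, Uu. intro Z.
  assert (Y : a1 t * a1 t = 0) by (rewrite <- Z; field; trivial).
  apply Rmult_integral in Y. tauto.
Qed.

Lemma normal_form_admissible E phi E' : in_class E -> has_normal_form E phi E' -> admissible E phi E'.
Proof.
intros HE HN. split; [exact HE|]. split; [|split; [|split]].
- assert (HE' := HE). destruct HE' as [[Ho _] [Sa [Sb Nb]]].
  destruct HN as [T [a1 [a0 [[ST [S1 [S0 H]]] [HD [HO HF]]]]]].
  apply (in_class_image E E' T
    (fun t => (alpha E t - 2 * (Derive a1 t / a1 t) + Derive (Derive T) t / Derive T t) * / Derive T t)
    (fun t => a1 t ^ 5 * beta E t * / Derive T t)); trivial.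
  + intros; now apply H.
  + assert (I1 : smooth1 (dom E) (fun t => / Derive T t)).
    { apply smooth1_inv; trivial. intros; now apply H. now apply smooth1_Derive. }
    apply smooth1_mult; trivial. apply smooth1_plus; trivial. apply smooth1_minus; trivial.
    * apply smooth1_mult; trivial. apply smooth1_const. apply smooth1_mult; trivial. now apply smooth1_Derive.
      apply smooth1_inv; trivial. intros; now apply H.
    * apply smooth1_mult; trivial. now apply smooth1_Derive, smooth1_Derive.
  + apply smooth1_mult; trivial. apply smooth1_mult; trivial. now apply smooth1_pow.
    apply smooth1_inv; trivial. intros; now apply H. now apply smooth1_Derive.
  + intros t Ht. destruct (H t Ht) as [N [M _]].
    apply Rmult_integral_contrapositive; split; [|now apply Rinv_neq_0_compat].
    apply Rmult_integral_contrapositive; split; [now apply pow_nonzero | now apply Nb].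
  + intros t Ht. destruct (H t Ht) as [N [M [R1 [R2 _]]]]. rewrite <- R1, <- R2. split; field; trivial.
- now apply (normal_form_point_transformation E phi E').
- destruct HN as [T [a1 [a0 [_ [HD [HO HF]]]]]]. intros t x u Hp. apply HO in Hp. split; trivial.
  apply HD. exists t. split; trivial. now apply HF.
- now apply normal_form_maps.
Qed.

(** The induction continues from the intermediate equation, whose membership in the class is part of
    the admissibility of the first generator. *)
Lemma acts_normal_form w E phi E' : in_class E -> acts w E phi E' -> has_normal_form E phi E'.
Proof.
revert E phi. induction w as [|g w IH]; intros E phi HE H.
- destruct H as [-> ->]. now apply identity_normal_form.
- destruct H as [phi1 [E1 [phi2 [H1 [H2 ->]]]]].
  assert (N1 := generator_normal_form g E phi1 E1 HE H1).
  assert (HE1 : in_class E1) by apply (normal_form_admissible E phi1 E1 HE N1).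
  apply compose_normal_form with E1; auto.
Qed.

Theorem theorem1 :
  (* the displayed formulas transform every equation of the class into an
     equation of the class *)
  (forall (g : parameters) (E : equation) (A B : R -> R),
     in_class E -> regular g E A B ->
     exists E' : equation, in_class E' /\ elements_part g E B E') /\
  (* every element of the group is an equivalence transformation: for each
     equation it is an admissible transformation *)
  (forall (w : group_element) (E : equation) (phi : transformation) (E' : equation),
     in_class E -> acts w E phi E' -> admissible E phi E') /\
  (* conversely, every equivalence transformation comes from the group *)
  (forall G : equation -> transformation * equation,
     equivalence_transformation G ->
     forall E : equation, in_class E -> generated E (fst (G E)) (snd (G E))) /\
  (* the group generates the entire set of admissible transformations *)
  (forall (E : equation) (phi : transformation) (E' : equation),
     admissible E phi E' -> generated E phi E').
Proof.
split; [exact elements_exist|]. split; [|split].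
- intros w E phi E' HE H. apply normal_form_admissible; trivial. now apply acts_normal_form with w.
(* Evaluated at a single equation, an equivalence transformation is an admissible transformation. *)
- intros G HG E HE. apply admissible_generated. now apply HG.
- exact admissible_generated.
Qed.
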